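(* Fix $\varepsilon>0$. Let $G$ be an $n$-vertex graph with vertex set $V$ and maximum degree $\Delta_G\le D\le n$. Let the lists $L_v$ $(v\in V)$ be drawn independently, each uniformly from the $\min\{\lceil(1+\varepsilon)\log n\rceil,\,D+1\}$-element subsets of $\Gamma=[D+1]=\{1,\dots,D+1\}$. Then with probability tending to $1$ as $n\to\infty$ (uniformly over all such $D$ and $G$), $G$ is $L$-colorable.
   Context: Graphs are finite and simple; $\log$ is the natural logarithm. For $L=(L_v:v\in V)$ with $L_v\subseteq\Gamma$, an $L$-coloring of $G$ is a proper vertex coloring $\sigma$ of $G$ with $\sigma_v\in L_v$ for all $v\in V$; $G$ is $L$-colorable if an $L$-coloring exists. *)

(* Defs.v *)
From HB Require Import structures.
From mathcomp Require Import all_boot all_order all_algebra.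
From mathcomp Require Import reals exp.

Set Implicit Arguments.
Unset Strict Implicit.
Unset Printing Implicit Defensive.

Import Order.TTheory GRing.Theory Num.Theory.

Local Open Scope ring_scope.

Definition simple_graph (V : finType) (adj : rel V) : Prop :=
  symmetric adj /\ irreflexive adj.

Definition max_degree (V : finType) (adj : rel V) : nat :=
  (\max_(v : V) #|[set w | adj v w]|)%N.

Definition proper_coloring (V C : finType) (adj : rel V)
    (sigma : {ffun V -> C}) : bool :=
  [forall u, forall v, adj u v ==> (sigma u != sigma v)].

Definition list_coloring (V C : finType) (adj : rel V)
    (L : {ffun V -> {set C}}) (sigma : {ffun V -> C}) : bool :=
  proper_coloring adj sigma && [forall v, sigma v \in L v].

Definition list_colorable (V C : finType) (adj : rel V)
    (L : {ffun V -> {set C}}) : bool :=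
  [exists sigma : {ffun V -> C}, list_coloring adj L sigma].

Definition uniform_mass (R : realType) (X : finType) (A : {set X}) (x : X) : R :=
  if x \in A then #|A|%:R^-1 else 0.

(* Probability of the event [E] when the coordinates [f i] are independent with
   mass functions [p i], i.e. under the product of the laws [p i]. *)
Definition prob_indep (R : realType) (I X : finType) (p : I -> X -> R)
    (E : pred {ffun I -> X}) : R :=
  \sum_(f : {ffun I -> X} | E f) \prod_(i : I) p i (f i).

(* The ceiling is nonnegative for [0 < n], so [absz] only casts it to nat. *)
Definition list_size (R : realType) (eps : R) (n D : nat) : nat :=
  minn `|Num.ceil ((1 + eps) * ln n%:R)|%N D.+1.

(* The D + 1 colors are the elements 0, ..., D of ['I_D.+1]. *)
Definition k_subsets (D k : nat) : {set {set 'I_D.+1}} :=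
  [set S : {set 'I_D.+1} | #|S| == k].

Definition prob_list_colorable (R : realType) (eps : R) (D : nat) (V : finType)
    (adj : rel V) : R :=
  prob_indep
    (fun _ : V => uniform_mass R (k_subsets D (list_size eps #|V| D)))
    (fun L => list_colorable adj L).

(* Main.v *)
(** Replace each list by [k] independent uniform colors; filling up the resulting set at
    random gives a uniform [k]-set, so it suffices to color from the draws.  Let
    [N = D + 1].  Peel off clusters of almost [N] vertices that are almost complete,
    until each remaining vertex has either fewer than [(1 - z) N] remaining neighbors or
    a neighborhood missing at least [z N ^ 2] adjacencies.

    In the remainder, color each vertex by its first draw and keep the colors without
    conflict.  A locally sparse vertex then sees many colors twice (bounded differences),
    at all such vertices at once up to resampling, which leaves it linearly many
    available colors.  The uncolored vertices are treated one at a time, each by a free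
    color if it draws one, or else by a color whose few holders are uncolored once; a
    supermartingale bounds the probability of running out of colors.

    A cluster [C] is colored last, each of its vertices avoiding the colors of its outside
    neighbors.  If many vertices have at least [m] non-neighbors in [C], a few of the
    draws give disjoint nonadjacent pairs in [C] sharing colors, which makes up for the
    forbidden colors; the rest of [C] is matched to distinct colors by Hall's theorem.
    The matching fails essentially only when some colors are missed by all vertices, so
    with probability [O(N n ^ - (1 + eps / 4))], and there are [O(n / N)] clusters. *)
Require Import Defs.
From HB Require Import structures.
From mathcomp Require Import all_boot all_order all_algebra.
From mathcomp Require Import reals exp.
From mathcomp Require Import perm sequences ring lra zify.

Set Implicit Arguments.
Unset Strict Implicit.
Unset Printing Implicit Defensive.

Import Order.TTheory GRing.Theory Num.Theory.

Local Open Scope ring_scope.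

(** * Uniform product measures *)

(** The delicate range is [N] of order [log n]. There [exp (- c N)] with a small constant [c] is
    only a small negative power of [n], and a union bound over the vertices fails. For locally
    sparse vertices this is repaired by resampling: a constant number [r] of rounds raises the
    failure probability to a power [r] of order [1 / c], at the price of [r + 1] draws per vertex,
    which is negligible against [eps log n]. In the cluster stage most other exponents can be made
    as large as desired by choosing constants. The exception is the coupon collector's exponent
    [k |C| / N] of a color missed by a whole cluster: every loss there must fit into [eps], which
    dictates the multiples of [eps / 64] below.

    Randomness is always a uniform function on a finite index set. Each stage owns a block of
    coordinates, so independence is disjointness of blocks and conditioning is [mix]. Estimates for
    a cluster hold for all forbidden sets within given size bounds, hence conditionally on any
    coloring outside. In the asymptotic statements [L] plays the role of [log n]. *)

Lemma eq_leW (R : realType) (x y : R) : x = y -> x <= y.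
Proof. by move=> ->. Qed.

Lemma double_count (S T : finType) (P : pred S) (Q : pred T) (r : S -> T -> bool) :
  (\sum_(x | P x) #|[set y | Q y && r x y]| = \sum_(y | Q y) #|[set x | P x && r x y]|)%N.
Proof.
have E (A : finType) (B : pred A) : #|[set x | B x]| = (\sum_x B x)%N.
  by rewrite cardsE -sum1_card big_mkcond.
under eq_bigr do rewrite E; under [RHS]eq_bigr do rewrite E.
rewrite exchange_big [RHS]big_mkcond /=; apply: eq_bigr => y _; rewrite big_mkcond.
by case: (Q y) => /=; [apply: eq_bigr => x _; case: (P x) | rewrite big1 // => x _; case: ifP].
Qed.

Lemma card_bigcup_le (S T : finType) (A : {set S}) (F : S -> {set T}) (n : nat) :
  (forall x, x \in A -> (#|F x| <= n)%N) -> (#|\bigcup_(x in A) F x| <= #|A| * n)%N.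
Proof.
move=> Fn; rewrite -sum_nat_const; elim/big_rec2: _ => [|x m B xA Bm]; first by rewrite cards0.
by apply: leq_trans (leq_card_setU _ _) (leq_add (Fn x xA) Bm).
Qed.

Lemma subset_leq_card_ex (T : finType) (A : {set T}) (m : nat) : (m <= #|A|)%N ->
  exists2 B : {set T}, B \subset A & #|B| = m.
Proof.
move=> mA; exists [set x in take m (enum A)].
  by apply/subsetP => x; rewrite inE => /mem_take; rewrite mem_enum.
rewrite cardsE (card_uniqP _) ?take_uniq ?enum_uniq // size_takel // -cardE //.
Qed.

Section UniformProduct.
Variables (R : realType) (I X : finType).
Hypothesis X_gt0 : (0 < #|X|)%N.

Local Notation Om := {ffun I -> X}.

Definition Ex (f : Om -> R) : R := (\sum_w f w) / #|{: Om}|%:R.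

Definition Pr (E : pred Om) : R := Ex (fun w => (E w)%:R).

Definition mix (J : {set I}) (a b : Om) : Om :=
  [ffun i => if i \in J then a i else b i].

Definition depends_on (T : Type) (J : {set I}) (f : Om -> T) :=
  forall a b : Om, {in J, a =1 b} -> f a = f b.

Lemma card_Om_gt0 : (0 : R) < #|{: Om}|%:R.
Proof. by rewrite card_ffun ltr0n expn_gt0 X_gt0. Qed.

Lemma card_Om_neq0 : #|{: Om}|%:R != 0 :> R.
Proof. by rewrite gt_eqF // card_Om_gt0. Qed.

Lemma eq_Ex f g : f =1 g -> Ex f = Ex g.
Proof. by move=> fg; rewrite /Ex; congr (_ / _); apply: eq_bigr. Qed.

Lemma le_Ex f g : (forall w, f w <= g w) -> Ex f <= Ex g.
Proof.
move=> fg; rewrite /Ex ler_pM2r ?invr_gt0 ?card_Om_gt0 //.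
by apply: ler_sum => w _.
Qed.

Lemma Ex_cst c : Ex (fun=> c) = c.
Proof.
rewrite /Ex sumr_const -[X in X / _]mulr_natr -mulrA.
by rewrite divff ?mulr1 // card_Om_neq0.
Qed.

Lemma ExD f g : Ex (fun w => f w + g w) = Ex f + Ex g.
Proof. by rewrite /Ex big_split /= mulrDl. Qed.

Lemma ExZ c f : Ex (fun w => c * f w) = c * Ex f.
Proof. by rewrite /Ex -mulr_sumr mulrA. Qed.

Lemma ExZr c f : Ex (fun w => f w * c) = Ex f * c.
Proof. by rewrite mulrC -ExZ; apply: eq_Ex => w; rewrite mulrC. Qed.

Lemma ExN f : Ex (fun w => - f w) = - Ex f.
Proof. by rewrite /Ex sumrN mulNr. Qed.

Lemma ExB f g : Ex (fun w => f w - g w) = Ex f - Ex g.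
Proof. by rewrite ExD ExN. Qed.

Lemma Ex_sum (J : Type) (r : seq J) (P : pred J) (F : J -> Om -> R) :
  Ex (fun w => \sum_(j <- r | P j) F j w) = \sum_(j <- r | P j) Ex (F j).
Proof. by rewrite /Ex exchange_big /= mulr_suml. Qed.

Lemma Ex_ge0 f : (forall w, 0 <= f w) -> 0 <= Ex f.
Proof. by move=> f0; rewrite -(Ex_cst 0); apply: le_Ex. Qed.

Lemma mixK (J : {set I}) (a b : Om) : mix J (mix J a b) (mix J b a) = a.
Proof. by apply/ffunP => i; rewrite !ffunE; case: ifP => //= ->. Qed.

Lemma mix_in (J : {set I}) (a b : Om) : {in J, mix J a b =1 a}.
Proof. by move=> i iJ; rewrite ffunE iJ. Qed.

Lemma mix_out (J : {set I}) (a b : Om) : {in ~: J, mix J a b =1 b}.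
Proof. by move=> i; rewrite inE ffunE => /negbTE ->. Qed.

Lemma mixC (J : {set I}) (a b : Om) : mix (~: J) a b = mix J b a.
Proof. by apply/ffunP => i; rewrite !ffunE inE; case: (i \in J). Qed.

(** Exchanging the coordinates in [J] of two samples is an involution on pairs of samples. The inner
    average is the conditional expectation given the coordinates outside [J], and this is the only
    form of conditioning used. *)
Lemma Ex_mix (J : {set I}) (f : Om -> R) : Ex (fun b => Ex (fun a => f (mix J a b))) = Ex f.
Proof.
rewrite /Ex -mulr_suml.
have -> : \sum_b \sum_a f (mix J a b) = \sum_(b : Om) \sum_(a : Om) f a.
  rewrite !pair_big /=.
  have swK : involutive (fun p : Om * Om => (mix J p.1 p.2, mix J p.2 p.1)).
    by case=> a b /=; rewrite !mixK.
  rewrite [RHS](reindex_inj (inv_inj swK)) /=.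
  have sK : involutive (fun p : Om * Om => (p.2, p.1)) by case.
  rewrite (reindex_inj (inv_inj sK)) /= [RHS](reindex_inj (inv_inj sK)) /=.
  by rewrite (reindex_inj (inv_inj sK)) /=.
rewrite sumr_const -[X in X / _ / _]mulr_natr -!mulrA.
by congr (_ * _); rewrite mulrA divff ?mul1r // card_Om_neq0.
Qed.

Lemma depends_mix (T : Type) (J : {set I}) (f : Om -> T) a b :
  depends_on J f -> f (mix J a b) = f a.
Proof. by move=> df; apply: df; apply: mix_in. Qed.

Lemma depends_mixC (T : Type) (J : {set I}) (f : Om -> T) a b :
  depends_on (~: J) f -> f (mix J a b) = f b.
Proof. by move=> df; apply: df; apply: mix_out. Qed.

Lemma Ex_indep (J : {set I}) (f g : Om -> R) : depends_on J f -> depends_on (~: J) g ->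
  Ex (fun w => f w * g w) = Ex f * Ex g.
Proof.
move=> df dg; rewrite -(Ex_mix J).
rewrite -[RHS]ExZ; apply: eq_Ex => b.
rewrite -ExZr; apply: eq_Ex => a.
by rewrite (depends_mix _ _ df) (depends_mixC _ _ dg).
Qed.

Lemma PrE (E : pred Om) : Pr E = #|E|%:R / #|{: Om}|%:R.
Proof.
rewrite /Pr /Ex; congr (_ / _).
rewrite -sum1_card natr_sum [RHS]big_mkcond /=; apply: eq_bigr => w _.
by rewrite unfold_in; case: (E w).
Qed.

Lemma Pr_ge0 E : 0 <= Pr E.
Proof. by apply: Ex_ge0 => w; rewrite ler0n. Qed.

Lemma eq_Pr (E F : pred Om) : E =1 F -> Pr E = Pr F.
Proof. by move=> EF; apply: eq_Ex => w; rewrite EF. Qed.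

Lemma le_Pr (E F : pred Om) : (forall w, E w -> F w) -> Pr E <= Pr F.
Proof.
move=> EF; apply: le_Ex => w; rewrite ler_nat.
by case: (E w) (EF w) => // /(_ isT) ->.
Qed.

Lemma Pr_le1 E : Pr E <= 1.
Proof.
by rewrite -[leRHS](Ex_cst 1); apply: le_Ex => w; rewrite (ler_nat _ _ 1); case: (E w).
Qed.

Lemma Pr_eq0 E : (forall w, ~~ E w) -> Pr E = 0.
Proof. by move=> E0; rewrite -(Ex_cst 0); apply: eq_Ex => w; rewrite (negbTE (E0 w)). Qed.

Lemma PrC (E : pred Om) : Pr (fun w => ~~ E w) = 1 - Pr E.
Proof.
rewrite -[1 in RHS](Ex_cst 1) -ExB; apply: eq_Ex => w.
by case: (E w); rewrite /= ?subrr ?subr0.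
Qed.

Lemma Pr_markov (E : pred Om) (f : Om -> R) :
  (forall w, 0 <= f w) -> (forall w, E w -> 1 <= f w) -> Pr E <= Ex f.
Proof.
by move=> f0 Ef; apply: le_Ex => w; case: (E w) (Ef w) => [->|_] //; apply: f0.
Qed.

Lemma Pr_bigU (J : eqType) (r : seq J) (E : pred Om) (F : J -> pred Om) :
  (forall w, E w -> exists2 j, j \in r & F j w) ->
  Pr E <= \sum_(j <- r) Pr (F j).
Proof.
move=> EF; rewrite -Ex_sum; apply: Pr_markov => [w|w /EF [j jr Fj]].
  by apply: sumr_ge0 => j _; rewrite ler0n.
by rewrite (big_rem j) //= Fj lerDl; apply: sumr_ge0 => *; rewrite ler0n.
Qed.

Lemma PrU (E F : pred Om) : Pr (fun w => E w || F w) <= Pr E + Pr F.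
Proof.
rewrite -ExD; apply: le_Ex => w; rewrite -natrD ler_nat.
by case: (E w); case: (F w).
Qed.

Lemma Pr_cond (J : {set I}) (E : pred Om) (p : R) :
  (forall b, Pr (fun a => E (mix J a b)) <= p) -> Pr E <= p.
Proof.
move=> Ep; rewrite /Pr -(Ex_mix J) -[leRHS](Ex_cst p).
by apply: le_Ex => b; apply: Ep.
Qed.

Lemma Pr_forall (J : {set I}) (A : I -> {set X}) :
  Pr (fun w => [forall (i | i \in J), w i \in A i]) =
  \prod_(i in J) (#|A i|%:R / #|X|%:R).
Proof.
have X0 : #|X|%:R != 0 :> R by rewrite pnatr_eq0 -lt0n.
rewrite PrE card_ffun.
pose B i := if i \in J then A i else setT.
have -> : #|(fun w : Om => [forall (i | i \in J), w i \in A i])| = #|family (fun i => mem (B i))|.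
  apply: eq_card => w; rewrite unfold_in; apply/forallP/familyP => h i; have := h i.
    by rewrite /B; case: ifP => //= _ _; rewrite inE.
  by rewrite /B; case: ifP.
have -> : #|family (fun i => mem (B i))|%:R = \prod_i #|B i|%:R :> R.
  transitivity (\prod_i \sum_(x in B i) (1 : R)).
    by rewrite bigA_distr_big_dep /= -sum1_card natr_sum; apply: eq_bigr => f _; rewrite big1.
  by apply: eq_bigr => i _; rewrite sumr_const.
rewrite natrX -[X in _ / X]prodr_const -prodf_div [RHS]big_mkcond /=.
apply: eq_bigr => i _; rewrite /B; case: ifP => // _.
by rewrite cardsT divff.
Qed.

Lemma expR_le_quad (z : R) : `|z| <= 1 -> expR z <= 1 + z + 2 * z ^+ 2.
Proof.
rewrite ler_norml => /andP[zm z1].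
have h : expR (- (z / 2)) >= 1 - z / 2 by have := expR_ge1Dx (- (z / 2)).
have e0 := expR_gt0 (- (z / 2)).
have -> : expR z = (expR (- (z / 2))) ^- 2.
  by rewrite -exprVn -expRN opprK -expRM_natl; congr expR; field.
set e := expR _ in h e0 *.
have h2 : 1 - z / 2 >= 1 / 2 by lra.
have : (1 - z / 2) ^+ 2 <= e ^+ 2 by rewrite ler_sqr ?nnegrE; lra.
move=> h3; rewrite invf_ple ?posrE; [|nra|nra].
apply: le_trans h3; rewrite -div1r ler_pdivrMr; [|nra].
(* This product is exactly [(1 + z + 2 z^2) (1 - z / 2)^2 - 1]. *)
have : 0 <= z ^+ 2 * ((1 - z) * (5 / 4 - z / 2)).
  by apply: mulr_ge0; [exact: sqr_ge0 | apply: mulr_ge0; lra].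
nra.
Qed.

Lemma Ex_le_dist f (b : R) : (forall a c, `|f a - f c| <= b) -> forall a, `|f a - Ex f| <= b.
Proof.
move=> fb a; rewrite ler_norml -[Ex f in X in X && _]opprK.
apply/andP; split.
  rewrite opprK lerBrDr addrC -lerBrDr opprK -(Ex_cst (f a + b)); apply: le_Ex => c.
  by have := fb a c; rewrite ler_norml; lra.
rewrite lerBlDr addrC -lerBlDr -(Ex_cst (f a - b)); apply: le_Ex => c.
by have := fb a c; rewrite ler_norml; lra.
Qed.

(** Hoeffding's lemma with a cruder constant: after centering, the linear term of [expR_le_quad] has
    mean zero, and every value lies within [b] of the mean. *)
Lemma mgf_range f (b l : R) : 0 <= l -> l * b <= 1 ->
  (forall a c, `|f a - f c| <= b) ->
  Ex (fun a => expR (- l * f a)) <= expR (- l * Ex f + 2 * l ^+ 2 * b ^+ 2).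
Proof.
move=> l0 lb fb; rewrite expRD.
have -> : Ex (fun a => expR (- l * f a)) =
          expR (- l * Ex f) * Ex (fun a => expR (- l * (f a - Ex f))).
  by rewrite -ExZ; apply: eq_Ex => a; rewrite -expRD; congr expR; ring.
rewrite ler_pM2l ?expR_gt0 //.
apply: (@le_trans _ _ (Ex (fun a => (1 + 2 * l ^+ 2 * b ^+ 2) - l * (f a - Ex f)))).
  apply: le_Ex => a; have ha := Ex_le_dist fb a.
  have hz : `|- l * (f a - Ex f)| <= 1.
    by rewrite normrM normrN (ger0_norm l0); apply: le_trans lb; rewrite ler_wpM2l.
  apply: le_trans (expR_le_quad hz) _.
  rewrite [leRHS](_ : _ = 1 + - l * (f a - Ex f) + 2 * (l ^+ 2 * b ^+ 2)); last by ring.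
  rewrite lerD2l ler_pM2l // exprMn sqrrN ler_wpM2l ?sqr_ge0 //.
  have b0 : 0 <= b by apply: le_trans ha.
  by rewrite -real_normK ?num_real // ler_sqr ?nnegrE.
rewrite ExB Ex_cst ExZ ExB Ex_cst subrr mulr0 subr0.
exact: expR_ge1Dx.
Qed.

(** The bounded differences inequality as a bound on the exponential moment, with the coordinates
    outside [J] frozen at [w]. The conditional form matters because neighbors and outer vertices
    will be exposed in two separate rounds. *)
Lemma mgf_bounded_diff (J : {set I}) (b : I -> R) (l : R) (f : Om -> R) :
  0 <= l -> (forall i, i \in J -> l * b i <= 1) ->
  (forall i, i \in J -> forall a c : Om, (forall j, j != i -> a j = c j) ->
     `|f a - f c| <= b i) ->
  forall w, Ex (fun a => expR (- l * f (mix J a w))) <=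
    expR (- l * Ex (fun a => f (mix J a w)) + 2 * l ^+ 2 * \sum_(i in J) b i ^+ 2).
Proof.
move=> l0; have [n] := ubnP #|J|; elim: n J => // n IH J Jn lb fb w.
have [->|[i0 i0J]] := set_0Vmem J.
  rewrite big_set0 mulr0 addr0.
  have e a : mix set0 a w = w by apply/ffunP => i; rewrite ffunE inE.
  under eq_Ex do rewrite e.
  by under [X in _ <= expR (_ * X)]eq_Ex do rewrite e; rewrite !Ex_cst.
pose J' := J :\ i0.
have mm a c : mix J (mix [set i0] a c) w = mix J' c (mix [set i0] a w).
  apply/ffunP => i; rewrite !ffunE !inE.
  by have [->|] := eqVneq i i0; rewrite ?i0J ?if_same.
(* [F a] is the conditional mean given the coordinate [i0]; the induction hypothesis treats the
   inner average and [mgf_range] the outer one. *)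
pose F a := Ex (fun c => f (mix J' c (mix [set i0] a w))).
have EF : Ex (fun a => f (mix J a w)) = Ex F.
  rewrite -(Ex_mix (~: [set i0])) /F; apply: eq_Ex => a; apply: eq_Ex => c.
  by rewrite mixC mm.
rewrite EF (big_setD1 i0) //= mulrDr addrA addrAC.
rewrite -(Ex_mix (~: [set i0])) /=.
apply: (@le_trans _ _ (Ex (fun a => expR (- l * F a + 2 * l ^+ 2 * \sum_(i in J') b i ^+ 2)))).
  apply: le_Ex => a.
  under eq_Ex do rewrite mixC mm.
  apply: IH.
  - by move: Jn; rewrite (cardsD1 i0) i0J.
  - by move=> i /setD1P[_ iJ]; apply: lb.
  - by move=> i /setD1P[_ iJ]; apply: fb.
rewrite [leLHS](eq_Ex (fun a => expRD _ _)).
rewrite ExZr addrAC [leRHS]expRD ler_pM2r ?expR_gt0 //.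
apply: mgf_range => //; first exact: lb.
move=> a c; rewrite /F -ExB.
apply: le_trans (_ : Ex (fun=> b i0) <= _); last by rewrite Ex_cst.
rewrite ler_norml -ExN; apply/andP; split; apply: le_Ex => d.
  have /(fb _ i0J) : forall j, j != i0 -> mix J' d (mix [set i0] a w) j = mix J' d (mix [set i0] c w) j.
    by move=> j ji; rewrite !ffunE !inE (negbTE ji).
  by rewrite ler_norml => /andP[].
have /(fb _ i0J) : forall j, j != i0 -> mix J' d (mix [set i0] a w) j = mix J' d (mix [set i0] c w) j.
  by move=> j ji; rewrite !ffunE !inE (negbTE ji).
by rewrite ler_norml => /andP[].
Qed.

(** * Adaptive exploration of independent coordinates *)

Section Adaptive.
Variables (St : Type) (query : St -> {set I}) (free : St -> {set I}).
Variables (delta : St -> Om -> St) (Inv : St -> Prop) (Phi : St -> R).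
Hypothesis Inv_delta : forall s w, Inv s -> Inv (delta s w).
Hypothesis delta_query : forall s, Inv s -> depends_on (query s) (delta s).
Hypothesis query_free : forall s, Inv s -> query s \subset free s.
Hypothesis free_delta : forall s w, Inv s -> free (delta s w) \subset free s :\: query s.
Hypothesis Phi_delta : forall s, Inv s -> Ex (fun w => Phi (delta s w)) <= Phi s.

(** Deferred decisions without a filtration: every step receives the same full sample [w], but reads
    it only on [query s], and [free s] contains all that may still be read later. *)
Fixpoint run (n : nat) (s : St) (w : Om) : St :=
  if n is n'.+1 then run n' (delta s w) w else s.

Lemma run_depends n s : Inv s -> depends_on (free s) (run n s).
Proof.
elim: n s => [|n IH] s Is a b ab //=.
have -> : delta s a = delta s b.
  apply: delta_query => // i iq; apply: ab.
  exact: (subsetP (query_free Is)).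
apply: IH; first exact: Inv_delta.
move=> i /(subsetP (free_delta _ Is)); rewrite inE => /andP[_]; exact: ab.
Qed.

(* A query never looks at a coordinate seen before, so conditionally on the past
   the run continues on fresh coordinates and a supermartingale stays one. *)
Lemma run_supermartingale n s : Inv s -> Ex (fun w => Phi (run n s w)) <= Phi s.
Proof.
elim: n s => [|n IH] s Is /=; first by rewrite Ex_cst.
apply: le_trans (Phi_delta Is).
rewrite -(Ex_mix (~: query s)); apply: le_Ex => b.
apply: le_trans (IH _ (Inv_delta b Is)); apply: le_Ex => a.
rewrite mixC.
have -> : delta s (mix (query s) b a) = delta s b.
  by apply: delta_query => //; apply: mix_in.
apply: eq_leW; congr Phi.
apply: run_depends; first exact: Inv_delta.
move=> i /(subsetP (free_delta _ Is)); rewrite inE => /andP[iq _].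
by rewrite ffunE (negbTE iq).
Qed.

End Adaptive.

End UniformProduct.

(** * Moser-Tardos resampling *)

Lemma mgf_bounded_diffT (R : realType) (I X : finType) (b : I -> R) (l : R) (f : {ffun I -> X} -> R) :
  (0 < #|X|)%N -> 0 <= l -> (forall i, l * b i <= 1) ->
  (forall i, forall a c : {ffun I -> X}, (forall j, j != i -> a j = c j) -> `|f a - f c| <= b i) ->
  Ex (fun a => expR (- l * f a)) <= expR (- l * Ex f + 2 * l ^+ 2 * \sum_i b i ^+ 2).
Proof.
move=> X0 l0 lb fb; have [x0 _] := card_gt0P X0.
pose w0 : {ffun I -> X} := [ffun=> x0].
have mixT (x : {ffun I -> X}) : mix setT x w0 = x by apply/ffunP => i; rewrite ffunE inE.
have := mgf_bounded_diff X0 (J := setT) l0 (fun i _ => lb i) (fun i _ => fb i) w0.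
have -> : Ex (fun a => expR (- l * f (mix setT a w0))) = Ex (fun a => expR (- l * f a)).
  by apply: eq_Ex => a; rewrite mixT.
have -> : Ex (fun a => f (mix setT a w0)) = Ex f by apply: eq_Ex => a; rewrite mixT.
by rewrite (eq_bigl xpredT) // => i; rewrite inE.
Qed.

(** * Restriction of a uniform product to a subfamily of coordinates *)

Section Pushforward.
Variables (R : realType) (U I X : finType).
Hypothesis X_gt0 : (0 < #|X|)%N.

(** By linearity it suffices to treat the indicator of one point [z], whose preimage is a box. This
    lemma moves every estimate proved for one block of draws into the full family of draws. *)
Lemma Ex_inj (h : U -> I) (f : {ffun U -> X} -> R) : injective h ->
  Ex (fun x : {ffun I -> X} => f [ffun u => x (h u)]) = Ex f.
Proof.
move=> hI.
have fE (y : {ffun U -> X}) : f y = \sum_z f z * (y == z)%:R.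
  rewrite (bigD1 y) //= eqxx mulr1 big1 ?addr0 // => z /negbTE zy.
  by rewrite eq_sym zy mulr0.
rewrite (eq_Ex (fun x => fE _)) Ex_sum [RHS]/Ex mulr_suml; apply: eq_bigr => z _.
rewrite ExZ; congr (_ * _).
pose A i := if [pick u | h u == i] is Some u then [set z u] else setT.
have Ah u : A (h u) = [set z u].
  rewrite /A; case: pickP => [v /eqP /hI -> //|/(_ u)].
  by rewrite eqxx.
transitivity (Pr R (fun x : {ffun I -> X} => [forall (i | i \in h @: setT), x i \in A i])).
  apply: eq_Ex => x; congr (_%:R); congr nat_of_bool.
  apply/eqP/forallP => [xz i|xA].
    apply/implyP => /imsetP[u _ ->]; rewrite Ah inE -xz ffunE //.
  apply/ffunP => u; rewrite ffunE.
  by have := implyP (xA (h u)) (imset_f h (in_setT u)); rewrite Ah inE => /eqP.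
rewrite Pr_forall // big_imset /=; last by move=> u v _ _; apply: hI.
under eq_bigr do rewrite Ah cards1 mul1r.
by rewrite prodr_const cardsT card_ffun natrX exprVn.
Qed.

Lemma Pr_inj (h : U -> I) (E : pred {ffun U -> X}) : injective h ->
  Pr R (fun x : {ffun I -> X} => E [ffun u => x (h u)]) = Pr R E.
Proof. by move=> hI; rewrite /Pr -(Ex_inj _ hI). Qed.

Lemma Pr_all_in (h : U -> I) (B : {set X}) : injective h ->
  Pr R (fun x : {ffun I -> X} => [forall u, x (h u) \in B]) =
  (#|B|%:R / #|X|%:R) ^+ #|U|.
Proof.
move=> hI; transitivity (Pr R (fun y : {ffun U -> X} => [forall (u | u \in setT), y u \in B])).
  rewrite -(Pr_inj _ hI); apply: eq_Ex => x; congr (_%:R); congr nat_of_bool.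
  by apply: eq_forallb => u; rewrite ffunE in_setT.
by rewrite (Pr_forall _ X_gt0 _ (fun=> B)) prodr_const cardsT.
Qed.

Lemma Pr_in (i : I) (B : {set X}) :
  Pr R (fun x : {ffun I -> X} => x i \in B) = #|B|%:R / #|X|%:R.
Proof.
transitivity (Pr R (fun x : {ffun I -> X} => [forall (j | j \in [set i]), x j \in B])).
  apply: eq_Ex => x; congr (_%:R); congr nat_of_bool; apply/idP/forall_inP => [xi j|h].
    by move/set1P->.
  by apply: h; rewrite inE.
by rewrite (Pr_forall _ X_gt0 _ (fun=> B)) big_set1.
Qed.

End Pushforward.

Lemma sum_subsets_prod (R : realType) (X : finType) (J : {set X}) (y : X -> R) :
  \sum_(T : {set X} | T \subset J) \prod_(i in T) y i = \prod_(i in J) (1 + y i).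
Proof.
transitivity (\prod_i ((if i \in J then y i else 0) + 1)).
  rewrite bigA_distr big_mkcond /=; apply: eq_bigr => T _.
  case: ifPn => [/subsetP TN|/subsetPn[i iT iN]].
    rewrite [LHS]big_mkcond; apply: eq_bigr => i _.
    by case: ifP => // /TN ->.
  by rewrite (bigD1 i) //= iT (negbTE iN) mul0r.
rewrite [RHS]big_mkcond; apply: eq_bigr => i _.
by case: ifP; rewrite ?add0r // addrC.
Qed.

Lemma sum_subsets (R : realType) (I : finType) (N : {set I}) (x : R) :
  \sum_(T : {set I} | T \subset N) x ^+ #|T| = (1 + x) ^+ #|N|.
Proof.
rewrite -prodr_const -sum_subsets_prod; apply: eq_bigr => T _.
by rewrite prodr_const.
Qed.

(* Parallel resampling with a table of fresh samples: in each round a maximal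
   family of violated events with disjoint scopes moves its scopes one level up.
   If a violation survives [k] rounds, following it backwards yields sets
   [T_0, ..., T_k] of events, and these sets determine the levels read. *)
Section Resampling.
Variables (R : realType) (U X I : finType) (k : nat).
Hypothesis X_gt0 : (0 < #|X|)%N.
Variables (S : I -> {set U}) (A : I -> pred {ffun U -> X}).
Hypothesis A_scope : forall v, depends_on (S v) (A v).

Local Notation table := {ffun U * 'I_k.+1 -> X}.

(** Cell [(u, i)] holds the [i]-th sample of the variable [u], and [l u] tells how often [u] has
    been resampled. The cast [inord] is faithful as long as levels stay at most [k]. *)
Definition table_row (l : U -> nat) (x : table) : {ffun U -> X} :=
  [ffun u => x (u, inord (l u))].

Definition cov (T : {set I}) : {set U} := \bigcup_(v in T) S v.

Definition meets (v w : I) : bool := (v == w) || ~~ [disjoint S v & S w].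

Definition indep (T : {set I}) : bool :=
  [forall v in T, forall w in T, (v != w) ==> [disjoint S v & S w]].

Definition bump_level (T : {set I}) (l : U -> nat) (u : U) : nat :=
  (l u + (u \in cov T))%N.

Definition violated (l : U -> nat) (x : table) : {set I} :=
  [set v | A v (table_row l x)].

Definition selected (l : U -> nat) (x : table) : {set I} :=
  [arg max_(M > set0 | (M \subset violated l x) && indep M) #|M|]%N.

Fixpoint level (x : table) (t : nat) : U -> nat :=
  if t is t'.+1 then bump_level (selected (level x t') x) (level x t')
  else fun=> 0%N.

(** A candidate history, earliest round first: each set must be violated at the levels produced by
    the sets before it alone. The actual run does not occur, so the probability can be computed for
    a fixed [s]. *)
Fixpoint valid (l : U -> nat) (s : seq {set I}) (x : table) : bool :=
  if s is T :: s' then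
    [forall v in T, A v (table_row l x)] && valid (bump_level T l) s' x
  else true.

Definition weight (s : seq {set I}) : nat := sumn [seq #|T : {set I}| | T <- s].

Definition unions (s : seq {set I}) : {set I} := \bigcup_(T <- s) T.

Definition meeting (T : {set I}) : {set I} :=
  [set w | [exists v in T, meets v w]].

(** Histories grow backwards in time: the new earliest set must meet some event of any later set,
    not just of the next one, so that every resampling relevant to the later events is recorded. *)
Fixpoint histories (r : nat) (s : seq {set I}) : seq (seq {set I}) :=
  if r is r'.+1 then
    flatten [seq histories r' (T :: s) | T : {set I} <-
      enum [pred T : {set I} | [&& T \subset meeting (unions s), T != set0 & indep T]]]
  else [:: s].

Lemma indep0 : indep set0.
Proof. by apply/forall_inP => v; rewrite inE. Qed.

Lemma selectedP l x : [/\ selected l x \subset violated l x, indep (selected l x) &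
  forall v, v \in violated l x -> exists2 w, w \in selected l x & meets v w].
Proof.
rewrite /selected; case: arg_maxnP => [|M /andP[MV Mi] Mm].
  by rewrite sub0set indep0.
split=> // v vV; apply/exists_inP; apply: contraT; rewrite negb_exists_in => /forall_inP nv.
have vM : v \notin M by apply/negP => /nv; rewrite /meets eqxx.
have := Mm (v |: M); rewrite /geq /= cardsU1 vM add1n ltnn => ->//.
rewrite subUset sub1set vV MV /=; apply/forall_inP => a /setU1P aM.
apply/forall_inP => b /setU1P bM; apply/implyP => ab.
case: aM bM ab => [->|aM] [->|bM] ab.
- by rewrite eqxx in ab.
- by have := nv _ bM; rewrite /meets negb_or negbK => /andP[].
- by have := nv _ aM; rewrite /meets negb_or negbK disjoint_sym => /andP[].
- by have /forall_inP/(_ _ bM)/implyP/(_ ab) := forall_inP Mi _ aM.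
Qed.

Lemma cov_meets T u v : u \in S v -> u \in cov T -> exists2 w, w \in T & (u \in S w) && meets v w.
Proof.
move=> uv /bigcupP[w wT uw]; exists w => //; rewrite uw /meets orbC.
by have -> // : ~~ [disjoint S v & S w]; apply/pred0Pn; exists u; rewrite /= uv uw.
Qed.

(** Either a selected event changed the scope of [v], or [v] was already violated and meets a
    selected event by maximality. *)
Lemma violated_step x t v : v \in violated (level x t.+1) x ->
  exists2 w, w \in selected (level x t) x & meets v w.
Proof.
have [_ _ mx] := selectedP (level x t) x => vV.
have [/exists_inP[w ws mw]|] := boolP [exists w in selected (level x t) x, meets v w].
  by exists w.
rewrite negb_exists_in => /forall_inP nv; apply: mx.
move: vV; rewrite !inE /= => Av; rewrite -(A_scope (a := table_row (level x t.+1) x)) // => u uS.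
rewrite !ffunE /= /bump_level.
have -> : u \in cov (selected (level x t) x) = false; last by rewrite addn0.
by apply/negP => /(cov_meets uS)[w /nv nw /andP[_ mw]]; rewrite mw in nw.
Qed.

Lemma mem_histories r (T : {set I}) (s h : seq {set I}) : T \subset meeting (unions s) -> T != set0 -> indep T ->
  h \in histories r (T :: s) -> h \in histories r.+1 s.
Proof.
move=> T1 T2 T3 hT /=; apply/flattenP; exists (histories r (T :: s)) => //.
by apply/mapP; exists T => //; rewrite mem_enum inE T1 T2 T3.
Qed.

Lemma unions_cons T s : unions (T :: s) = T :|: unions s.
Proof. by rewrite /unions big_cons. Qed.

(** Going back one round keeps only the selected events that meet the sets recorded so far. The
    discarded ones do not touch the recorded scopes, so the history has the true levels there; hence
    the hypothesis for all [l] that agree with [level x r] on these scopes. *)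
Lemma history_exists x r T s :
  (forall l, {in cov (unions (T :: s)), l =1 level x r} -> valid l (T :: s) x) ->
  T != set0 -> T \subset violated (level x r) x ->
  exists2 h, h \in histories r (T :: s) & valid (fun=> 0%N) h x.
Proof.
elim: r T s => [|r IH] T s vT T0 TV.
  by exists (T :: s); [rewrite inE | apply: vT].
have [sV si _] := selectedP (level x r) x.
pose T' := selected (level x r) x :&: meeting (unions (T :: s)).
have T'i : indep T'.
  apply/forall_inP => a /setIP[aM _]; apply/forall_inP => b /setIP[bM _].
  by have /forall_inP/(_ _ bM) := forall_inP si _ aM.
have T'0 : T' != set0.
  have /set0Pn[v vT'] := T0.
  have /violated_step[w ws mw] := subsetP TV _ vT'.
  apply/set0Pn; exists w; rewrite inE ws inE; apply/exists_inP; exists v => //.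
  by rewrite unions_cons inE vT'.
have T'V : T' \subset violated (level x r) x by apply: subset_trans sV; apply: subsetIl.
have [|h hh hv] := IH T' (T :: s) _ T'0 T'V.
  move=> l ll; rewrite [valid _ _ _]/= -/(valid _ (T :: s) x); apply/andP; split.
    apply/forall_inP => w wT'; have := subsetP T'V _ wT'; rewrite inE => Aw.
    rewrite -(A_scope (a := table_row (level x r) x)) // => u uS.
    rewrite !ffunE ll //; apply/bigcupP; exists w => //.
    by rewrite unions_cons inE wT'.
  apply: vT => u uc; rewrite [RHS]/= /bump_level ll; last first.
    move: uc => /bigcupP[w wu uw]; apply/bigcupP; exists w => //.
    by rewrite unions_cons inE wu orbT.
  congr (_ + nat_of_bool _)%N.
  apply/idP/idP => [/bigcupP[w /setIP[ws _] uw]|uM].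
    by apply/bigcupP; exists w.
  have /bigcupP[w' wU uw'] := uc.
  have [w ws /andP[uw mw]] := cov_meets uw' uM.
  apply/bigcupP; exists w => //; rewrite inE ws inE.
  by apply/exists_inP; exists w'.
exists h => //; apply: mem_histories hh => //; exact: subsetIr.
Qed.

(** The second alternative says that the history may run off the top of the table, where [inord]
    would wrap around; its users exclude it. *)
Lemma valid_depends l s : depends_on [set c : U * 'I_k.+1 | (l c.1 <= c.2)%N] (valid l s)
  \/ ~~ [forall u, (l u + size s <= k.+1)%N].
Proof.
elim: s l => [|T s IH] l; first by left.
have [/forallP lk|] := boolP [forall u, (l u + size (T :: s) <= k.+1)%N]; last by right.
left=> a b ab /=; congr (_ && _).
  apply: eq_forallb => v; congr (_ ==> _); apply: A_scope => u _.
  rewrite !ffunE ab // inE inordK //=; have := lk u; rewrite /= addnS; lia.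
have [d|/negP[]] := IH (bump_level T l).
  apply: d => c; rewrite inE => lc; apply: ab; rewrite inE.
  by apply: leq_trans lc; rewrite leq_addr.
apply/forallP => u; have := lk u; rewrite /bump_level /=; case: (u \in _); lia.
Qed.

Variable p : R.
Hypothesis p_ge0 : 0 <= p.
Hypothesis Ap : forall v, Pr R (A v) <= p.

Lemma Pr_all_violated l (T : {set I}) : (forall u, l u < k.+1)%N -> indep T ->
  Pr R (fun x : table => [forall v in T, A v (table_row l x)]) <= p ^+ #|T|.
Proof.
move=> lk; have [n] := ubnP #|T|; elim: n T => // n IH T Tn Ti.
have [->|[v vT]] := set_0Vmem T.
  by rewrite cards0 expr0 Pr_le1.
have T'i : indep (T :\ v).
  apply/forall_inP => a /setD1P[_ aM]; apply/forall_inP => b /setD1P[_ bM].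
  by have /forall_inP/(_ _ bM) := forall_inP Ti _ aM.
have E1 (x : table) : ([forall w in T, A w (table_row l x)])%:R =
    (A v (table_row l x))%:R * ([forall w in T :\ v, A w (table_row l x)])%:R :> R.
  rewrite -natrM mulnb; congr (_%:R); congr nat_of_bool.
  apply/forall_inP/andP => [h|[h1 /forall_inP h2] w wT].
    by split; [apply: h | apply/forall_inP => w /setD1P[_ wT]; apply: h].
  by have [->//|wv] := eqVneq w v; apply: h2; rewrite !inE wv.
rewrite /Pr (eq_Ex E1).
rewrite (@Ex_indep _ _ _ X_gt0 [set c : U * 'I_k.+1 | (c.1 \in S v) && (c.2 == l c.1 :> nat)]) //.
- rewrite (cardsD1 v) vT exprS; apply: ler_pM.
  + exact: Pr_ge0.
  + exact: Pr_ge0.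
  + have hI : injective (fun u : U => (u, inord (l u) : 'I_k.+1)) by move=> u w [].
    by apply: le_trans (Ap v); rewrite -(Pr_inj R X_gt0 (A v) hI).
  + by apply: IH => //; move: Tn; rewrite (cardsD1 v) vT.
- move=> a b ab; congr (_%:R); congr nat_of_bool; apply: A_scope => u uS.
  by rewrite !ffunE ab // inE /= uS inordK //= eqxx.
- move=> a b ab; congr (_%:R); congr nat_of_bool; apply: eq_forallb => w.
  have [/setD1P[wv wT] /=|//] := boolP (w \in T :\ v); apply: A_scope => u uS.
  rewrite !ffunE ab // !inE /= inordK // eqxx andbT; apply/negP => uv.
  have /forall_inP/(_ _ vT)/implyP/(_ wv) := forall_inP Ti _ wT.
  by rewrite disjoint_subset => /subsetP/(_ _ uS); rewrite inE uv.
Qed.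

(** The first set reads its scopes at the current levels, and the rest of the history reads these
    variables only at higher levels. The factors are therefore independent, and each event costs a
    factor [p]. *)
Lemma Pr_valid l s : (forall u, l u + size s <= k.+1)%N -> all indep s ->
  Pr R (valid l s) <= p ^+ weight s.
Proof.
elim: s l => [|T s IH] l lk /=; first by rewrite expr0 Pr_le1.
case/andP=> Ti si; rewrite /weight /= exprD.
have lk' u : (bump_level T l u + size s <= k.+1)%N.
  by have := lk u; rewrite /bump_level /=; case: (u \in _); lia.
have E1 (x : table) : ([forall w in T, A w (table_row l x)] && valid (bump_level T l) s x)%:R =
    ([forall w in T, A w (table_row l x)])%:R * (valid (bump_level T l) s x)%:R :> R.
  by rewrite -natrM mulnb.
rewrite /Pr (eq_Ex E1).
rewrite (@Ex_indep _ _ _ X_gt0 [set c : U * 'I_k.+1 | (c.1 \in cov T) && (c.2 == l c.1 :> nat)]) //.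
- apply: ler_pM; try exact: Pr_ge0.
    apply: Pr_all_violated => // u; have := lk u; rewrite /=; lia.
  exact: IH.
- move=> a b ab; congr (_%:R); congr nat_of_bool; apply: eq_forallb => w.
  have [wT /=|//] := boolP (w \in T); apply: A_scope => u uS.
  rewrite !ffunE ab // inE /= inordK ?eqxx ?andbT; last by have := lk u; rewrite /=; lia.
  by apply/bigcupP; exists w.
- have [d|/negP[]] := valid_depends (bump_level T l) s; last exact/forallP.
  move=> a b ab; congr (_%:R); congr nat_of_bool; apply: d => c; rewrite inE => lc.
  apply: ab; rewrite !inE; apply/negP => /andP[cc /eqP c2].
  by move: lc; rewrite /bump_level cc c2; lia.
Qed.

Lemma histories_size r s h : h \in histories r s -> size h = (r + size s)%N.
Proof.
elim: r s => [|r IH] s /=; first by rewrite inE => /eqP ->.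
by case/flattenP => hs /mapP[T _ ->] /IH ->; rewrite /= addnS.
Qed.

Lemma histories_indep r s h : all indep s -> h \in histories r s -> all indep h.
Proof.
elim: r s => [|r IH] s si /=; first by rewrite inE => /eqP ->.
case/flattenP => hs /mapP[T]; rewrite mem_enum inE => /and3P[_ _ Ti] -> /IH; apply.
by rewrite /= Ti.
Qed.

Variable d : nat.
Hypothesis deg_d : forall v, (#|[set w | meets v w]| <= d)%N.
Hypothesis dp_small : d%:R * p * expR (2 * k%:R) <= 1.

Lemma card_unions s : (#|unions s| <= weight s)%N.
Proof.
elim: s => [|T s IH]; first by rewrite /unions big_nil cards0.
rewrite unions_cons /weight /=; apply: leq_trans (leq_card_setU _ _) _.
by rewrite leq_add2l.
Qed.

Lemma card_meeting (T : {set I}) : (#|meeting T| <= d * #|T|)%N.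
Proof.
apply: (@leq_trans #|\bigcup_(v in T) [set w | meets v w]|).
  apply/subset_leq_card/subsetP => w; rewrite inE => /exists_inP[v vT mv].
  by apply/bigcupP; exists v => //; rewrite inE.
by rewrite mulnC; apply: card_bigcup_le.
Qed.

(** With [z = d y <= 1], the sum [(1 + y)^|N| - 1] is at most [exp (z m) - 1 <= z m exp (z m)], and
    both [m] and [exp (z m)] are at most [exp m]. *)
Lemma sum_nonempty_subsets (N : {set I}) (y : R) (m : nat) : 0 <= y -> d%:R * y <= 1 ->
  (#|N| <= d * m)%N ->
  \sum_(T : {set I} | (T \subset N) && (T != set0)) y ^+ #|T| <= d%:R * y * expR (2 * m%:R).
Proof.
move=> y0 dy Nm.
have -> : \sum_(T : {set I} | (T \subset N) && (T != set0)) y ^+ #|T| = (1 + y) ^+ #|N| - 1.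
  by rewrite -sum_subsets [in RHS](bigD1 set0) ?sub0set //= cards0 expr0 addrAC subrr add0r.
set z := d%:R * y in dy *; have z0 : 0 <= z by rewrite mulr_ge0.
have h1 : (1 + y) ^+ #|N| <= expR (z * m%:R).
  apply: le_trans (_ : expR (y * #|N|%:R) <= _).
    rewrite expRM_natr lerXn2r ?nnegrE ?expR_ge1Dx ?expR_ge0 //; lra.
  by rewrite ler_expR /z (mulrC _ y) -mulrA ler_wpM2l // -natrM ler_nat.
have h2 : expR (z * m%:R) - 1 <= z * m%:R * expR (z * m%:R).
  have := expR_ge1Dx (- (z * m%:R)); rewrite expRN => h.
  have e0 := expR_gt0 (z * m%:R).
  have : (1 - z * m%:R) * expR (z * m%:R) <= 1.
    by rewrite -ler_pdivlMr // div1r.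
  by lra.
have h3 : z * m%:R * expR (z * m%:R) <= z * (expR m%:R * expR m%:R).
  rewrite -mulrA ler_wpM2l //; apply: ler_pM; rewrite ?expR_ge0 ?ler0n //.
    by have := expR_ge1Dx (m%:R : R); lra.
  by rewrite ler_expR ler_piMl.
have -> : expR (2 * m%:R) = expR m%:R * expR m%:R :> R by rewrite -expRD; congr expR; ring.
by lra.
Qed.

(** The next set is chosen among at most [d] times the total weight of the history, so a round
    multiplies the sum by [exp] of twice that weight. The last factor records this loss: each event
    already present pays [exp 2] once per remaining round, which is why [dp_small] contains
    [expR (2 * k%:R)]. *)
Lemma sum_histories r s : (r <= k)%N ->
  \sum_(h <- histories r s) p ^+ weight h <=
  p ^+ weight s * (d%:R * p * expR (2 * k%:R)) ^+ r * expR (2 * r%:R * (weight s)%:R).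
Proof.
elim: r s => [|r IH] s rk.
  by rewrite /= big_seq1 expr0 !(mulr0, mul0r) expR0 !mulr1.
rewrite [histories _ _]/= big_flatten big_map /= big_enum /=.
set m := weight s; set q := d%:R * p * _.
have q0 : 0 <= q by rewrite !mulr_ge0 ?expR_ge0.
apply: (@le_trans _ _ (\sum_(T : {set I} | (T \subset meeting (unions s)) && (T != set0))
   (p ^+ m * q ^+ r * expR (2 * r%:R * m%:R)) * (p * expR (2 * r%:R)) ^+ #|T|)).
  rewrite big_mkcond [leRHS]big_mkcond /=; apply: ler_sum => T _; rewrite inE.
  case: ifP => [/and3P[-> -> _]|_] /=.
    apply: le_trans (IH _ (ltnW rk)) _; rewrite /weight /= -/(weight s) -/m -/q.
    rewrite exprD natrD mulrDr expRD (expRM_natr #|T|) [X in _ <= _ * X]exprMn.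
    by apply: eq_leW; ring.
  by case: ifP => // _; rewrite !mulr_ge0 ?exprn_ge0 ?expR_ge0 // mulr_ge0 ?expR_ge0.
rewrite -mulr_sumr [in leRHS]exprS.
have er : expR (2 * r%:R) <= expR (2 * k%:R) :> R by rewrite ler_expR ler_pM2l // ler_nat ltnW.
have dq : d%:R * (p * expR (2 * r%:R)) <= q by rewrite mulrA /q ler_wpM2l // mulr_ge0.
apply: le_trans (_ : p ^+ m * q ^+ r * expR (2 * r%:R * m%:R) * (q * expR (2 * m%:R)) <= _).
  rewrite ler_wpM2l ?mulr_ge0 ?exprn_ge0 ?expR_ge0 //.
  apply: le_trans (sum_nonempty_subsets (m := m) _ _ _) _.
  - by rewrite mulr_ge0 ?expR_ge0.
  - exact: le_trans dq dp_small.
  - apply: leq_trans (card_meeting _) _; rewrite leq_mul2l card_unions orbT //.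
  - by rewrite ler_wpM2r ?expR_ge0.
have -> : expR (2 * r.+1%:R * m%:R) = expR (2 * r%:R * m%:R) * expR (2 * m%:R) :> R.
  by rewrite -expRD; congr expR; rewrite -natr1; ring.
by apply: eq_leW; ring.
Qed.

Lemma resampling : Pr R (fun x : table =>
    ~~ [exists l : {ffun U -> 'I_k.+1}, [forall v, ~~ A v (table_row (fun u => l u : nat) x)]])
  <= #|I|%:R * (d%:R * p * expR (2 * k%:R)) ^+ k * (p * expR (2 * k%:R)).
Proof.
apply: (@le_trans _ _ (\sum_(h <- flatten [seq histories k [:: [set v]] | v <- enum I])
   Pr R (fun x : table => valid (fun=> 0%N) h x))).
  apply: Pr_bigU => // x nx.
  have levelk t u : (level x t u <= t)%N.
    by elim: t => //= t IH; rewrite /bump_level; case: (_ \in _); lia.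
  have : violated (level x k) x != set0.
    (* If no event is violated after [k] rounds, the levels reached then are the witness. *)
    apply: contra nx => /eqP v0; apply/existsP; exists [ffun u => inord (level x k u)].
    apply/forallP => v; have /setP/(_ v) := v0; rewrite !inE => /negbT.
    apply: contra; congr (is_true (A v _)); apply/ffunP => u; rewrite !ffunE.
    by rewrite inordK // ltnS levelk.
  case/set0Pn => v vV.
  have [|||h hh hv] := @history_exists x k [set v] [::] _ _ _.
  - move=> l ll /=; rewrite andbT; apply/forall_inP => w /set1P ->.
    move: vV; rewrite inE => Av; rewrite -(A_scope (a := table_row (level x k) x)) // => u uS.
    rewrite !ffunE ll //; apply/bigcupP; exists v => //.
    by rewrite unions_cons !inE eqxx.
  - by apply/set0Pn; exists v; rewrite inE.
  - by rewrite sub1set.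
  exists h => //; apply/flattenP; exists (histories k [:: [set v]]) => //.
  by apply/mapP; exists v => //; rewrite mem_enum.
apply: (@le_trans _ _ (\sum_(h <- flatten [seq histories k [:: [set v]] | v <- enum I]) p ^+ weight h)).
  rewrite big_seq [leRHS]big_seq; apply: ler_sum => h /flattenP[hs /mapP[v _ ->] hh].
  apply: Pr_valid.
    by move=> u; rewrite (histories_size hh) /= addn1.
  apply: histories_indep hh => /=; rewrite andbT; apply/forall_inP => a /set1P ->.
  by apply/forall_inP => b /set1P ->; rewrite eqxx.
rewrite big_flatten big_map big_enum /=.
apply: (@le_trans _ _ (\sum_(v : I) (d%:R * p * expR (2 * k%:R)) ^+ k * (p * expR (2 * k%:R)))).
  apply: ler_sum => v _; apply: le_trans (sum_histories _ (leqnn k)) _.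
  rewrite /weight /= cards1 addn0 expr1 mulr1; set Q := _ ^+ k.
  by rewrite (mulrC p) -mulrA.
by rewrite sumr_const -[leLHS]mulr_natl mulrA.
Qed.

End Resampling.

(** * The kicking process *)

(* Every uncolored vertex [u] first tries [k4] fresh draws against its available
   colors.  If all fail, it takes a color [c] from [k3] further draws anyway and
   uncolors ("kicks") its at most [M] neighbors colored [c]; [u] and the kicked
   vertices are frozen, so that no vertex is kicked twice. *)
Section Kicking.
Variables (R : realType) (V : finType) (D k4 k3 M E : nat) (adj : rel V).
Hypothesis adj_sym : symmetric adj.
Hypothesis adj_irr : irreflexive adj.
Hypothesis adj_deg : forall v, (#|[set w | adj v w]| <= D)%N.

Local Notation color := 'I_D.+1.
Local Notation slot := (bool * ('I_k4 + 'I_k3))%type.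
Local Notation draws := {ffun V * slot -> color}.

Variables (H : {set V}) (A0 : V -> {set color}).

Definition hnbr (u : V) : {set V} := [set w in H | adj u w].

(** A vertex is handled at most twice: first from [ktodo] with the block of draws marked [false],
    and once more from [kkick], if it loses its color, with the block marked [true]. [kfresh] holds
    the vertices whose second block is unread. In a block the [inl] draws look for a free color and
    the [inr] draws for a color to take by force. [kerr] is set if the latter fail or if freezing
    makes some vertex have more than [E] frozen neighbors. *)
Record kstate := KState {
  kcol : {ffun V -> option color};
  ktodo : {set V}; kkick : {set V}; kfrz : {set V}; kfresh : {set V};
  kerr : bool }.

Definition carriers (col : {ffun V -> option color}) u c : {set V} :=
  [set w in hnbr u | col w == Some c].

Definition avail (col : {ffun V -> option color}) u : {set color} :=
  [set c in A0 u | carriers col u c == set0].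

Definition takeable (s : kstate) u : {set color} :=
  [set c in A0 u | (#|carriers (kcol s) u c| <= M)%N
                   && [disjoint carriers (kcol s) u c & kfrz s]].

Definition try_free (b : bool) (u : V) (s : kstate) (w : draws) : option color :=
  omap (fun i => w (u, (b, inl i))) [pick i | w (u, (b, inl i)) \in avail (kcol s) u].

Definition try_take (b : bool) (u : V) (s : kstate) (w : draws) : option color :=
  omap (fun i => w (u, (b, inr i))) [pick i | w (u, (b, inr i)) \in takeable s u].

Definition overfull (frz : {set V}) : bool :=
  [exists x, (E < #|hnbr x :&: frz|)%N].

Definition handle (b : bool) (u : V) (s : kstate) (w : draws) : kstate :=
  let todo := if b then ktodo s else ktodo s :\ u in
  let fresh := if b then kfresh s :\ u else kfresh s in
  if try_free b u s w is Some c then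
    KState [ffun x => if x == u then Some c else kcol s x]
      todo (kkick s :\ u) (kfrz s) fresh false
  else if try_take b u s w is Some c then
    let K := carriers (kcol s) u c in
    let frz := u |: (K :|: kfrz s) in
    KState [ffun x => if x == u then Some c else if x \in K then None else kcol s x]
      todo (kkick s :\ u :|: K) frz fresh (overfull frz)
  else KState (kcol s) todo (kkick s :\ u) (kfrz s) fresh true.

Definition next_vertex (s : kstate) : option (bool * V) :=
  if kerr s then None
  else if [pick u in kkick s] is Some u then Some (true, u)
  else if [pick u in ktodo s] is Some u then Some (false, u)
  else None.

Definition kstep (s : kstate) (w : draws) : kstate :=
  if next_vertex s is Some (b, u) then handle b u s w else s.

Definition kquery (s : kstate) : {set V * slot} :=
  if next_vertex s is Some (b, u) then [set c | (c.1 == u) && (c.2.1 == b)] else set0.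

Definition kfree (s : kstate) : {set V * slot} :=
  [set c | if c.2.1 then c.1 \in kfresh s else c.1 \in ktodo s].

(** Kicked vertices are frozen, and [takeable] excludes colors carried by frozen vertices. With
    [inv_fresh], every vertex that can still be kicked therefore owns an unread second block. *)
Record kinv (s : kstate) : Prop := KInv {
  inv_col : forall v c, kcol s v = Some c -> (v \in H) && (c \in A0 v);
  inv_proper : forall u v c, adj u v -> kcol s u = Some c -> kcol s v != Some c;
  inv_cover : forall v, ~~ kerr s -> v \in H ->
    [|| v \in ktodo s, v \in kkick s | kcol s v != None];
  inv_kick : kkick s \subset kfresh s :&: H;
  inv_kick_frz : kkick s \subset kfrz s;
  inv_todo : ktodo s \subset H;
  inv_fresh : forall v, v \in H -> v \notin kfrz s -> v \in kfresh s;
  inv_frz : ~~ kerr s -> ~~ overfull (kfrz s) }.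

Lemma card_hnbr u : (#|hnbr u| <= D)%N.
Proof.
apply: leq_trans (adj_deg u); apply/subset_leq_card/subsetP => w.
by rewrite !inE => /andP[].
Qed.

Lemma next_vertexP s b u : kinv s -> next_vertex s = Some (b, u) ->
  [/\ ~~ kerr s, u \in H, if b then u \in kkick s else u \in ktodo s &
      if b then u \in kfresh s else u \in ktodo s].
Proof.
move=> Is; rewrite /next_vertex; case Ee: (kerr s) => //.
case: pickP => [v vk [<- <-]|_].
  by have /setIP[] := subsetP (inv_kick Is) _ vk; split.
case: pickP => [v vt [<- <-]|//].
by split=> //; apply: (subsetP (inv_todo Is)).
Qed.

Lemma try_free_some b u s w c : try_free b u s w = Some c ->
  c \in avail (kcol s) u /\ exists j, w (u, j) = c.
Proof. by rewrite /try_free; case: pickP => //= i wi [<-]; split=> //; exists (b, inl i). Qed.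

Lemma try_take_some b u s w c : try_take b u s w = Some c ->
  c \in takeable s u /\ exists j, w (u, j) = c.
Proof. by rewrite /try_take; case: pickP => //= i wi [<-]; split=> //; exists (b, inr i). Qed.

Lemma kinv_step s w : kinv s -> kinv (kstep s w).
Proof.
move=> Is; rewrite /kstep; case En: (next_vertex s) => [[b u]|//].
have [ns uH uk uq] := next_vertexP Is En.
set todo := if b then ktodo s else ktodo s :\ u.
set fresh := if b then kfresh s :\ u else kfresh s.
have todoH : todo \subset H.
  by rewrite /todo; case: (b); [|apply: subset_trans (subsetDl _ _) _]; apply: inv_todo Is.
have kickS : kkick s :\ u \subset fresh :&: H.
  apply/subsetP => v /setD1P[vu vk]; have /setIP[vf vH] := subsetP (inv_kick Is) _ vk.
  by rewrite inE vH andbT /fresh; case: (b) => //; rewrite !inE vu.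
have todo_u v : v != u -> v \in ktodo s -> v \in todo.
  by move=> vu vt; rewrite /todo; case: (b) => //; rewrite !inE vu.
have freshS v : v \in H -> v \notin kfrz s -> v \in fresh.
  move=> vH vf; have vfr := inv_fresh Is vH vf; rewrite /fresh; case: (b) uk => // uk.
  rewrite !inE vfr andbT; apply: contraNneq vf => ->.
  exact: (subsetP (inv_kick_frz Is)).
have kickF : kkick s :\ u \subset kfrz s.
  by apply: subset_trans (subsetDl _ _) _; apply: inv_kick_frz Is.
rewrite /handle -/todo -/fresh; case Ef: (try_free b u s w) => [c|].
  have [] := try_free_some Ef; rewrite inE => /andP[cA c0] _.
  have car v : v \in hnbr u -> kcol s v != Some c.
    by move=> vu; apply/negP => vc; have /eqP/setP/(_ v) := c0; rewrite inE vu vc inE.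
  split=> //=.
  - move=> v c'; rewrite ffunE; have [-> [<-]|_] := eqVneq v u; first by rewrite uH.
    exact: inv_col Is _ _.
  - move=> x y c' xy; rewrite !ffunE.
    have [xu|xu] := eqVneq x u; have [yu|yu] := eqVneq y u.
    + by move: xy; rewrite xu yu adj_irr.
    + move=> [<-]; have [yH|yH] := boolP (y \in H); first by apply: car; rewrite inE yH -xu.
      by apply/negP => /eqP /(inv_col Is); rewrite (negbTE yH).
    + move=> xc; apply/negP => /eqP[cc]; move: xc; rewrite -cc => xc.
      have /andP[xH _] := inv_col Is xc.
      by have := car x; rewrite inE xH adj_sym -yu xy xc eqxx => /(_ isT).
    + exact: inv_proper Is _ _ _ xy.
  - move=> v _ vH; rewrite ffunE; have [vu|vu] := eqVneq v u; first by rewrite !orbT.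
    case/or3P: (inv_cover Is ns vH) => [/(todo_u _ vu) ->//|vk|->]; last by rewrite !orbT.
    by rewrite !inE vu vk orbT.
  - by move=> _; apply: inv_frz Is ns.
case Et: (try_take b u s w) => [c|].
  have [] := try_take_some Et; rewrite inE => /and3P[cA cM cF] _.
  set K := carriers _ _ _ in cM cF *.
  have KH : K \subset H by apply/subsetP => v; rewrite !inE => /andP[/andP[]].
  have uK : u \notin K by rewrite !inE adj_irr andbF.
  have car v : v \in H -> adj u v -> kcol s v = Some c -> v \in K.
    by move=> vH uv vc; rewrite !inE vH uv vc eqxx.
  split=> //=.
  - move=> v c'; rewrite ffunE; have [-> [<-]|_] := eqVneq v u; first by rewrite uH.
    by case: ifP => // _; apply: inv_col Is _ _.
  - move=> x y c' xy; rewrite !ffunE.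
    have [xu|xu] := eqVneq x u; have [yu|yu] := eqVneq y u.
    + by move: xy; rewrite xu yu adj_irr.
    + move=> [<-]; case: ifPn => // yK; apply: contra yK => /eqP yc.
      by have /andP[yH _] := inv_col Is yc; apply: car => //; rewrite -xu.
    + case: ifPn => // xK xc; apply/negP => /eqP[cc]; move: xc; rewrite -cc => xc.
      have /andP[xH _] := inv_col Is xc; move/negP: xK; apply; apply: car => //.
      by rewrite adj_sym -yu.
    + by case: ifP => // _ xc; case: ifP => // _; apply: inv_proper Is _ _ _ xy xc.
  - move=> v _ vH; rewrite ffunE; have [vu|vu] := eqVneq v u; first by rewrite !orbT.
    case: ifP => vK; first by rewrite in_setU vK !orbT.
    case/or3P: (inv_cover Is ns vH) => [/(todo_u _ vu) ->//|vk|->]; last by rewrite !orbT.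
    by rewrite !inE vu vk !orbT.
  - rewrite subUset kickS /=; apply/subsetP => v vK; rewrite inE (subsetP KH) // andbT.
    apply: freshS; first exact: (subsetP KH).
    by move: cF; rewrite disjoint_subset => /subsetP/(_ _ vK).
  - rewrite subUset (subset_trans kickF) /=; last by rewrite setUA subsetUr.
    by rewrite setUCA subsetUl.
  - by move=> v vH; rewrite !inE !negb_or => /and3P[_ _]; apply: freshS.
split=> //=.
- exact: inv_col Is.
- exact: inv_proper Is.
Qed.

Lemma kstep_depends s : depends_on (kquery s) (kstep s).
Proof.
move=> a c ac; rewrite /kstep; move: ac; rewrite /kquery.
case: (next_vertex s) => [[b u]|] // ac.
have e j : a (u, (b, j)) = c (u, (b, j)) by apply: ac; rewrite inE /= !eqxx.
rewrite /handle.
have -> : try_free b u s a = try_free b u s c.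
  rewrite /try_free; under eq_pick do rewrite e.
  by case: pickP => //= i _; rewrite e.
have -> // : try_take b u s a = try_take b u s c.
rewrite /try_take; under eq_pick do rewrite e.
by case: pickP => //= i _; rewrite e.
Qed.

Lemma kquery_free s : kinv s -> kquery s \subset kfree s.
Proof.
move=> Is; rewrite /kquery; case En: (next_vertex s) => [[b u]|]; last exact: sub0set.
have [_ _ _ uq] := next_vertexP Is En.
by apply/subsetP => -[v [b' j]]; rewrite !inE /= => /andP[/eqP -> /eqP ->].
Qed.

Lemma handle_todo b u s w : ktodo (handle b u s w) = if b then ktodo s else ktodo s :\ u.
Proof. by rewrite /handle; case: try_free => [c|] //; case: try_take. Qed.

Lemma handle_fresh b u s w : kfresh (handle b u s w) = if b then kfresh s :\ u else kfresh s.
Proof. by rewrite /handle; case: try_free => [c|] //; case: try_take. Qed.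

Lemma kfree_step s w : kfree (kstep s w) \subset kfree s :\: kquery s.
Proof.
rewrite /kstep /kquery; case: (next_vertex s) => [[b u]|]; last by rewrite setD0.
apply/subsetP => -[v [b' j]]; rewrite !inE /= handle_todo handle_fresh.
by case: b; case: b'; rewrite ?inE ?andbF ?andbT ?eqxx //= ?andbT ?andbF => //; case/andP=> -> ->.
Qed.

(** The number of handlings that can still occur; it serves both for termination and to pay for
    failures of [try_take]. *)
Definition kleft (s : kstate) : nat := (#|ktodo s| + #|kfresh s|)%N.

Lemma kleft_step s w b u : kinv s -> next_vertex s = Some (b, u) ->
  kleft s = (kleft (kstep s w)).+1.
Proof.
move=> Is En; have [_ _ _ uq] := next_vertexP Is En.
rewrite /kstep En /kleft handle_todo handle_fresh.
by case: b uq {En} => uq; [rewrite addnC (cardsD1 u (kfresh s)) | rewrite (cardsD1 u (ktodo s))];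
  rewrite uq ?add1n ?addSn // addnC.
Qed.

Lemma run_halts n s w : kinv s -> (kleft s <= n)%N ->
  next_vertex (run kstep n s w) = None.
Proof.
elim: n s => [|n IH] s Is sn /=.
  case En: (next_vertex s) => [[b u]|//].
  by have := kleft_step w Is En; move: sn; rewrite leqn0 => /eqP ->.
case En: (next_vertex s) => [[b u]|]; last first.
  have ks : kstep s w = s by rewrite /kstep En.
  by rewrite ks; elim: n {IH sn} => //= n; rewrite ks.
apply: IH; first exact: kinv_step.
by have := kleft_step w Is En; lia.
Qed.

Lemma kinv_run n s w : kinv s -> kinv (run kstep n s w).
Proof. by elim: n s => //= n IH s /(kinv_step w) /IH. Qed.

Definition listed (w : draws) (s : kstate) : Prop :=
  forall v c, kcol s v = Some c -> exists j, w (v, j) = c.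

Lemma listed_run n s w : listed w s -> listed w (run kstep n s w).
Proof.
elim: n s => //= n IH s Ls; apply: IH; rewrite /kstep.
case: (next_vertex s) => [[b u]|//]; rewrite /handle.
case Ef: (try_free b u s w) => [c|].
  have [_ h] := try_free_some Ef.
  by move=> v c' /=; rewrite ffunE; have [-> [<-]//|_] := eqVneq v u; apply: Ls.
case Et: (try_take b u s w) => [c|] //.
have [_ h] := try_take_some Et.
move=> v c' /=; rewrite ffunE; have [-> [<-]//|_] := eqVneq v u.
by case: ifP => // _; apply: Ls.
Qed.

Definition kinit : kstate := KState [ffun=> None] H set0 set0 H false.

Lemma kinv_init : kinv kinit.
Proof.
split=> //=; rewrite ?sub0set //.
- by move=> v c; rewrite ffunE.
- by move=> u v c _; rewrite !ffunE.
- by move=> v _ ->.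
- by move=> _; apply/existsP => -[x]; rewrite setI0 cards0.
Qed.

Definition kcolorable (w : draws) : bool :=
  [exists f : {ffun V -> color},
    [forall u in H, [&& f u \in A0 u, [exists j, w (u, j) == f u] &
      [forall v in H, adj u v ==> (f u != f v)]]]].

Lemma kick_fail n w : (#|H| + #|H| <= n)%N ->
  ~~ kcolorable w -> kerr (run kstep n kinit w).
Proof.
move=> Hn; apply: contraR => ne; set s := run kstep n kinit w in ne.
have Is : kinv s by apply: kinv_run kinv_init.
have Ls : listed w s by apply: listed_run => v c; rewrite /= ffunE.
have : next_vertex s = None by apply: run_halts kinv_init _.
rewrite /next_vertex (negbTE ne); case: pickP => // k0 ; case: pickP => // t0 _.
have colH v : v \in H -> exists c, kcol s v = Some c.
  move=> vH; have := inv_cover Is ne vH; have /= -> := t0 v; have /= -> := k0 v.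
  by rewrite /=; case: (kcol s v) => // c _; exists c.
apply/existsP; exists [ffun v => odflt ord0 (kcol s v)].
apply/forall_inP => u uH; rewrite !ffunE; have [c uc] := colH u uH; rewrite uc /=.
have /andP[_ ->] := inv_col Is uc; rewrite /=; apply/andP; split.
  by have [j <-] := Ls _ _ uc; apply/existsP; exists j.
apply/forall_inP => v vH; apply/implyP => uv; rewrite ffunE.
have [c' vc] := colH v vH; rewrite vc /=.
by have := inv_proper Is uv uc; rewrite vc; apply: contra => /eqP ->.
Qed.

Variables (lam p4 pf tau zeta : R).
Hypotheses (lam_ge0 : 0 <= lam) (k3_gt0 : (0 < k3)%N) (zeta_ge0 : 0 <= zeta <= 1).
Hypothesis A0_slack : forall u, u \in H ->
  zeta * D.+1%:R + #|hnbr u|%:R <= #|A0 u|%:R.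
Hypothesis A0_big : forall u, u \in H ->
  #|~: A0 u|%:R + D%:R / M.+1%:R + E%:R <= tau * D.+1%:R.
Hypothesis p4_ge : (1 - zeta) ^+ k4 <= p4.
Hypothesis pf_ge0 : 0 <= pf.
Hypothesis pf_ge : tau ^+ k3 <= pf.

Local Notation N := (D.+1%:R : R).

Definition rho : R := p4 * expR (lam * M.+1%:R) * k3%:R.

(** Handling [u] by force freezes a neighbor of [x] if [u] is one itself, or if the color taken is
    carried by a common neighbor of [u] and [x]; a uniform color is of the latter kind with
    probability at most the second summand. *)
Definition influence u x : R :=
  (u \in hnbr x)%:R + #|hnbr u :&: hnbr x|%:R / N.

Definition influence_left s x : R :=
  \sum_(u in ktodo s) influence u x + \sum_(u in kfresh s) influence u x.

Definition frozen_term (s : kstate) (x : V) : R :=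
  expR (lam * (#|hnbr x :&: kfrz s|%:R - E%:R) + rho * influence_left s x).

(** The exponential terms watch the number of frozen neighbors of each [x] against the threshold
    [E]; their [influence_left] prepays the growth expected from all handlings still to come. The
    last term prepays a failure [pf] of the forced draws at each of them. Since an error has
    potential 1, the final mean bounds the failure probability. *)
Definition potential (s : kstate) : R :=
  if kerr s then 1 else \sum_x frozen_term s x + pf * (kleft s)%:R.

Lemma N_gt0 : 0 < N. Proof. by rewrite ltr0n. Qed.

Lemma color_gt0 : (0 < #|{: color}|)%N. Proof. by rewrite card_ord. Qed.

Lemma influence_ge0 u x : 0 <= influence u x.
Proof. by rewrite addr_ge0 ?divr_ge0 ?ler0n. Qed.

Lemma p4_ge0 : 0 <= p4.
Proof. by apply: le_trans p4_ge; rewrite exprn_ge0 // subr_ge0; case/andP: zeta_ge0. Qed.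

Lemma rho_ge0 : 0 <= rho.
Proof. by rewrite /rho !mulr_ge0 ?expR_ge0 ?p4_ge0. Qed.

Lemma card_avail col u : u \in H -> zeta * N <= #|avail col u|%:R.
Proof.
move=> uH; have := A0_slack uH.
have : (#|A0 u| <= #|avail col u| + #|hnbr u|)%N.
  apply: (@leq_trans #|avail col u :|: [set odflt ord0 (col w) | w in hnbr u]|).
    apply/subset_leq_card/subsetP => c cA; rewrite inE; apply/orP.
    have [c0|/set0Pn[w]] := boolP (carriers col u c == set0).
      by left; rewrite inE cA.
    by rewrite inE => /andP[wu /eqP wc]; right; apply/imsetP; exists w => //; rewrite wc.
  by rewrite (leq_trans (leq_card_setU _ _)) // leq_add2l leq_imset_card.
rewrite -(ler_nat R) natrD; lra.
Qed.

(** A color cannot be taken for one of three reasons: it is outside [A0 u], or more than [M]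
    neighbors carry it, which happens for at most [D / (M + 1)] colors, or a frozen neighbor carries
    it, which happens for at most [E] colors. *)
Lemma card_takeable s u : kinv s -> ~~ kerr s -> u \in H ->
  #|~: takeable s u|%:R <= tau * N.
Proof.
move=> Is ns uH; apply: le_trans (A0_big uH).
pose B := [set c : color | (M < #|carriers (kcol s) u c|)%N].
pose F := [set odflt ord0 (kcol s w) | w in hnbr u :&: kfrz s].
have cB : (#|B| * M.+1 <= D)%N.
  apply: leq_trans (card_hnbr u).
  apply: (@leq_trans (\sum_(c in B) #|carriers (kcol s) u c|)).
    by rewrite -sum_nat_const; apply: leq_sum => c; rewrite inE.
  rewrite (double_count (mem B) (mem (hnbr u)) (fun c w => kcol s w == Some c)) -sum1_card.
  apply: leq_sum => w _; rewrite -(cards1 (odflt ord0 (kcol s w))); apply: subset_leq_card.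
  by apply/subsetP => c; rewrite !inE => /andP[_ /eqP ->].
have cF : (#|F| <= E)%N.
  apply: leq_trans (leq_imset_card _ _) _.
  by have := inv_frz Is ns; rewrite negb_exists => /forallP/(_ u); rewrite -leqNgt.
have : (#|~: takeable s u| <= #|~: A0 u| + #|B| + #|F|)%N.
  apply: (@leq_trans #|(~: A0 u :|: B) :|: F|); last first.
    by rewrite (leq_trans (leq_card_setU _ _)) // leq_add2r leq_card_setU.
  apply/subset_leq_card/subsetP => c; rewrite !inE !negb_and.
  case/or3P => [->//|h|/pred0Pn[w /=]]; first by rewrite ltnNge h !orbT.
  rewrite inE => /andP[/andP[wu /eqP wc] wf]; apply/orP; right; apply/imsetP.
  by exists w; rewrite ?wc // in_setI wu.
rewrite -(ler_nat R) !natrD => h; apply: le_trans h _; apply: lerD; last by rewrite ler_nat.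
rewrite lerD2l ler_pdivlMr ?ltr0n // -natrM ler_nat //.
Qed.

Lemma influence_left_handle b u s w x : (if b then u \in kfresh s else u \in ktodo s) ->
  influence_left (handle b u s w) x = influence_left s x - influence u x.
Proof.
rewrite /influence_left handle_todo handle_fresh.
by case: b => us; rewrite [in RHS](big_setD1 u us) /=; lra.
Qed.

Lemma influence_left_ge0 s x : 0 <= influence_left s x.
Proof. by rewrite addr_ge0 //; apply: sumr_ge0 => *; apply: influence_ge0. Qed.

Lemma frozen_term_ge0 s x : 0 <= frozen_term s x.
Proof. exact: expR_ge0. Qed.

Definition shared (s : kstate) u x : {set color} :=
  [set c | [exists y in hnbr u :&: hnbr x, kcol s y == Some c]].

Lemma card_shared s u x : (#|shared s u x| <= #|hnbr u :&: hnbr x|)%N.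
Proof.
apply: leq_trans (leq_imset_card (fun y => odflt ord0 (kcol s y)) _).
apply/subset_leq_card/subsetP => c; rewrite inE => /exists_inP[y yI /eqP yc].
by apply/imsetP; exists y => //; rewrite yc.
Qed.

Definition base_term s u x : R :=
  expR (lam * (#|hnbr x :&: kfrz s|%:R - E%:R) + rho * (influence_left s x - influence u x)).

Definition missed b u s (w : draws) : bool :=
  [forall i : 'I_k4, w (u, (b, inl i)) \in ~: avail (kcol s) u].

Definition hit b u s x (w : draws) : bool :=
  [exists i : 'I_k3, w (u, (b, inr i)) \in shared s u x].

(** Frozen neighbors of [x] are gained only if all free draws miss, and then at most [M + 1] of
    them: [u] and the kicked carriers. A positive gain forces [u] to be a neighbor of [x] or a draw
    to hit a color shared by [u] and [x]. *)
Lemma frozen_term_handle b u s w x : kinv s -> u \in H ->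
  (if b then u \in kfresh s else u \in ktodo s) ->
  frozen_term (handle b u s w) x <= base_term s u x *
   (1 + (missed b u s w)%:R * (expR (lam * M.+1%:R) * ((u \in hnbr x)%:R + (hit b u s x w)%:R))).
Proof.
move=> Is uH us; rewrite /frozen_term influence_left_handle //.
have hN y : 0 <= y -> base_term s u x <= base_term s u x * (1 + y).
  by move=> y0; rewrite ler_peMr ?expR_ge0 // lerDl.
have h0 : 0 <= (missed b u s w)%:R * (expR (lam * M.+1%:R) * ((u \in hnbr x)%:R + (hit b u s x w)%:R)).
  by rewrite !mulr_ge0 ?expR_ge0 ?addr_ge0.
rewrite /handle; case Ef: (try_free b u s w) => [c|]; first exact: hN.
have ms : missed b u s w.
  apply/forallP => i; rewrite inE; apply/negP => wi.
  by move: Ef; rewrite /try_free; case: pickP => // /(_ i); rewrite wi.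
rewrite ms mul1r in h0 *.
case Et: (try_take b u s w) => [c|]; last exact: hN.
have [] := try_take_some Et; rewrite inE => /and3P[cA cM cF] _.
set K := carriers _ _ _ in cM cF *; rewrite /=.
pose dl := ((u \in hnbr x) + #|hnbr x :&: K|)%N.
have dlM : (dl <= M.+1)%N.
  rewrite -add1n; apply: leq_add; first by case: (_ \in _).
  by apply: leq_trans cM; apply/subset_leq_card/subsetIr.
have fr : (#|hnbr x :&: (u |: (K :|: kfrz s))| <= #|hnbr x :&: kfrz s| + dl)%N.
  rewrite setUA setIUr addnC (leq_trans (leq_card_setU _ _)) // leq_add2r.
  rewrite setIUr (leq_trans (leq_card_setU _ _)) // leq_add2r.
  have [ux|ux] := boolP (u \in hnbr x).
    by rewrite -[X in (_ <= X)%N](cards1 u); apply/subset_leq_card/subsetIr.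
  have -> : hnbr x :&: [set u] = set0; last by rewrite cards0.
  by apply/setP => y; rewrite !in_setI !in_set1 in_set0; apply/andP => -[yx /eqP yu]; rewrite -yu yx in ux.
apply: (@le_trans _ _ (base_term s u x * expR (lam * dl%:R))).
  rewrite /base_term -expRD ler_expR.
  have : lam * #|hnbr x :&: (u |: (K :|: kfrz s))|%:R <= lam * (#|hnbr x :&: kfrz s| + dl)%N%:R.
    by rewrite ler_wpM2l // ler_nat.
  by rewrite natrD; lra.
rewrite ler_wpM2l ?expR_ge0 //.
have [dl0|dl0] := posnP dl; first by rewrite dl0 mulr0 expR0 lerDl.
apply: (@le_trans _ _ (expR (lam * M.+1%:R))).
  by rewrite ler_expR ler_wpM2l // ler_nat.
have h1 : (1 : R) <= (u \in hnbr x)%:R + (hit b u s x w)%:R.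
  rewrite -natrD (ler_nat _ 1); move: dl0; rewrite /dl; case: (u \in hnbr x) => //=.
  rewrite !add0n card_gt0 => /set0Pn[y]; rewrite in_setI => /andP[yx yK].
  rewrite lt0b; apply/existsP; move: Et; rewrite /try_take; case: pickP => //= i wi [ci].
  exists i; rewrite ci inE; apply/exists_inP; exists y.
    by rewrite in_setI yx andbT; move: yK; rewrite in_set => /andP[].
  by move: yK; rewrite in_set => /andP[].
have : expR (lam * M.+1%:R) * 1 <= expR (lam * M.+1%:R) * ((u \in hnbr x)%:R + (hit b u s x w)%:R).
  by rewrite ler_wpM2l ?expR_ge0.
rewrite mulr1; lra.
Qed.

(** An error has two sources. Either no forced draw is takeable, which is the indicator, or some [x]
    is overfull, and then its own term is already at least 1. *)
Lemma potential_handle b u s w : kinv s -> u \in H ->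
  potential (handle b u s w) <=
  [forall i : 'I_k3, w (u, (b, inr i)) \in ~: takeable s u]%:R +
  \sum_x frozen_term (handle b u s w) x + pf * (kleft (handle b u s w))%:R.
Proof.
move=> Is uH.
have s0 w' : 0 <= \sum_x frozen_term (handle b u s w') x by apply: sumr_ge0 => *; apply: frozen_term_ge0.
rewrite /potential; case: ifPn => [er|_]; last by rewrite lerD2r lerDr ler0n.
have p0 : 0 <= pf * (kleft (handle b u s w))%:R by rewrite mulr_ge0.
move: er (s0 w) p0; rewrite /handle; case Ef: (try_free b u s w) => [c|] //.
case Et: (try_take b u s w) => [c|] /= er s0' p0'.
  set S := \sum_x _ in s0' *; suff S1 : 1 <= S by apply: le_trans S1 _; rewrite -addrA addrCA lerDl addr_ge0 // ler0n.
  have /existsP[x Ex] := er; rewrite /S (bigD1 x) //= -[leLHS]addr0; apply: lerD; last first.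
    by apply: sumr_ge0 => *; apply: frozen_term_ge0.
  rewrite /frozen_term -[leLHS]expR0 ler_expR addr_ge0 //.
    by rewrite mulr_ge0 // subr_ge0 ler_nat ltnW.
  by rewrite mulr_ge0 ?rho_ge0 ?influence_left_ge0.
have -> : [forall i, w (u, (b, inr i)) \in ~: takeable s u].
  apply/forallP => i; rewrite inE; apply/negP => wi.
  by move: Et; rewrite /try_take; case: pickP => // /(_ i); rewrite wi.
have -> : (true%:R : R) = 1 by [].
by rewrite -addrA lerDl addr_ge0.
Qed.

Lemma slot_inj (T : finType) (u : V) (b : bool) (f : T -> 'I_k4 + 'I_k3) :
  injective f -> injective (fun i => (u, (b, f i))).
Proof. by move=> fI i j [] /fI. Qed.

Lemma Pr_missed b u s : u \in H -> Pr R (missed b u s) <= p4.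
Proof.
move=> uH; rewrite /missed.
rewrite (Pr_all_in R color_gt0 (~: avail (kcol s) u) (slot_inj (u := u) (b := b) (f := inl) _)); last by move=> i j [].
rewrite !card_ord; apply: le_trans p4_ge; rewrite lerXn2r ?nnegrE ?divr_ge0 //.
  by rewrite subr_ge0; case/andP: zeta_ge0.
rewrite ler_pdivrMr ?N_gt0 // mulrBl mul1r.
have := card_avail (kcol s) uH.
have := f_equal (fun n => n%:R : R) (cardsC (avail (kcol s) u)); rewrite /= card_ord natrD; lra.
Qed.

Lemma Pr_untakeable b u s : kinv s -> ~~ kerr s -> u \in H ->
  Pr R (fun w : draws => [forall i : 'I_k3, w (u, (b, inr i)) \in ~: takeable s u]) <= pf.
Proof.
move=> Is ns uH.
rewrite (Pr_all_in R color_gt0 (~: takeable s u) (slot_inj (u := u) (b := b) (f := inr) _)); last by move=> i j [].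
have ct := card_takeable Is ns uH.
have t0 : 0 <= tau by rewrite -(pmulr_lge0 _ N_gt0); apply: le_trans ct.
rewrite !card_ord; apply: le_trans pf_ge; rewrite lerXn2r ?nnegrE ?divr_ge0 //.
by rewrite ler_pdivrMr ?N_gt0.
Qed.

Lemma Pr_hit b u s x : Pr R (hit b u s x) <= k3%:R * (#|hnbr u :&: hnbr x|%:R / N).
Proof.
apply: (@le_trans _ _ (\sum_(i < k3)
   Pr R (fun w : draws => w (u, (b, inr i)) \in shared s u x))).
  apply: Pr_bigU; first exact: color_gt0.
  by move=> w /existsP[i wi]; exists i => //; rewrite mem_index_enum.
apply: (@le_trans _ _ (\sum_(i < k3) (#|hnbr u :&: hnbr x|%:R / N))).
  apply: ler_sum => i _; rewrite (Pr_in R color_gt0) card_ord ler_pM2r ?invr_gt0 ?N_gt0 //.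
  by rewrite ler_nat card_shared.
by rewrite sumr_const card_ord -[leLHS]mulr_natl.
Qed.

Lemma Pr_missed_hit b u s x :
  Ex (fun w => (missed b u s w)%:R * (hit b u s x w)%:R) = Pr R (missed b u s) * Pr R (hit b u s x).
Proof.
rewrite (@Ex_indep _ _ _ color_gt0 [set c : V * slot | if c.2.2 is inl _ then true else false]) //.
- move=> a c ac; congr (_%:R); congr nat_of_bool; apply: eq_forallb => i.
  by rewrite ac // inE.
- move=> a c ac; congr (_%:R); congr nat_of_bool; apply: eq_existsb => i.
  by rewrite ac // !inE.
Qed.

(** Free and forced draws occupy different slots, so missing and hitting are independent. The mean
    relative growth of the term of [x] is at most [rho * influence u x], and [1 + t <= exp t]
    matches it with the influence used up by this handling. *)
Lemma potential_step s : kinv s -> Ex (fun w => potential (kstep s w)) <= potential s.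
Proof.
move=> Is; case En: (next_vertex s) => [[b u]|]; last first.
  rewrite -[leRHS](@Ex_cst _ (V * slot)%type color color_gt0); apply: (le_Ex color_gt0) => w.
  by rewrite /kstep En.
have [ns uH _ us] := next_vertexP Is En.
pose C := expR (lam * M.+1%:R).
pose F (w : draws) : R :=
  [forall i : 'I_k3, w (u, (b, inr i)) \in ~: takeable s u]%:R +
  (\sum_x base_term s u x *
     (1 + (C * (u \in hnbr x)%:R * (missed b u s w)%:R + C * ((missed b u s w)%:R * (hit b u s x w)%:R))) +
   pf * ((kleft s)%:R - 1)).
apply: le_trans (_ : Ex F <= _).
  apply: (le_Ex color_gt0) => w; rewrite {1}/kstep En; apply: le_trans (potential_handle b w Is uH) _.
  rewrite /F -addrA lerD2l; apply: lerD; last first.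
    have := kleft_step w Is En; rewrite {1}/kstep En => ->.
    by rewrite -natr1 addrK.
  apply: ler_sum => x _; apply: le_trans (frozen_term_handle _ x Is uH us) _.
  by rewrite ler_wpM2l ?expR_ge0 // /C; lra.
rewrite /F ExD [X in _ + X <= _]ExD [X in _ + (_ + X) <= _](Ex_cst _ color_gt0) Ex_sum.
rewrite /potential (negbTE ns).
have h1 := Pr_untakeable b Is ns uH.
have h2 : \sum_x Ex (fun w => base_term s u x *
     (1 + (C * (u \in hnbr x)%:R * (missed b u s w)%:R + C * ((missed b u s w)%:R * (hit b u s x w)%:R))))
   <= \sum_x frozen_term s x.
  apply: ler_sum => x _; rewrite ExZ ExD (Ex_cst _ color_gt0) ExD !ExZ Pr_missed_hit -/(Pr R (missed b u s)).
  have -> : frozen_term s x = base_term s u x * expR (rho * influence u x).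
    by rewrite /base_term -expRD; congr expR; ring.
  rewrite ler_wpM2l ?expR_ge0 //; apply: le_trans (expR_ge1Dx _); rewrite lerD2l.
  rewrite /rho /influence -/C.
  set P := Pr R (missed b u s); have P4 : P <= p4 by apply: Pr_missed.
  have P0 : 0 <= P by apply: (Pr_ge0 _ color_gt0).
  have C0 : 0 <= C by apply: expR_ge0.
  have hh := Pr_hit b u s x; set q := _ / N in hh *.
  have q0 : 0 <= q by rewrite divr_ge0.
  apply: (@le_trans _ _ (C * (p4 * (k3%:R * (u \in hnbr x)%:R)) + C * (p4 * (k3%:R * q)))); last first.
    by apply: eq_leW; ring.
  apply: lerD.
    rewrite -mulrA ler_wpM2l // mulrC; apply: ler_pM => //.
    by rewrite ler_peMl // ler1n.
  by rewrite ler_wpM2l //; apply: ler_pM => //; apply: (Pr_ge0 _ color_gt0).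
rewrite /Pr in h1; set S := \sum_x Ex _ in h2 *; set S' := \sum_x frozen_term _ _ in h2 *.
lra.
Qed.

(** There are at most [D] neighbors of [x] and at most [D^2] paths of length two ending at [x], the
    latter weighted by [1 / N]. *)
Lemma sum_influence x : \sum_u influence u x <= 2 * N.
Proof.
rewrite big_split /=.
have h1 : \sum_(u : V) (u \in hnbr x)%:R <= N.
  rewrite -natr_sum ler_nat; apply: leq_trans (leqW (card_hnbr x)).
  by rewrite -sum1_card [X in (_ <= X)%N]big_mkcond; apply: leq_sum => u _; case: (_ \in _).
have h2 : \sum_(u : V) #|hnbr u :&: hnbr x|%:R / N <= N.
  rewrite -mulr_suml ler_pdivrMr ?N_gt0 // -natr_sum -natrM ler_nat.
  have -> : (\sum_u #|hnbr u :&: hnbr x| = \sum_u #|[set y | (y \in hnbr x) && (y \in hnbr u)]|)%N.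
    by apply: eq_bigr => u _; apply: eq_card => y; rewrite in_setI in_set andbC.
  rewrite (double_count xpredT (mem (hnbr x)) (fun u y => y \in hnbr u)).
  apply: (@leq_trans (\sum_(y in hnbr x) D)).
    apply: leq_sum => y _; apply: leq_trans (adj_deg y); apply: subset_leq_card.
    by apply/subsetP => u; rewrite !in_set => /= /andP[_]; rewrite adj_sym.
  by rewrite sum_nat_const; apply: leq_mul; [apply: leqW; apply: card_hnbr | ].
lra.
Qed.

(** At the start every vertex of [H] owns both blocks, so the influence on each [x] is at most [4 N]
    and [2 |H|] handlings are to be paid for. *)
Lemma kick_coloring : Pr R (fun w => ~~ kcolorable w) <=
  #|V|%:R * expR (- (lam * E%:R) + 4 * rho * N) + 2 * pf * #|H|%:R.
Proof.
apply: le_trans (_ : Ex (fun w => potential (run kstep (#|H| + #|H|) kinit w)) <= _).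
  apply: (Pr_markov color_gt0) => w.
    rewrite /potential; case: ifP => // _; rewrite addr_ge0 ?mulr_ge0 //.
    by apply: sumr_ge0 => *; apply: frozen_term_ge0.
  by move=> /kick_fail /= h; rewrite /potential h.
have h := @run_supermartingale _ _ _ color_gt0 _ kquery kfree kstep kinv potential.
apply: le_trans (h _ _ _ _ _ _ _ kinv_init) _ => {h}.
- by move=> s w; apply: kinv_step.
- by move=> s _; apply: kstep_depends.
- by move=> s; apply: kquery_free.
- by move=> s w _; apply: kfree_step.
- by move=> s; apply: potential_step.
rewrite /potential /=; apply: lerD; last first.
  by rewrite /kleft /= natrD; lra.
apply: (@le_trans _ _ (\sum_(x : V) expR (- (lam * E%:R) + 4 * rho * N))); last first.
  by rewrite sumr_const -[leLHS]mulr_natl.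
apply: ler_sum => x _; rewrite /frozen_term ler_expR /= setI0 cards0 sub0r mulrN lerD2l.
rewrite [leRHS](_ : _ = rho * (4 * N)); last by ring.
rewrite ler_wpM2l ?rho_ge0 //.
rewrite /influence_left /=.
have : \sum_(u in H) influence u x <= 2 * N.
  apply: le_trans (sum_influence x); rewrite [leRHS](bigID (mem H)) /= lerDl.
  by apply: sumr_ge0 => *; apply: influence_ge0.
lra.
Qed.

End Kicking.

(** * Local sparsity and doubled colors *)

Section Slack.
Variables (R : realType) (V : finType) (D : nat) (adj : rel V).
Hypothesis adj_sym : symmetric adj.
Hypothesis adj_irr : irreflexive adj.
Hypothesis adj_deg : forall v, (#|[set w | adj v w]| <= D)%N.

Local Notation color := 'I_D.+1.
Local Notation N := (D.+1%:R : R).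
Local Notation coloring := {ffun V -> color}.

Variables (W : {set V}) (G1 : {set color}).

Local Notation nbr := (hnbr adj W).

(** Only colors of [G1] are kept. This set will have size linear in [N], so that many colors get
    doubled, but with a small constant, so that the kept colors leave almost the whole palette to
    the uncolored vertices. *)
Definition kept (y : coloring) : {set V} :=
  [set w in W | (y w \in G1) && [forall u in nbr w, y u != y w]].

Definition color_class (y : coloring) v c : {set V} := [set w in nbr v | y w == c].

Definition doubled (y : coloring) v : {set color} :=
  [set c in G1 | (#|color_class y v c| == 2)%N && (color_class y v c \subset kept y)].

Definition scope v : {set V} := nbr v :|: \bigcup_(w in nbr v) nbr w.

Definition nonedges v : {set V * V} :=
  [set p | [&& p.1 \in nbr v, p.2 \in nbr v, p.1 != p.2 & ~~ adj p.1 p.2]].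

(** Each doubled color is counted by two kept neighbors but removes a single color from the palette
    of [v]. *)
Lemma doubled_repeats (y : coloring) v :
  (#|y @: (nbr v :&: kept y)| + #|doubled y v| <= #|nbr v :&: kept y|)%N.
Proof.
set K := nbr v :&: kept y.
have dI : doubled y v \subset y @: K.
  apply/subsetP => c; rewrite inE => /and3P[_ /eqP c2 /subsetP ck].
  have /card_gt0P[w wc] : (0 < #|color_class y v c|)%N by rewrite c2.
  have wk := ck _ wc; move: wc; rewrite inE => /andP[wv /eqP <-].
  by apply: imset_f; rewrite inE wv.
rewrite -[X in (_ <= X)%N]sum1_card (partition_big_imset y) /=.
have -> : (#|y @: K| + #|doubled y v| = \sum_(c in y @: K) (1 + (c \in doubled y v)))%N.
  rewrite big_split /= sum1_card; congr (_ + _)%N.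
  rewrite -sum1_card big_mkcond [RHS]big_mkcond /=; apply: eq_bigr => c _.
  by case: ifPn => [cd|//]; [rewrite (subsetP dI) | case: ifP].
apply: leq_sum => c /imsetP[w wK yw].
rewrite sum1dep_card; case: (boolP (c \in doubled y v)) => [|_]; last first.
  by rewrite addn0 card_gt0; apply/set0Pn; exists w; rewrite inE wK yw eqxx.
rewrite inE => /and3P[_ /eqP c2 /subsetP ck].
rewrite addn1 -c2; apply/subset_leq_card/subsetP => x xc.
by rewrite inE inE (ck _ xc) andbT; move: xc; rewrite inE.
Qed.

Lemma kept_depends v w : w \in nbr v -> depends_on (scope v) (fun y => w \in kept y).
Proof.
move=> wv a b ab; have ws : w \in scope v by rewrite in_setU wv.
rewrite !inE (ab w ws).
congr (_ && (_ && _)); apply: eq_forallb => u.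
case: (boolP (u \in nbr w)) => //= uw; congr (_ != _); apply: ab.
by rewrite inE; apply/orP; right; apply/bigcupP; exists w.
Qed.

Lemma doubled_depends v : depends_on (scope v) (fun y => doubled y v).
Proof.
move=> a b ab; have cc c : color_class a v c = color_class b v c.
  by apply/setP => w; rewrite [LHS]in_set [RHS]in_set; case: (boolP (w \in nbr v)) => //= wv; rewrite ab // in_setU wv.
apply/setP => c; rewrite !inE cc; congr (_ && (_ && _)).
apply/subsetP/subsetP => h w wc; have := h _ wc; rewrite (@kept_depends v w _ a b) //.
- by move: wc; rewrite inE => /andP[].
- by move: wc; rewrite inE => /andP[].
Qed.

Lemma doubled_local (a b : coloring) i c v : (forall j, j != i -> a j = b j) ->
  a i != c -> b i != c -> (c \in doubled a v) = (c \in doubled b v).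
Proof.
move=> ab ac bc.
have e j : (a j == c) = (b j == c).
  by have [->|/ab ->//] := eqVneq j i; rewrite (negbTE ac) (negbTE bc).
have cc : color_class a v c = color_class b v c.
  by apply/setP => w; rewrite !inE e.
rewrite !inE cc; congr (_ && (_ && _)).
have key w : w \in color_class b v c -> (w \in kept a) = (w \in kept b).
  rewrite in_set => /andP[_ bw]; have aw := bw; rewrite -e in aw.
  rewrite !inE (eqP aw) (eqP bw); congr (_ && (_ && _)); apply: eq_forallb => u.
  by rewrite e.
by apply/subsetP/subsetP => h w wc; have := h _ wc; rewrite key.
Qed.

(* Recoloring a vertex [i] outside the neighborhood of [v] matters only for
   colors already present on common neighbors of [i] and [v]. *)
Lemma doubled_local_out (a b : coloring) i c v : (forall j, j != i -> a j = b j) ->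
  i \notin nbr v -> (forall w, w \in nbr i :&: nbr v -> a w != c) ->
  (c \in doubled a v) = (c \in doubled b v).
Proof.
move=> ab iv ic.
have abv w : w \in nbr v -> a w = b w by move=> wv; apply: ab; apply: contraNneq iv => <-.
have cc : color_class a v c = color_class b v c.
  by apply/setP => w; rewrite [LHS]in_set [RHS]in_set; case: (boolP (w \in nbr v)) => //= wv; rewrite abv.
rewrite !inE cc; congr (_ && (_ && _)).
have key w : w \in color_class b v c -> (w \in kept a) = (w \in kept b).
  rewrite inE => /andP[wv /eqP bw]; rewrite !inE abv //.
  congr (_ && (_ && _)); apply: eq_forallb => u.
  have [uw /=|//] := boolP (u \in nbr w); have [ui|/ab ->//] := eqVneq u i.
  have wi : w \in nbr i.
    by move: wv uw; rewrite ui !inE => /andP[-> _] /andP[_]; rewrite adj_sym.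
  by have := ic w; rewrite in_setI wi wv abv // bw eqxx => /(_ isT).
by apply/subsetP/subsetP => h w wc; have := h _ wc; rewrite key.
Qed.

Lemma card_diff_le (T : finType) (A B C : {set T}) :
  (forall c, c \notin C -> (c \in A) = (c \in B)) -> (#|A| <= #|B| + #|C|)%N.
Proof.
move=> h; apply: (@leq_trans #|B :|: C|); last exact: leq_card_setU.
apply/subset_leq_card/subsetP => c cA; rewrite inE.
by have [|/h <-] := boolP (c \in C); rewrite ?orbT // cA.
Qed.

Lemma dist_card (T : finType) (A B C : {set T}) :
  (forall c, c \notin C -> (c \in A) = (c \in B)) ->
  `|#|A|%:R - #|B|%:R| <= #|C|%:R :> R.
Proof.
move=> h; rewrite ler_norml; apply/andP; split.
  have : (#|B| <= #|A| + #|C|)%N by apply: card_diff_le => c /h.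
  by rewrite -(ler_nat R) natrD; lra.
have : (#|A| <= #|B| + #|C|)%N by apply: card_diff_le.
by rewrite -(ler_nat R) natrD; lra.
Qed.

Lemma doubled_diff (a b : coloring) i v : (forall j, j != i -> a j = b j) ->
  `|#|doubled a v|%:R - #|doubled b v|%:R| <= 2 :> R.
Proof.
move=> ab; apply: le_trans (dist_card (C := [set a i; b i]) _) _.
  by move=> c; rewrite in_setU !in_set1 negb_or => /andP[ca cb]; apply: (@doubled_local a b i); rewrite // eq_sym.
by rewrite (ler_nat R _ 2) cards2; case: (_ != _).
Qed.

(** The bound is random: its mean is [2 / N] times the number of common neighbors, usually far below
    the worst case 2. *)
Lemma doubled_diff_out (a b : coloring) i v : (forall j, j != i -> a j = b j) ->
  i \notin nbr v ->
  `|#|doubled a v|%:R - #|doubled b v|%:R| <=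
  \sum_(w in nbr i :&: nbr v) ((a w == a i)%:R + (a w == b i)%:R) :> R.
Proof.
move=> ab iv.
pose C := [set c in [set a i; b i] | [exists w in nbr i :&: nbr v, a w == c]].
apply: le_trans (dist_card (C := C) _) _.
  move=> c; rewrite [c \in C]in_set negb_and => /orP[|].
    by rewrite in_setU !in_set1 negb_or => /andP[ca cb]; apply: (@doubled_local a b i); rewrite // eq_sym.
  rewrite negb_exists_in => /forall_inP h; apply: (doubled_local_out ab iv) => w; exact: h.
rewrite -sum1_card natr_sum.
have -> : \sum_(w in nbr i :&: nbr v) ((a w == a i)%:R + (a w == b i)%:R) =
   \sum_(w in nbr i :&: nbr v) (a w == a i)%:R + \sum_(w in nbr i :&: nbr v) (a w == b i)%:R :> R.
  by rewrite big_split.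
have ex c : ([exists w in nbr i :&: nbr v, a w == c])%:R <=
    \sum_(w in nbr i :&: nbr v) (a w == c)%:R :> R.
  case: exists_inP => [[w wI wc]|_]; last by apply: sumr_ge0.
  by rewrite (bigD1 w) //= wc lerDl; apply: sumr_ge0.
apply: le_trans (lerD (ex (a i)) (ex (b i))).
rewrite -natr_sum -natrD ler_nat sum1_card.
apply: (@leq_trans #|[set c in [set a i] | [exists w in nbr i :&: nbr v, a w == c]]
   :|: [set c in [set b i] | [exists w in nbr i :&: nbr v, a w == c]]|).
  by apply/subset_leq_card/subsetP => c; rewrite !inE andb_orl.
have one x : (#|[set c in [set x] | [exists w in nbr i :&: nbr v, a w == c]]|
    <= [exists w in nbr i :&: nbr v, a w == x])%N.
  case: (boolP [exists _ in _, _]) => h.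
    by rewrite -[leqRHS](cards1 x); apply/subset_leq_card/subsetP => c; rewrite !inE => /andP[].
  by rewrite leqn0 cards_eq0; apply/eqP/setP => c; rewrite !inE; case: eqP => //= ->; apply/negbTE.
by apply: leq_trans (leq_card_setU _ _) (leq_add (one _) (one _)).
Qed.

Lemma sum_common v : (\sum_(i : V) #|nbr i :&: nbr v| <= D * D)%N.
Proof.
have -> : (\sum_i #|nbr i :&: nbr v| = \sum_i #|[set w | (w \in nbr v) && (w \in nbr i)]|)%N.
  by apply: eq_bigr => i _; apply: eq_card => w; rewrite in_setI in_set andbC.
rewrite (double_count xpredT (mem (nbr v)) (fun i w => w \in nbr i)).
apply: (@leq_trans (\sum_(w in nbr v) D)).
  apply: leq_sum => w _; apply: leq_trans (adj_deg w); apply: subset_leq_card.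
  by apply/subsetP => i; rewrite !in_set => /= /andP[_]; rewrite adj_sym.
by rewrite sum_nat_const leq_mul2r (card_hnbr adj_deg) orbT.
Qed.

(** The count depends on about [D^2] colors with differences up to 2, too much for a direct bound.
    The neighbors of [v] are treated first, given the others: at most [N] coordinates with
    difference 2. The conditional mean [F] then changes by at most [2 |common| / N] when an outer
    vertex [i] is recolored, and the squares of these numbers sum to at most [4 N], because the
    common neighbors number at most [D^2] in total. *)
Lemma doubled_mgf v (l : R) : 0 <= l -> 2 * l <= 1 ->
  Ex (fun y => expR (- l * #|doubled y v|%:R)) <=
  expR (- l * Ex (fun y => #|doubled y v|%:R) + 16 * l ^+ 2 * N).
Proof.
move=> l0 l1; have cg := color_gt0 D.
pose Y (y : coloring) : R := #|doubled y v|%:R.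
pose J := nbr v; pose F w := Ex (fun a => Y (mix J a w)).
have nD : #|nbr v|%:R <= N by rewrite ler_nat; apply: leqW; apply: (card_hnbr adj_deg).
have h1 w : Ex (fun a => expR (- l * Y (mix J a w))) <= expR (- l * F w) * expR (8 * l ^+ 2 * N).
  apply: le_trans (mgf_bounded_diff cg (b := fun=> 2) l0 _ _ w) _.
  - by move=> i _; rewrite mulrC.
  - by move=> i _ a c ac; apply: doubled_diff ac.
  rewrite -expRD ler_expR lerD2l sumr_const -[X in _ * X <= _]mulr_natl.
  have -> : 2 * l ^+ 2 * (#|nbr v|%:R * 2 ^+ 2) = 8 * l ^+ 2 * #|nbr v|%:R by ring.
  by rewrite ler_wpM2l // mulr_ge0 // sqr_ge0.
pose bb i : R := if i \in J then 0 else 2 * #|nbr i :&: nbr v|%:R / N.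
have bb2 i : bb i <= 2.
  rewrite /bb; case: ifP => // _; rewrite ler_pdivrMr ?ltr0n // ler_pM2l // ler_nat.
  apply: leqW; apply: leq_trans (card_hnbr adj_deg W v); apply/subset_leq_card/subsetIr.
have bb0 i : 0 <= bb i by rewrite /bb; case: ifP => // _; rewrite divr_ge0 // mulr_ge0.
have FD i (a c : coloring) : (forall j, j != i -> a j = c j) -> `|F a - F c| <= bb i.
  move=> ac; rewrite /bb; case: ifPn => iJ.
    rewrite /F (eq_Ex (g := fun e => Y (mix J e c))) ?subrr ?normr0 // => e.
    congr Y; apply/ffunP => j; rewrite !ffunE; case: ifPn => // jJ.
    by apply: ac; apply: contraNneq jJ => ->.
  rewrite /F -ExB.
  pose Z (e : coloring) : R := \sum_(w in nbr i :&: nbr v) ((e w == a i)%:R + (e w == c i)%:R).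
  have ZE : Ex Z = 2 * #|nbr i :&: nbr v|%:R / N.
    rewrite /Z Ex_sum (eq_bigr (fun=> 2 / N)) => [|w _].
      by rewrite sumr_const -[LHS]mulr_natl mulrA [_ * 2]mulrC.
    rewrite ExD; have e1 x : Ex (fun e : coloring => (e w == x)%:R) = 1 / N :> R.
      have := Pr_in R cg w [set x]; rewrite cards1 card_ord => <-.
      by apply: eq_Ex => e; rewrite inE.
    by rewrite !e1 -mulrDl.
  rewrite -ZE; have hp e : `|Y (mix J e a) - Y (mix J e c)| <= Z e.
    apply: le_trans (doubled_diff_out (i := i) _ iJ) _.
      by move=> j ji; rewrite !ffunE; case: ifP => // _; apply: ac.
    apply: ler_sum => w /setIP[_ wv].
    by rewrite !ffunE wv (negbTE iJ).
  rewrite ler_norml -ExN; apply/andP; split; apply: (le_Ex cg) => e.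
    by have := hp e; rewrite ler_norml => /andP[].
  by have := hp e; rewrite ler_norml => /andP[].
have h2 : Ex (fun a => expR (- l * F a)) <= expR (- l * Ex F + 8 * l ^+ 2 * N).
  apply: le_trans (mgf_bounded_diffT cg (b := bb) (f := F) l0 _ FD) _.
    by move=> i; have := bb2 i; nra.
  rewrite ler_expR lerD2l.
  apply: (@le_trans _ _ (2 * l ^+ 2 * (4 * N))); last by apply: eq_leW; ring.
  rewrite ler_wpM2l ?mulr_ge0 ?sqr_ge0 //.
  apply: (@le_trans _ _ (\sum_(i : V) 4 * (#|nbr i :&: nbr v|%:R / N))).
    apply: ler_sum => i _.
    rewrite /bb; case: ifP => _; first by rewrite expr0n /= mulr_ge0 ?divr_ge0.
    have q1 : #|nbr i :&: nbr v|%:R / N <= 1 :> R.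
      rewrite ler_pdivrMr ?ltr0n // mul1r ler_nat; apply: leqW.
      by apply: leq_trans (card_hnbr adj_deg W v); apply/subset_leq_card/subsetIr.
    have q0 : 0 <= #|nbr i :&: nbr v|%:R / N :> R by rewrite divr_ge0.
    by rewrite -mulrA exprMn expr2 -natrM ler_pM2l // expr2 ler_piMl.
  rewrite -mulr_sumr ler_pM2l // -mulr_suml ler_pdivrMr ?ltr0n // -natr_sum -natrM ler_nat.
  apply: leq_trans (sum_common v) _; apply: leq_mul; exact: leqW.
rewrite -(Ex_mix cg J).
apply: le_trans (le_Ex cg h1) _; rewrite ExZr.
apply: le_trans (ler_wpM2r (expR_ge0 _) h2) _.
rewrite -expRD ler_expR /F (Ex_mix cg J Y) /Y.
by apply: eq_leW; ring.
Qed.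

Lemma card_scope v : (#|scope v| <= D + D * D)%N.
Proof.
apply: leq_trans (leq_card_setU _ _) _; apply: leq_add; first exact: (card_hnbr adj_deg).
apply: leq_trans (card_bigcup_le (n := D) _) _; first by move=> w _; apply: (card_hnbr adj_deg).
by rewrite leq_mul2r (card_hnbr adj_deg) orbT.
Qed.

Lemma scope_sym v u : u \in scope v -> u \in W -> v \in W -> v \in scope u.
Proof.
move=> us uW vW; move: us; rewrite !in_setU => /orP[uv|/bigcupP[x xv ux]]; apply/orP.
  by left; move: uv; rewrite !inE vW adj_sym => /andP[].
right; apply/bigcupP; exists x; last by move: xv; rewrite !inE vW adj_sym => /andP[].
by move: ux xv; rewrite !inE adj_sym => /andP[_ ->] /andP[->].
Qed.

Lemma scope_W v : scope v \subset W.
Proof.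
apply/subsetP => u; rewrite in_setU => /orP[|/bigcupP[x _]]; by rewrite inE => /andP[].
Qed.

(** For positive [m], [1 - 1 / (m + 1)] is the inverse of [1 + 1 / m], which is at most
    [exp (1 / m)]. *)
Lemma nat_expr_bound (m : nat) : (1 - 1 / m.+1%:R) ^+ m >= expR (- 1) :> R.
Proof.
case: m => [|m]; first by rewrite expr0 -[leRHS]expR0 ler_expR; lra.
have h := expR_ge1Dx (1 / m.+1%:R : R).
have e0 := expR_gt0 (1 / m.+1%:R : R).
have m0 : 0 < m.+1%:R :> R by rewrite ltr0n.
have mp : 0 < 1 / m.+1%:R :> R by rewrite divr_gt0.
have eq1 : 1 - 1 / m.+2%:R = (1 + 1 / m.+1%:R)^-1 :> R.
  rewrite -[m.+2%:R]natr1; field.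
  by rewrite !gt_eqF //; lra.
have -> : - 1 = m.+1%:R * - (1 / m.+1%:R) :> R.
  by rewrite mulrN mulrCA divff ?mul1r // gt_eqF.
rewrite expRM_natl lerXn2r ?nnegrE ?expR_ge0 //.
  by rewrite eq1 invr_ge0 addr_ge0 // ltW.
by rewrite eq1 expRN lef_pV2 ?posrE // addr_gt0.
Qed.

(** A color is certainly doubled if both ends of a nonadjacent pair receive it and none of the at
    most [3 D] other vertices near [v] and the pair does. This has probability at least
    [N^-2 (1 - 1/N)^(3D)]. The factor 2 in the denominator accounts for ordered pairs. *)
Lemma Ex_doubled_ge v : (forall a, a \in nbr v -> a \in W) ->
  #|G1|%:R * #|nonedges v|%:R * expR (- 3) / (2 * N ^+ 2) <= Ex (fun y => #|doubled y v|%:R) :> R.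
Proof.
move=> _; have cg := color_gt0 D.
pose others (p : V * V) := (nbr v :|: nbr p.1 :|: nbr p.2) :\: [set p.1; p.2].
pose ev (p : V * V) c (y : coloring) := [&& y p.1 == c, y p.2 == c & [forall u in others p, y u != c]].
have N0 : 0 < N by rewrite ltr0n.
have Pev p c : p \in nonedges v -> N ^- 2 * expR (- 3) <= Pr R (ev p c).
  rewrite inE => /and4P[p1 p2 p12 pa].
  pose A u : {set color} := if u \in [set p.1; p.2] then [set c] else ~: [set c].
  have -> : Pr R (ev p c) = Pr R (fun y : coloring => [forall (u | u \in [set p.1; p.2] :|: others p), y u \in A u]).
    apply: eq_Pr => y; apply/and3P/forall_inP => [[/eqP y1 /eqP y2 /forall_inP yo] u|h].
      rewrite in_setU /A; case: ifPn => [|up /= uo]; last by rewrite !inE yo.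
      by rewrite !inE => /orP[] /eqP -> _; rewrite ?y1 ?y2.
    split.
    - by have := h p.1; rewrite /A !inE eqxx /= inE => /(_ isT).
    - by have := h p.2; rewrite /A !inE eqxx !orbT /= inE => /(_ isT).
    apply/forall_inP => u uo; have := h u; rewrite in_setU uo orbT => /(_ isT).
    by move: uo; rewrite /A in_setD => /andP[/negbTE -> _]; rewrite !inE.
  rewrite Pr_forall // card_ord (big_setID [set p.1; p.2]) /= setUK.
  rewrite setDUl setDv set0U setDDl setUid -/(others p).
  apply: ler_pM; rewrite ?expR_ge0 ?invr_ge0 ?exprn_ge0 ?ler0n //.
    rewrite (eq_bigr (fun=> 1 / N)) => [|u up]; last by rewrite /A up cards1.
    by rewrite prodr_const cards2 p12 /= mul1r exprVn.
  rewrite (eq_bigr (fun=> 1 - 1 / N)) => [|u]; last first.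
    rewrite in_setD => /andP[/negbTE up _]; rewrite /A up.
    have := f_equal (fun n => n%:R : R) (cardsC [set c]); rewrite /= cards1 card_ord natrD => <-.
    set x := (#|~: [set c]|%:R : R); have x0 : 0 <= x by [].
    by field; rewrite gt_eqF //; lra.
  rewrite prodr_const.
  have oD : (#|others p| <= D * 3)%N.
    apply: leq_trans (subset_leq_card (subsetDl _ _)) _.
    apply: leq_trans (leq_card_setU _ _) _; rewrite mulnS addnC.
    apply: leq_add; first exact: (card_hnbr adj_deg).
    apply: leq_trans (leq_card_setU _ _) _; rewrite mulnS muln1.
    by apply: leq_add; exact: (card_hnbr adj_deg).
  have q1 : 0 <= 1 - 1 / N <= 1.
    apply/andP; split; last by rewrite gerBl divr_ge0.
    by rewrite subr_ge0 ler_pdivrMr // mul1r ler1n.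
  apply: le_trans (_ : (1 - 1 / N) ^+ (D * 3) <= _); last first.
    by case/andP: q1 => q0 q1; apply: ler_wiXn2l.
  rewrite exprM; have := nat_expr_bound D => h.
  have -> : expR (- 3) = expR (- 1) ^+ 3 :> R by rewrite -expRM_natl; congr expR; ring.
  by rewrite lerXn2r ?nnegrE ?expR_ge0 ?exprn_ge0 //; case/andP: q1.
have pt (y : coloring) c : c \in G1 ->
    \sum_(p in nonedges v) (ev p c y)%:R <= 2 * (c \in doubled y v)%:R :> R.
  move=> cG; have [/exists_inP[p pn pe]|] := boolP [exists p in nonedges v, ev p c y]; last first.
    rewrite negb_exists_in => /forall_inP h; rewrite big1 ?mulr_ge0 // => p /h /negbTE -> //.
  have := pn; rewrite inE => /and4P[p1 p2 p12 pa].
  have /and3P[/eqP y1 /eqP y2 /forall_inP yo] := pe.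
  have cls : color_class y v c = [set p.1; p.2].
    apply/setP => u; rewrite in_set; apply/andP/idP => [[uv /eqP uc]|].
      apply: contraT => up; have := yo u; rewrite uc eqxx.
      by rewrite in_setD up !in_setU uv => /(_ isT).
    by rewrite !inE => /orP[] /eqP ->; rewrite ?y1 ?y2 ?eqxx; move: p1 p2; rewrite !inE.
  have cd : c \in doubled y v.
    rewrite in_set cG cls cards2 p12 /=; apply/subsetP => u up.
    have uc : y u = c by move: up; rewrite !inE => /orP[] /eqP ->.
    have uv : u \in nbr v by move: up; rewrite !in_set2 => /orP[] /eqP ->.
    have uW : u \in W by move: uv; rewrite in_set => /andP[].
    rewrite in_set uW uc cG /=.
    apply/forall_inP => x xu; apply/negP => /eqP xc.
    have [xp|xp] := boolP (x \in [set p.1; p.2]); last first.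
      have xo : x \in others p.
        rewrite in_setD xp !in_setU; move: up; rewrite in_set2 => /orP[] /eqP <-; by rewrite xu !orbT.
      by have := yo x xo; rewrite xc eqxx.
    move: up xp xu; rewrite !in_set2 [x \in nbr u]in_set => /orP[] /eqP -> /orP[] /eqP ->;
      rewrite ?adj_irr ?andbF // => /andP[_]; rewrite ?(negbTE pa) //.
    by rewrite adj_sym (negbTE pa).
  rewrite cd mulr1 -natr_sum (ler_nat R _ 2).
  apply: (@leq_trans #|[set (p.1, p.2); (p.2, p.1)]|); last by rewrite cards2; case: (_ != _).
  rewrite -sum1_card big_mkcond [X in (_ <= X)%N]big_mkcond; apply: leq_sum => q _.
  case: ifPn => // qn; case: (boolP (ev q c y)) => //= /and3P[/eqP q1 /eqP q2 _].
  have := qn; rewrite inE => /and4P[q1v q2v q12 _].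
  have q1c : q.1 \in [set p.1; p.2] by rewrite -cls in_set q1v q1 eqxx.
  have q2c : q.2 \in [set p.1; p.2] by rewrite -cls in_set q2v q2 eqxx.
  suff -> : q \in [set (p.1, p.2); (p.2, p.1)] by [].
  case: q q1c q2c q12 {qn q1 q2 q1v q2v} => a b /=; rewrite !in_set2 !xpair_eqE.
  by move=> /orP[] /eqP -> /orP[] /eqP ->; rewrite ?eqxx ?orbT.
have le1 : Ex (fun y : coloring => \sum_(c in G1) \sum_(p in nonedges v) (ev p c y)%:R) <=
    2 * Ex (fun y => #|doubled y v|%:R) :> R.
  rewrite -ExZ; apply: (le_Ex cg) => y.
  apply: (@le_trans _ _ (\sum_(c in G1) 2 * (c \in doubled y v)%:R)).
    by apply: ler_sum => c; apply: pt.
  rewrite -mulr_sumr ler_pM2l // -natr_sum ler_nat -sum1_card big_mkcond [X in (_ <= X)%N]big_mkcond.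
  by apply: leq_sum => c _; case: (c \in G1); case: (c \in doubled y v).
have le2 : #|G1|%:R * (#|nonedges v|%:R * (N ^- 2 * expR (- 3))) <=
   Ex (fun y : coloring => \sum_(c in G1) \sum_(p in nonedges v) (ev p c y)%:R) :> R.
  rewrite Ex_sum mulr_natl -sumr_const; apply: ler_sum => c _.
  rewrite Ex_sum mulr_natl -sumr_const; apply: ler_sum => p pn; exact: Pev.
have := le_trans le2 le1; set E := Ex _; move=> h.
have -> : #|G1|%:R * #|nonedges v|%:R * expR (- 3) / (2 * N ^+ 2) =
   #|G1|%:R * (#|nonedges v|%:R * (N ^- 2 * expR (- 3))) / 2 :> R.
  by rewrite invfM; ring.
by rewrite ler_pdivrMr // [leRHS]mulrC.
Qed.

Lemma doubled_tail v (m : R) : 0 <= m <= 1 ->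
  2 * m * N ^+ 3 <= #|G1|%:R * #|nonedges v|%:R * expR (- 3) ->
  Pr R (fun y => #|doubled y v|%:R < m * N / 2) <= expR (- (m ^+ 2 / 256) * N).
Proof.
case/andP=> m0 m1 hm; have N0 : 0 < N by rewrite ltr0n.
have cg := color_gt0 D.
have mu : m * N <= Ex (fun y => #|doubled y v|%:R).
  apply: le_trans (Ex_doubled_ge (v := v) _); last by move=> a; rewrite inE => /andP[].
  rewrite ler_pdivlMr ?mulr_gt0 ?exprn_gt0 //; apply: le_trans hm.
  by apply: eq_leW; ring.
set E := Ex _ in mu.
(* The minimizer of the exponent [- l m / 2 + 16 l^2]. *)
pose l := m / 64; have l0 : 0 <= l by rewrite /l; lra.
have h := doubled_mgf v l0 _; rewrite -/E in h.
apply: (@le_trans _ _ (Ex (fun y => expR (l * (m * N / 2)) * expR (- l * #|doubled y v|%:R)))).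
  apply: (Pr_markov cg) => y; first by rewrite mulr_ge0 ?expR_ge0.
  move=> yl; rewrite -expRD -[leLHS]expR0 ler_expR.
  have : l * #|doubled y v|%:R <= l * (m * N / 2) by rewrite ler_wpM2l // ltW.
  by lra.
rewrite ExZ; apply: le_trans (_ : expR (l * (m * N / 2)) * expR (- l * E + 16 * l ^+ 2 * N) <= _).
  by rewrite ler_wpM2l ?expR_ge0 // h // /l; lra.
rewrite -expRD ler_expR.
have : l * (m * N) <= l * E by rewrite ler_wpM2l.
have -> : - (m ^+ 2 / 256) * N = - (l * (m * N) / 4) by rewrite /l; field.
have -> : 16 * l ^+ 2 * N = l * (m * N) / 4 by rewrite /l; field.
have : 0 <= l * (m * N) by rewrite mulr_ge0 // mulr_ge0 // ltW.
lra.
Qed.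

End Slack.

(** * Coloring the sparse remainder: resampled slack, then kicking *)

Section SparsePart.
Variables (R : realType) (V : finType) (D r k4 k3 M E : nat) (adj : rel V).
Hypothesis adj_sym : symmetric adj.
Hypothesis adj_irr : irreflexive adj.
Hypothesis adj_deg : forall v, (#|[set w | adj v w]| <= D)%N.

Local Notation color := 'I_D.+1.
Local Notation N := (D.+1%:R : R).
Local Notation slot := (bool * ('I_k4 + 'I_k3))%type.
Local Notation row := ('I_r.+1 + slot)%type.
Local Notation draws := {ffun V * row -> color}.

Variables (W : {set V}) (G1 : {set color}) (z m tau lam p4 pf : R).

Local Notation nbr := (hnbr adj W).

Hypothesis z_ge0 : 0 <= z <= 1.
Hypothesis W_sparse : forall v, v \in W ->
  #|nbr v|%:R <= (1 - z) * N \/ z * N ^+ 2 <= #|nonedges adj W v|%:R.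
Hypothesis m_bounds : 0 <= m <= 2 * z.
Hypothesis m_le1 : m <= 1.
Hypothesis m_small : 2 * m * N ^+ 3 <= #|G1|%:R * (z * N ^+ 2) * expR (- 3).
Hypotheses (lam_ge0 : 0 <= lam) (k3_gt0 : (0 < k3)%N) (pf_ge0 : 0 <= pf).
Hypothesis G1_small : #|G1|%:R + D%:R / M.+1%:R + E%:R <= tau * N.
Hypothesis p4_ge : (1 - m / 2) ^+ k4 <= p4.
Hypothesis pf_ge : tau ^+ k3 <= pf.

Definition colorable_on (J : finType) (U : {set V}) (w : {ffun V * J -> color}) : bool :=
  [exists f : {ffun V -> color},
    [forall u in U, [exists j, w (u, j) == f u] &&
      [forall v in U, adj u v ==> (f u != f v)]]].

Definition slack_event (v : V) (y : {ffun V -> color}) : bool :=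
  [&& v \in W, z * N ^+ 2 <= #|nonedges adj W v|%:R &
      #|doubled adj W G1 y v|%:R < m * N / 2].

Definition event_scope (v : V) : {set V} := if v \in W then scope adj W v else set0.

Definition slack_p : R := expR (- (m ^+ 2 / 256) * N).
(** One for the event itself. Any other event it meets shares a vertex [u] of the scope, with
    [D + D^2] choices for [u] and, scopes being symmetric, as many for the other event. *)
Definition slack_d : nat := (1 + (D + D * D) * (D + D * D))%N.

Hypothesis dp_small : slack_d%:R * slack_p * expR (2 * r%:R) <= 1.

Lemma slack_event_depends v : depends_on (event_scope v) (slack_event v).
Proof.
move=> a b; rewrite /slack_event /event_scope; case: ifP => // vW ab.
by rewrite (doubled_depends G1 ab).
Qed.

Lemma Pr_slack_event v : Pr R (slack_event v) <= slack_p.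
Proof.
have cg := color_gt0 D.
have z0 : 0 < N by rewrite ltr0n.
have [vW|vW] := boolP (v \in W); last first.
  by rewrite (Pr_eq0 R cg) ?expR_ge0 // => y; rewrite /slack_event (negbTE vW).
have [ne|ne] := boolP (z * N ^+ 2 <= #|nonedges adj W v|%:R); last first.
  by rewrite (Pr_eq0 R cg) ?expR_ge0 // => y; rewrite /slack_event (negbTE ne) andbF.
apply: le_trans (doubled_tail adj_sym adj_irr adj_deg (W := W) (G1 := G1) (v := v) (m := m) _ _).
- by apply: (le_Pr R cg) => y /and3P[].
- by case/andP: m_bounds => -> _.
- by apply: le_trans m_small _; rewrite ler_wpM2r ?expR_ge0 // ler_wpM2l.
Qed.

Lemma card_meets v : (#|[set w | meets event_scope v w]| <= slack_d)%N.
Proof.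
have cs u : (#|scope adj W u| <= D + D * D)%N by apply: card_scope.
apply: (@leq_trans #|v |: \bigcup_(u in event_scope v) [set w in W | u \in scope adj W w]|).
  apply/subset_leq_card/subsetP => w; rewrite inE => /orP[/eqP ->|].
    by rewrite in_setU1 eqxx.
  case/pred0Pn => u /= /andP[uv uw]; rewrite in_setU1; apply/orP; right.
  apply/bigcupP; exists u => //; move: uw; rewrite /event_scope inE.
  by case: ifP => //; rewrite inE.
rewrite cardsU1; apply: leq_add; first by case: (_ \in _).
apply: leq_trans (card_bigcup_le (n := D + D * D) _) _.
  move=> u; rewrite /event_scope; case: ifP => [vW uv|_]; last by rewrite inE.
  have uW : u \in W by apply: (subsetP (scope_W adj W v)).
  apply: leq_trans (cs u); apply/subset_leq_card/subsetP => w; rewrite inE => /andP[wW us].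
  exact: (scope_sym adj_sym us).
by rewrite leq_mul2r; apply/orP; right; rewrite /event_scope; case: ifP => _; rewrite ?cards0.
Qed.

Definition table_part (w : draws) : {ffun V * 'I_r.+1 -> color} :=
  [ffun c => w (c.1, inl c.2)].

Definition slot_part (w : draws) : {ffun V * slot -> color} :=
  [ffun c => w (c.1, inr c.2)].

Definition table_bad (x : {ffun V * 'I_r.+1 -> color}) : bool :=
  ~~ [exists l : {ffun V -> 'I_r.+1},
     [forall v, ~~ slack_event v (table_row (fun u => l u : nat) x)]].

Lemma Pr_table_bad : Pr R (fun w => table_bad (table_part w)) <=
  #|V|%:R * (slack_d%:R * slack_p * expR (2 * r%:R)) ^+ r * (slack_p * expR (2 * r%:R)).
Proof.
have cg := color_gt0 D.
have hI : injective (fun c : V * 'I_r.+1 => (c.1, inl c.2 : row)).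
  by move=> [a i] [b j] [-> ->].
apply: le_trans (resampling cg slack_event_depends _ Pr_slack_event card_meets dp_small).
  by rewrite -(Pr_inj R cg table_bad hI).
exact: expR_ge0.
Qed.

(** A kept neighbor removes at most one color, so the surplus is at least [N - |nbr u|], enough when
    the degree is small. Otherwise the doubled colors add [m N / 2] to it. *)
Lemma slack_rest y u : [forall v, ~~ slack_event v y] -> u \in W ->
  m / 2 * N + #|hnbr adj (W :\: kept adj W G1 y) u|%:R <=
  #|~: (y @: (nbr u :&: kept adj W G1 y))|%:R.
Proof.
move=> /forallP/(_ u) ny uW; set K := kept _ _ _ _.
have eH : hnbr adj (W :\: K) u = nbr u :\: K.
  by apply/setP => x; rewrite [LHS]in_set in_setD [RHS]in_setD [x \in nbr u]in_set andbA.
have eN := f_equal (fun n => n%:R : R) (cardsC (y @: (nbr u :&: K))).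
rewrite /= card_ord natrD in eN.
have eD := f_equal (fun n => n%:R : R) (cardsID K (nbr u)); rewrite /= natrD in eD.
rewrite eH.
have nN : #|nbr u|%:R <= N by rewrite ler_nat; apply: leqW; apply: (card_hnbr adj_deg).
have N0 : 0 < N by rewrite ltr0n.
have [m0 m2] := andP m_bounds.
have hi : #|y @: (nbr u :&: K)|%:R <= #|nbr u :&: K|%:R :> R.
  by rewrite ler_nat leq_imset_card.
have [small|ne] := W_sparse uW.
  have : m / 2 * N <= z * N by rewrite ler_pM2r //; lra.
  by move: small; rewrite mulrBl mul1r; lra.
move: ny; rewrite /slack_event uW ne /= -leNgt => ny.
have := doubled_repeats adj W G1 y u; rewrite -/K -(ler_nat R) natrD.
by move: ny; rewrite mulrAC; lra.
Qed.

Lemma sparse_coloring : Pr R (fun w : draws => ~~ colorable_on W w) <=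
  #|V|%:R * (slack_d%:R * slack_p * expR (2 * r%:R)) ^+ r * (slack_p * expR (2 * r%:R)) +
  (#|V|%:R * expR (- (lam * E%:R) + 4 * rho k3 M lam p4 * N) + 2 * pf * #|V|%:R).
Proof.
have cg := color_gt0 D.
have m0 : 0 <= m / 2 <= 1.
  have [h _] := andP m_bounds; have h1 := m_le1; apply/andP; split.
    by rewrite divr_ge0.
  by rewrite ler_pdivrMr // mul1r; apply: le_trans h1 _; rewrite ler1n.
apply: le_trans (lerD Pr_table_bad (lexx _)).
apply: (@le_trans _ _ (Pr R (fun w => table_bad (table_part w)) +
   Pr R (fun w : draws => ~~ table_bad (table_part w) && ~~ colorable_on W w))).
  apply: le_trans (PrU R cg _ _); apply: (le_Pr R cg) => w nw.
  by rewrite nw andbT orbN.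
rewrite lerD2l.
set B := _ + _; have B0 : 0 <= B.
  by rewrite addr_ge0 // !mulr_ge0 ?expR_ge0.
(* The resampling table is fixed from here on; only the slots of the kicking process remain
   random. *)
apply: (Pr_cond cg (J := [set c : V * row | if c.2 is inr _ then true else false])) => b.
set J := [set c : V * row | _].
have tb a : table_part (mix J a b) = table_part b.
  by apply/ffunP => c; rewrite !ffunE inE.
have sb a : slot_part (mix J a b) = slot_part a.
  by apply/ffunP => c; rewrite !ffunE inE.
have [bad|/negPn/existsP[l lP]] := boolP (table_bad (table_part b)).
  by rewrite (Pr_eq0 R cg) // => a; rewrite tb bad.
pose y := table_row (fun u => l u : nat) (table_part b).
pose K := kept adj W G1 y; pose H := W :\: K.
pose A0 u := ~: (y @: (nbr u :&: K)).
have yG u : y @: (nbr u :&: K) \subset G1.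
  by apply/subsetP => c /imsetP[w /setIP[_ wK] ->]; move: wK; rewrite in_set => /and3P[].
have slack u : u \in H -> m / 2 * N + #|hnbr adj H u|%:R <= #|A0 u|%:R.
  by rewrite in_setD => /andP[_ uW]; apply: slack_rest.
have big u : u \in H -> #|~: A0 u|%:R + D%:R / M.+1%:R + E%:R <= tau * N.
  move=> _; apply: le_trans G1_small; rewrite setCK !lerD2r ler_nat.
  exact: subset_leq_card.
have kc := kick_coloring adj_sym adj_irr adj_deg lam_ge0 k3_gt0 m0 slack big p4_ge pf_ge0 pf_ge.
have hI : injective (fun c : V * slot => (c.1, inr c.2 : row)).
  by move=> [u i] [v j] [-> ->].
apply: (@le_trans _ _ (Pr R (fun a => ~~ kcolorable adj H A0 (slot_part a)))); last first.
  rewrite (Pr_inj R cg (fun a => ~~ kcolorable adj H A0 a) hI).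
  apply: le_trans kc _; rewrite lerD2l ler_wpM2l ?mulr_ge0 //.
  by rewrite ler_nat max_card.
apply: (le_Pr R cg) => a /andP[_]; apply: contra => /existsP[f /forall_inP fP].
pose g : {ffun V -> color} := [ffun u => if u \in K then y u else f u].
have gE u : g u = if u \in K then y u else f u by rewrite ffunE.
apply/existsP; exists g.
have KW u : u \in K -> u \in W by rewrite in_set => /andP[].
apply/forall_inP => u uW; rewrite !gE; apply/andP; split.
  case: ifPn => uK.
    by apply/existsP; exists (inl (inord (l u))); rewrite !ffunE inE.
  have uH : u \in H by rewrite in_setD uK.
  have /and3P[_ /existsP[j /eqP <-] _] := fP _ uH.
  by apply/existsP; exists (inr j); rewrite !ffunE inE.
apply/forall_inP => v vW; apply/implyP => uv; rewrite gE.
have kk x x' : x \in K -> x' \in W -> adj x x' -> y x != y x'.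
  move=> xK x'W xx'; move: xK; rewrite in_set => /and3P[_ _ /forall_inP/(_ x')].
  by rewrite in_set x'W xx' eq_sym => /(_ isT).
have kh x x' : x \in K -> x' \notin K -> x' \in W -> adj x' x -> f x' != y x.
  move=> xK x'K x'W xx'; have x'H : x' \in H by rewrite in_setD x'K.
  have /and3P[fA _ _] := fP _ x'H; move: fA; rewrite in_setC.
  apply: contra => /eqP ->; apply: imset_f; rewrite in_setI xK andbT in_set xx' andbT.
  exact: KW.
case: ifPn => uK; case: ifPn => vK.
- exact: kk.
- by rewrite eq_sym; apply: kh => //; rewrite adj_sym.
- exact: kh.
have uH : u \in H by rewrite in_setD uK.
have vH : v \in H by rewrite in_setD vK.
by have /and3P[_ _ /forall_inP/(_ v vH)/implyP/(_ uv)] := fP _ uH.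
Qed.

End SparsePart.

(** * Hall matchings inside a cluster *)

Section Hall.
Variables (U X : finType) (x0 : X).

Definition nbhd (N : U -> {set X}) (A : {set U}) : {set X} := \bigcup_(u in A) N u.

Lemma nbhdU N (A B : {set U}) : nbhd N (A :|: B) = nbhd N A :|: nbhd N B.
Proof. by rewrite /nbhd bigcup_setU. Qed.

(** If some nonempty proper subset is tight, it is matched by itself and the rest avoids its
    neighborhood. If none is, an arbitrary edge can be used, since every nonempty proper subset has
    a color to spare. *)
Theorem hall (C : {set U}) (N : U -> {set X}) :
  (forall A : {set U}, A \subset C -> (#|A| <= #|nbhd N A|)%N) ->
  exists f : U -> X, (forall u, u \in C -> f u \in N u) /\ {in C &, injective f}.
Proof.
have [n] := ubnP #|C|; elim: n C N => // n IH C N Cn hall.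
have [->|[u uC]] := set_0Vmem C.
  by exists (fun=> x0); split=> [u|u v]; rewrite inE.
have [/existsP[A /and4P[AC A0 AnC /eqP tight]]|] := boolP [exists A : {set U},
   [&& A \subset C, A != set0, A != C & #|nbhd N A| == #|A|]].
  have [f [fN fI]] : exists f : U -> X, (forall u, u \in A -> f u \in N u) /\ {in A &, injective f}.
    apply: IH => [|B BA]; last exact: hall (subset_trans BA AC).
    by apply: leq_trans (proper_card _) Cn; rewrite properEneq AnC.
  pose N' v := N v :\: nbhd N A.
  have [g [gN gI]] : exists g : U -> X, (forall u, u \in C :\: A -> g u \in N' u) /\ {in C :\: A &, injective g}.
    apply: IH => [|B BA].
      apply: leq_trans (_ : #|C| <= n)%N => //; rewrite cardsD (setIidPr AC).
      have := subset_leq_card AC; have : (0 < #|A|)%N by rewrite card_gt0.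
      by lia.
    have BC : A :|: B \subset C by rewrite subUset AC (subset_trans BA) // subsetDl.
    have := hall _ BC; rewrite nbhdU cardsU.
    have -> : A :&: B = set0.
      apply/setP => v; rewrite !inE; apply/andP => -[vA /(subsetP BA)]; by rewrite inE vA.
    have -> : nbhd N' B = nbhd N B :\: nbhd N A.
      apply/setP => x; rewrite inE; apply/bigcupP/andP => [[v vB]|[xA /bigcupP[v vB vx]]].
        by rewrite inE => /andP[-> vx]; split=> //; apply/bigcupP; exists v.
      by exists v => //; rewrite inE xA.
    rewrite cardsD cards0 subn0 cardsU setIC.
    have := subset_leq_card (subsetIl (nbhd N B) (nbhd N A)).
    lia.
  exists (fun v => if v \in A then f v else g v); split=> [v vC|v w vC wC].
    case: ifPn => vA; first exact: fN.
    have : v \in C :\: A by rewrite inE vA.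
    by move=> /gN; rewrite inE => /andP[].
  have fA x : x \in A -> f x \in nbhd N A.
    by move=> xA; apply/bigcupP; exists x => //; apply: fN.
  have gA x : x \in C -> x \notin A -> g x \notin nbhd N A.
    move=> xC xA; have /gN : x \in C :\: A by rewrite inE xA.
    by rewrite inE => /andP[].
  case: ifPn => vA; case: ifPn => wA; first exact: fI.
  - by move=> e; have := gA _ wC wA; rewrite -e fA.
  - by move=> e; have := gA _ vC vA; rewrite e fA.
  - by apply: gI; rewrite inE ?vA ?wA.
rewrite negb_exists => /forallP loose.
have /card_gt0P[x xu] : (0 < #|N u|)%N.
  have := hall [set u]; rewrite sub1set uC cards1 => /(_ isT).
  by rewrite /nbhd big_set1.
pose N' v := N v :\ x.
have [f [fN fI]] : exists f : U -> X, (forall v, v \in C :\ u -> f v \in N' v) /\ {in C :\ u &, injective f}.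
  apply: IH => [|A AC]; first by move: Cn; rewrite (cardsD1 u) uC.
  have AC' : A \subset C by apply: subset_trans AC (subsetDl _ _).
  have -> : nbhd N' A = nbhd N A :\ x.
    apply/setP => y; rewrite inE; apply/bigcupP/andP => [[v vB]|[yA /bigcupP[v vB vx]]].
      by rewrite in_setD => /andP[-> vx]; split=> //; apply/bigcupP; exists v.
    by exists v => //; rewrite in_setD yA.
  have [->|A0] := eqVneq A set0; first by rewrite cards0.
  have AnC : A != C.
    by apply/eqP => e; have := subsetP AC u; rewrite e uC !inE eqxx => /(_ isT).
  have := loose A; rewrite AC' A0 AnC /= => ne.
  have := hall A AC'; have := cardsD1 x (nbhd N A); move: ne; case: (x \in _); lia.
exists (fun v => if v == u then x else f v); split=> [v vC|v w vC wC].
  have [->//|vu] := eqVneq v u.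
  have /fN : v \in C :\ u by rewrite !inE vu.
  by rewrite in_setD1 => /andP[].
have fx y : y \in C -> y != u -> f y != x.
  move=> yC yu; have /fN : y \in C :\ u by rewrite !inE yu.
  by rewrite in_setD1 => /andP[].
have [->|vu] := eqVneq v u; have [->|wu] := eqVneq w u => //.
- by move=> e; have := fx _ wC wu; rewrite -e eqxx.
- by move=> e; have := fx _ vC vu; rewrite e eqxx.
by apply: fI; rewrite !inE ?vu ?wu.
Qed.

End Hall.

(** * Generating functions and enumeration of small sets *)

Section ProductTools.
Variables (R : realType) (I X : finType).
Hypothesis X_gt0 : (0 < #|X|)%N.

Lemma Ex_prod (phi : I -> X -> R) :
  Ex (fun w : {ffun I -> X} => \prod_i phi i (w i)) = \prod_i ((\sum_x phi i x) / #|X|%:R).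
Proof.
rewrite /Ex -bigA_distr_bigA /= card_ffun natrX -[X in _ / X]prodr_const.
by rewrite -prodf_div.
Qed.

Lemma Ex_count (J : {set I}) (A : I -> {set X}) (s : R) :
  Ex (fun w : {ffun I -> X} => s ^+ #|[set i in J | w i \in A i]|) =
  \prod_(i in J) (1 + (s - 1) * (#|A i|%:R / #|X|%:R)).
Proof.
have X0 : #|X|%:R != 0 :> R by rewrite pnatr_eq0 -lt0n.
transitivity (Ex (fun w : {ffun I -> X} => \prod_i (if (i \in J) && (w i \in A i) then s else 1))).
  apply: eq_Ex => w; rewrite -prodr_const [LHS]big_mkcond /=; apply: eq_bigr => i _.
  by rewrite inE.
rewrite (Ex_prod (fun i x => if (i \in J) && (x \in A i) then s else 1)) [RHS]big_mkcond /=.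
apply: eq_bigr => i _; case: (i \in J) => /=; last by rewrite sumr_const divff.
rewrite (eq_bigr (fun x => 1 + (s - 1) * (x \in A i)%:R)) => [|x _]; last first.
  by case: (x \in A i); [rewrite mulr1 addrC subrK | rewrite mulr0 addr0].
rewrite big_split /= sumr_const -mulr_sumr -natr_sum.
have -> : (\sum_x (x \in A i) = #|A i|)%N.
  by rewrite -sum1_card [RHS]big_mkcond; apply: eq_bigr => x _; case: (x \in A i).
by rewrite mulrDl divff // mulrA.
Qed.

(** Union bounds over sets of at most [m] elements run over functions on ['I_m], which gives the
    count [|Y|^m] without binomial coefficients. *)
Lemma image_ord (Y : finType) (B : {set Y}) (m : nat) : B != set0 -> (#|B| <= m)%N ->
  exists f : {ffun 'I_m -> Y}, f @: setT = B.
Proof.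
case/set0Pn => y0 y0B Bm; exists [ffun i : 'I_m => nth y0 (enum B) i].
apply/setP => y; apply/imsetP/idP => [[i _ ->]|yB].
  rewrite ffunE; have [iB|iB] := ltnP i (size (enum B)); last by rewrite nth_default.
  by rewrite -mem_enum mem_nth.
have yi : (index y (enum B) < m)%N.
  by apply: leq_trans Bm; rewrite cardE index_mem mem_enum.
by exists (Ordinal yi); rewrite // ffunE nth_index // mem_enum.
Qed.

(** With [u = 1 - y], the claim becomes [1 - exp (- l u) <= a (b - 1)], with equality at [u = 0].
    Here [a >= 1] because [y >= k]. If [k l u >= 1], then [b - 1 >= 1]. Otherwise [l >= 4 / k] gives
    [a k >= 1], so the right side is at least [l u]. The restriction [y >= k] is the reason for
    singling out abnormal colors. *)
Lemma convex_chord (k l y : R) : 0 < k <= 1 / 2 -> 4 / k <= l -> k <= y <= 1 ->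
  1 + (expR ((1 - k) * l) - 1) * expR (- (l * (1 - y))) <= expR ((1 - k) * l * y).
Proof.
case/andP=> k0 k2 kl /andP[ky y1].
have k1 : 1 <= k^-1 by rewrite invf_ge1 //; lra.
have l0 : 0 < l by apply: lt_le_trans kl; rewrite divr_gt0.
pose u := 1 - y; have u0 : 0 <= u by rewrite /u; lra.
pose a := expR (l * (1 - k - u)); pose b := expR (k * l * u).
have -> : expR ((1 - k) * l * y) = a * b.
  by rewrite /a /b -expRD; congr expR; rewrite /u; ring.
have e1 : expR ((1 - k) * l) * expR (- (l * (1 - y))) = a.
  by rewrite /a -expRD; congr expR; rewrite /u; ring.
rewrite mulrBl mul1r e1 -/u.
have hu : 1 - l * u <= expR (- (l * u)) by have := expR_ge1Dx (- (l * u)).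
have hb : 1 + k * l * u <= b by apply: expR_ge1Dx.
have lu0 : 0 <= l * u by rewrite mulr_ge0 // ltW.
have ge_a : 1 + l * (1 - k - u) <= a by apply: expR_ge1Dx.
have ku : 0 <= 1 - k - u by rewrite /u; lra.
have a1 : 1 <= a.
  by apply: le_trans ge_a; rewrite lerDl mulr_ge0 // ltW.
have e0 := expR_gt0 (- (l * u)).
suff : 1 - expR (- (l * u)) <= a * (b - 1) by lra.
have klu : k * l * u <= b - 1 by lra.
have klu0 : 0 <= k * l * u by rewrite -mulrA mulr_ge0 // ltW.
have [big|small] := leP 1 (k * l * u).
  apply: (@le_trans _ _ 1); first lra.
  apply: (@le_trans _ _ (1 * (b - 1))); first lra.
  by rewrite ler_wpM2r //; lra.
apply: (@le_trans _ _ (l * u)); first lra.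
have lk : 4 <= l * k by rewrite -ler_pdivrMr.
have ka : 1 <= a * k.
  have : k * (1 + l * (1 - k - u)) <= k * a by rewrite ler_pM2l.
  have -> : k * (1 + l * (1 - k - u)) = k + l * k * (1 - k) - k * l * u by ring.
  have : 4 * (1 - k) <= l * k * (1 - k) by rewrite ler_wpM2r //; lra.
  by rewrite [a * k]mulrC; lra.
apply: (@le_trans _ _ (a * (k * l * u))); last by rewrite ler_wpM2l //; lra.
have -> : a * (k * l * u) = (a * k) * (l * u) by ring.
by rewrite ler_peMl.
Qed.

End ProductTools.

Lemma sum_subsets_le (R : realType) (I : finType) (A : {set I}) (x : R) : 0 <= x -> #|A|%:R * x <= 1 ->
  \sum_(T : {set I} | T \subset A) x ^+ #|T| <= 1 + 3 * (#|A|%:R * x).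
Proof.
move=> x0 ax; rewrite sum_subsets.
have a0 : 0 <= #|A|%:R * x by rewrite mulr_ge0.
apply: (@le_trans _ _ (expR (#|A|%:R * x))).
  by rewrite expRM_natl lerXn2r ?nnegrE ?expR_ge0 ?addr_ge0 // expR_ge1Dx.
have /expR_le_quad h : `|#|A|%:R * x| <= 1 by rewrite ger0_norm.
apply: le_trans h _; rewrite -addrA lerD2l.
have : (#|A|%:R * x) ^+ 2 <= #|A|%:R * x by rewrite expr2 ler_piMr.
lra.
Qed.

Lemma sum_cst_subsets (R : realType) (I : finType) (A : {set I}) (q : R) :
  \sum_(T : {set I} | T \subset A) q = 2 ^+ #|A| * q.
Proof.
have := sum_subsets A (1 : R); rewrite -[1 + 1]/(2%:R) => <-.
by rewrite mulr_suml; apply: eq_bigr => T _; rewrite expr1n mul1r.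
Qed.

Lemma sum_nonempty_le (R : realType) (I : finType) (A : {set I}) (x : R) : 0 <= x -> #|A|%:R * x <= 1 ->
  \sum_(T : {set I} | (T \subset A) && (T != set0)) x ^+ #|T| <= 3 * (#|A|%:R * x).
Proof.
move=> x0 ax; have := sum_subsets_le x0 ax.
rewrite (bigD1 set0) ?sub0set //= cards0 expr0; lra.
Qed.

Lemma Pr_exists (R : realType) (I X J : finType) (X_gt0 : (0 < #|X|)%N) (P : pred J)
    (E : pred {ffun I -> X}) (F : J -> pred {ffun I -> X}) :
  (forall w, E w -> exists2 j, P j & F j w) -> Pr R E <= \sum_(j | P j) Pr R (F j).
Proof.
move=> EF; rewrite -big_enum /=; apply: Pr_bigU => // w /EF[j Pj Fj].
by exists j; rewrite // mem_enum.
Qed.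

(** * Failure of Hall's condition for random draws *)

Section Matching.
Variables (R : realType) (U : finType) (D k : nat) (C C0 : {set U}).
Variables (F : U -> {set 'I_D.+1}).
Notation color := 'I_D.+1.
Notation draws := {ffun U * 'I_k -> color}.
Notation N := (D.+1%:R : R).

Let cg := color_gt0 D.

Let N_gt0 : 0 < N. Proof. by rewrite ltr0n. Qed.

Definition usable (w : draws) (u : U) : {set color} := [set w (u, i) | i : 'I_k] :\: F u.

Definition matchable (w : draws) : bool := [exists f : {ffun U -> color},
  [forall u in C, f u \in usable w u] &&
  [forall u in C, forall v in C, (f u == f v) ==> (u == v)]].

Definition unseen (A : {set U}) (T : {set color}) (w : draws) : bool :=
  [forall u in A, forall i, w (u, i) \notin T :\: F u].

Lemma Pr_unseen (A : {set U}) (T : {set color}) : Pr R (unseen A T) = \prod_(u in A) (#|~: (T :\: F u)|%:R / N) ^+ k.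
Proof.
transitivity (Pr R (fun w : draws => [forall (c | c \in setX A setT), w c \in ~: (T :\: F c.1)])).
  apply: eq_Pr => w; apply/forall_inP/forall_inP => [h [u i]|h u uA].
    by rewrite !inE /= andbT => /h/forallP/(_ i); rewrite !inE.
  by apply/forallP => i; have := h (u, i); rewrite !inE uA /= => /(_ isT).
rewrite (Pr_forall R cg _ (fun c => ~: (T :\: F c.1))) card_ord.
rewrite (eq_bigl (fun c => (c.1 \in A) && true)); last first.
  by move=> c; rewrite !inE andbT.
rewrite -(pair_big (mem A) predT (fun u i => #|~: (T :\: F u)|%:R / N)) /=.
by apply: eq_bigr => u _; rewrite prodr_const card_ord.
Qed.

Lemma Pr_unseen_le (A : {set U}) (T : {set color}) (p : R) : (forall u, u \in A -> #|~: (T :\: F u)|%:R <= p * N) ->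
  Pr R (unseen A T) <= (p ^+ k) ^+ #|A|.
Proof.
move=> h; rewrite Pr_unseen -prodr_const; apply: ler_prod => u uA.
have q0 : 0 <= #|~: (T :\: F u)|%:R / N by rewrite divr_ge0.
have qp : #|~: (T :\: F u)|%:R / N <= p by rewrite ler_pdivrMr // h.
by rewrite exprn_ge0 //= lerXn2r // nnegrE // (le_trans q0).
Qed.

Lemma sum_setD (A : {set U}) (T : {set color}) :
  (\sum_(u in A) #|T :\: F u| = \sum_(x in T) #|[set u in A | x \notin F u]|)%N.
Proof.
rewrite -(double_count (mem A) (mem T) (fun u x => x \notin F u)).
by apply: eq_bigr => u _; apply: eq_card => x; rewrite in_setD in_set andbC.
Qed.

(** After [1 - t <= exp (- t)] the double sum over vertices and colors can be reordered, so that the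
    bound is a product over colors. *)
Lemma Pr_unseen_exp (A : {set U}) (T : {set color}) : Pr R (unseen A T) <=
  \prod_(x in T) expR (- (k%:R / N * #|[set u in A | x \notin F u]|%:R)).
Proof.
rewrite Pr_unseen.
have -> : \prod_(x in T) expR (- (k%:R / N * #|[set u in A | x \notin F u]|%:R)) =
  \prod_(u in A) expR (- (k%:R / N * #|T :\: F u|%:R)).
  rewrite -!expR_sum !sumrN -!mulr_sumr -!natr_sum sum_setD //.
apply: ler_prod => u _; rewrite exprn_ge0 ?divr_ge0 //=.
have -> : - (k%:R / N * #|T :\: F u|%:R) = k%:R * (- (#|T :\: F u|%:R / N)) by ring.
rewrite expRM_natl lerXn2r ?nnegrE ?expR_ge0 ?divr_ge0 //.
apply: le_trans (expR_ge1Dx _).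
have := cardsC (T :\: F u); rewrite card_ord => /(congr1 (fun n => n%:R : R)).
rewrite natrD => e.
have N0 : N != 0 by rewrite gt_eqF.
rewrite -[X in X - _](divff N0) -mulrBl ler_pM2r ?invr_gt0 //.
by rewrite -e addrC addKr.
Qed.

Lemma unseen_nbhd w (A : {set U}) (T : {set color}) : [disjoint nbhd (usable w) A & T] -> unseen A T w.
Proof.
move=> dT; apply/forall_inP => u uA; apply/forallP => i; apply/negP; rewrite in_setD => /andP[xF xT].
have : w (u, i) \in nbhd (usable w) A.
  by apply/bigcupP; exists u => //; rewrite in_setD xF; apply: imset_f.
by move/(disjointFr dT); rewrite xT.
Qed.

(** All draws of a violator [A] fall into a set of at most [|A|] colors or are forbidden, with
    probability at most [p] each. There are [N^|A|] ways to name the set, so each vertex of [A]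
    costs a factor [N p^k]. *)
Lemma Pr_small_violator (ts fm : nat) (p : R) :
  (forall u, u \in C -> (#|F u| <= fm)%N) -> (ts + fm)%:R <= p * N ->
  #|C|%:R * (N * p ^+ k) <= 1 ->
  Pr R (fun w : draws => [exists A : {set U}, [&& A \subset C, A != set0, (#|A| <= ts)%N &
    (#|nbhd (usable w) A| < #|A|)%N]]) <= 3 * (#|C|%:R * (N * p ^+ k)).
Proof.
move=> Fm pN small; have p0 : 0 <= p by rewrite -(pmulr_lge0 _ N_gt0) (le_trans _ pN).
have x0 : 0 <= N * p ^+ k by rewrite mulr_ge0 // exprn_ge0.
apply: le_trans (sum_nonempty_le x0 small).
apply: (@le_trans _ _ (\sum_(A : {set U} | (A \subset C) && (A != set0))
   Pr R (fun w : draws => (#|A| <= ts)%N && (#|nbhd (usable w) A| < #|A|)%N))).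
  apply: Pr_exists => // w /existsP[A /and4P[sAC A0 At An]]; exists A; first by rewrite sAC.
  by rewrite At.
apply: ler_sum => A /andP[sAC A0].
apply: (@le_trans _ _ (\sum_(f : {ffun 'I_#|A| -> color} | predT f)
   Pr R (fun w => (#|A| <= ts)%N && unseen A (~: (f @: setT)) w))).
  apply: Pr_exists => // w /andP[At An].
  (* An image of a nonempty domain is nonempty, so [ord0] is added; the strict inequality [An]
     leaves room for it. *)
  have [||f fE] := @image_ord _ (ord0 |: nbhd (usable w) A) #|A|.
  - by apply/set0Pn; exists ord0; rewrite setU11.
  - by apply: leq_trans (leq_card_setU _ _) _; rewrite cards1.
  exists f; rewrite // At /= fE; apply: unseen_nbhd.
  by rewrite -setI_eq0; apply/eqP/setP => x; rewrite !inE; case: (x \in _); rewrite ?orbT ?andbF.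
rewrite exprMn -[N ^+ _]natrX -[(D.+1 ^ _)%N]/((D.+1 ^ #|A|)%N).
have -> : (D.+1 ^ #|A|)%N = #|{ffun 'I_#|A| -> color}| by rewrite card_ffun !card_ord.
rewrite mulrC mulr_natr -sumr_const; apply: ler_sum => f _.
have [At|_] /= := leqP #|A| ts; last first.
  by rewrite /Pr (Ex_cst _ cg) !exprn_ge0.
apply: Pr_unseen_le => u uA; apply: le_trans pN.
rewrite ler_nat setCD setCK; apply: leq_trans (leq_card_setU _ _) _.
rewrite leq_add ?Fm ?(subsetP sAC) //; apply: leq_trans At.
by apply: leq_trans (leq_imset_card _ _) _; rewrite cardsT card_ord.
Qed.

(** Here [A] and the missed color set are both of linear size, and the trivial count [2^|C| 2^N]
    suffices against [k ts] failing draws. *)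
Lemma Pr_middle_violator (ts fm d : nat) (p : R) :
  (forall u, u \in C -> (#|F u| <= fm)%N) -> N - d%:R + fm%:R <= p * N -> p <= 1 -> 0 <= p ->
  Pr R (fun w : draws => [exists A : {set U}, [&& A \subset C, (ts <= #|A|)%N &
    (d <= #|~: nbhd (usable w) A|)%N]]) <= 2 ^+ #|C| * (2 ^+ D.+1 * (p ^+ k) ^+ ts).
Proof.
move=> Fm pN p1 p0.
apply: (@le_trans _ _ (\sum_(A : {set U} | A \subset C) \sum_(T : {set color} | predT T)
   Pr R (fun w : draws => [&& (ts <= #|A|)%N, (d <= #|T|)%N & unseen A T w]))).
  apply: le_trans (_ : _ <= \sum_(A : {set U} | A \subset C) Pr R (fun w : draws => 
     (ts <= #|A|)%N && (d <= #|~: nbhd (usable w) A|)%N)) _.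
    apply: Pr_exists => // w /existsP[A /and3P[sAC At An]]; exists A => //.
    by rewrite At.
  apply: ler_sum => A _; apply: Pr_exists => // w /andP[At An].
  exists (~: nbhd (usable w) A) => //; rewrite At An unseen_nbhd //.
  by rewrite -setI_eq0 setICr.
have pk : 0 <= p ^+ k <= 1 by rewrite exprn_ge0 // exprn_ile1.
have q0 : 0 <= (p ^+ k) ^+ ts by rewrite exprn_ge0 // exprn_ge0.
have -> : 2 ^+ #|C| * (2 ^+ D.+1 * (p ^+ k) ^+ ts) =
  \sum_(A : {set U} | A \subset C) \sum_(T : {set color} | predT T) (p ^+ k) ^+ ts.
  rewrite (eq_bigr (fun=> 2 ^+ D.+1 * (p ^+ k) ^+ ts)) ?sum_cst_subsets // => A _.
  have := sum_cst_subsets [set: color] ((p ^+ k) ^+ ts); rewrite cardsT card_ord => <-.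
  by apply: eq_bigl => T; rewrite subsetT.
apply: ler_sum => A sAC; apply: ler_sum => T _.
have [At|_] /= := leqP ts #|A|; last by rewrite /Pr (Ex_cst _ cg).
have [Td|_] /= := leqP d #|T|; last by rewrite /Pr (Ex_cst _ cg).
apply: (@le_trans _ _ ((p ^+ k) ^+ #|A|)); last first.
  by have /andP[? ?] := pk; rewrite ler_wiXn2l.
apply: Pr_unseen_le => u uA; apply: le_trans pN.
rewrite setCD; apply: (@le_trans _ _ (#|~: T| + #|F u|)%:R).
  by rewrite ler_nat leq_card_setU.
rewrite natrD lerD //; last by rewrite ler_nat Fm // (subsetP sAC).
have := cardsC T; rewrite card_ord => /(congr1 (fun n => n%:R : R)); rewrite natrD.
have : (d%:R : R) <= #|T|%:R by rewrite ler_nat.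
lra.
Qed.

(* [C0] are the vertices of [C] with few forbidden colors. *)
Definition normal (kap : R) (x : color) : bool :=
  #|[set u in C0 | x \in F u]|%:R <= kap * #|C0|%:R.

Definition hits (w : draws) (x : color) : {set U * 'I_k} :=
  [set c in setX [set u in C0 | x \notin F u] setT | w c \in [set x]].

Lemma card_compl_forbid (A : {set U}) (x : color) :
  (#|[set u in A | x \notin F u]| + #|[set u in A | x \in F u]| = #|A|)%N.
Proof.
rewrite addnC -(cardsID [set u | x \in F u] A); congr (_ + _)%N; apply: eq_card => u.
  by rewrite !inE.
by rewrite !inE andbC.
Qed.

Lemma Pr_few_hits (kap th : R) (h : nat) : 0 <= th ->
  Pr R (fun w => [exists x, normal kap x && (#|hits w x| < h)%N]) <=
  N * expR (th * h%:R - (1 - expR (- th)) * (k%:R * ((1 - kap) * #|C0|%:R) / N)).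
Proof.
move=> th0; set B := expR _.
apply: (@le_trans _ _ (\sum_(x | normal kap x) Pr R (fun w => (#|hits w x| < h)%N))).
  by apply: Pr_exists => // w /existsP[x /andP[nx hx]]; exists x.
apply: (@le_trans _ _ (\sum_(x | normal kap x) B)); last first.
  have -> : N * B = \sum_(x : color) B by rewrite sumr_const card_ord mulr_natl.
  rewrite [leLHS]big_mkcond; apply: ler_sum => x _.
  by case: ifP => // _; apply: expR_ge0.
apply: ler_sum => x nx; set s := expR (- th).
have s0 : 0 < s by apply: expR_gt0.
have s1 : s <= 1 by rewrite -expR0 ler_expR oppr_le0.
apply: (@le_trans _ _ (Ex (fun w => s ^+ #|hits w x| * expR (th * h%:R)))).
  apply: Pr_markov => // [w|w hx]; first by rewrite mulr_ge0 ?exprn_ge0 ?expR_ge0 // ltW.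
  rewrite /s -expRM_natl -expRD -{1}expR0 ler_expR.
  have -> : #|hits w x|%:R * - th + th * h%:R = th * (h%:R - #|hits w x|%:R) by ring.
  by rewrite mulr_ge0 // subr_ge0 ler_nat ltnW.
rewrite ExZr /hits (Ex_count cg (setX [set u in C0 | x \notin F u] setT) (fun=> [set x])).
rewrite prodr_const cards1 card_ord cardsX cardsT card_ord /B expRD mulrC.
rewrite ler_wpM2l ?expR_ge0 //.
set a := #|_|; have ca : (1 - kap) * #|C0|%:R <= a%:R :> R.
  have := card_compl_forbid C0 x => /(congr1 (fun n => n%:R : R)); rewrite natrD -/a.
  by move: nx; rewrite /normal; lra.
apply: (@le_trans _ _ (expR ((s - 1) / N) ^+ (a * k))).
  rewrite lerXn2r ?nnegrE ?expR_ge0 //; last first.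
    by rewrite mul1r; apply: expR_ge1Dx.
  rewrite mul1r; have : N^-1 <= 1 by rewrite invf_le1 // ler1n.
  have v0 : 0 <= N^-1 by rewrite invr_ge0.
  have -> : 1 + (s - 1) / N = (1 - N^-1) + s * N^-1 by ring.
  by move=> v1; rewrite addr_ge0 ?subr_ge0 // mulr_ge0 // ltW.
rewrite -expRM_natl ler_expR natrM -subr_ge0.
have -> : - ((1 - s) * (k%:R * ((1 - kap) * #|C0|%:R) / N)) - a%:R * k%:R * ((s - 1) / N) =
   (1 - s) * k%:R / N * (a%:R - (1 - kap) * #|C0|%:R) by ring.
by rewrite mulr_ge0 ?subr_ge0 // mulr_ge0 ?invr_ge0 // mulr_ge0 // subr_ge0.
Qed.

(** Chernoff's bound with base [1 / tau]: as [T] has density at most [tau], each draw contributes a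
    factor at most [e] to the exponential moment, while [h |T|] hits gain [tau^(h |T|)]. Naming [B]
    costs [|U|^(K |T|)]. *)
Lemma Pr_expansion (K h tt : nat) (tau : R) : (0 < h)%N -> 0 < tau <= 1 -> tt%:R <= tau * N ->
  N * (#|U|%:R ^+ K * (tau ^+ h * expR (K * k)%:R)) <= 1 ->
  Pr R (fun w : draws => [exists B : {set U}, exists T : {set color},
    [&& (0 < #|T| <= tt)%N, (#|B| <= K * #|T|)%N &
        (h * #|T| <= #|[set c in setX B setT | w c \in T]|)%N]]) <=
  3 * (N * (#|U|%:R ^+ K * (tau ^+ h * expR (K * k)%:R))).
Proof.
move=> h0 /andP[tau0 tau1] ttN; set x := #|U|%:R ^+ K * _ => xN.
have x0 : 0 <= x by rewrite mulr_ge0 ?exprn_ge0 // mulr_ge0 ?expR_ge0 ?exprn_ge0 // ltW.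
have NE : N = #|[set: color]|%:R by rewrite cardsT card_ord.
rewrite NE; rewrite NE in xN; apply: le_trans (sum_nonempty_le x0 xN).
apply: (@le_trans _ _ (\sum_(T : {set color} | (T \subset [set: color]) && (T != set0))
  Pr R (fun w : draws => (#|T| <= tt)%N && [exists B : {set U}, (#|B| <= K * #|T|)%N &&
        (h * #|T| <= #|[set c in setX B setT | w c \in T]|)%N]))).
  apply: Pr_exists => // w /existsP[B /existsP[T /and3P[/andP[T0 Tt] BT hB]]].
  exists T; first by rewrite subsetT -card_gt0.
  by rewrite Tt; apply/existsP; exists B; rewrite BT.
apply: ler_sum => T /andP[_ T0].
have [Tt|_] /= := leqP #|T| tt; last by rewrite /Pr (Ex_cst _ cg) exprn_ge0.
apply: (@le_trans _ _ (\sum_(f : {ffun 'I_(K * #|T|) -> U} | predT f)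
  Pr R (fun w : draws => (h * #|T| <= #|[set c in setX (f @: setT) setT | w c \in T]|)%N))).
  apply: Pr_exists => // w /existsP[B /andP[BT hB]].
  have B0 : B != set0.
    apply/eqP => B0; move: hB; rewrite B0.
    have -> : [set c in setX set0 [set: 'I_k] | w c \in T] = set0.
      by apply/setP => c; rewrite !inE.
    by rewrite cards0 leqn0 muln_eq0 cards_eq0 (negbTE T0) orbF; lia.
  by have [f fE] := image_ord B0 BT; exists f; rewrite ?fE.
set q := tau ^+ h * _ in x x0 xN *.
have q0 : 0 <= q by rewrite mulr_ge0 ?expR_ge0 // exprn_ge0 // ltW.
have -> : x ^+ #|T| = \sum_(f : {ffun 'I_(K * #|T|) -> U} | predT f) q ^+ #|T|.
  rewrite sumr_const (eq_card (B := {: {ffun 'I_(K * #|T|) -> U}})) //.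
  by rewrite card_ffun card_ord -mulr_natl natrX exprM -exprMn.
apply: ler_sum => f _; set B := f @: setT.
have s0 : 0 < tau^-1 by rewrite invr_gt0.
apply: (@le_trans _ _ (Ex (fun w : draws =>
   tau^-1 ^+ #|[set c in setX B setT | w c \in T]| * tau ^+ (h * #|T|)))).
  apply: Pr_markov => // [w|w hB]; first by rewrite mulr_ge0 ?exprn_ge0 // ltW.
  rewrite -(subnK hB) exprD -mulrA -exprMn mulVf ?gt_eqF // expr1n mulr1.
  by rewrite exprn_ege1 // invf_ge1.
rewrite ExZr (Ex_count cg (setX B setT) (fun=> T)).
rewrite prodr_const card_ord cardsX cardsT card_ord [leRHS]exprMn -exprM mulrC.
rewrite ler_wpM2l ?exprn_ge0 ?(ltW tau0) //.
apply: (@le_trans _ _ (expR 1 ^+ (#|B| * k) )).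
  have T1 : (tau^-1 - 1) * (#|T|%:R / N) <= 1.
    apply: (@le_trans _ _ (tau^-1 * (#|T|%:R / N))).
      by rewrite ler_wpM2r ?divr_ge0 // gerBl.
    rewrite mulrA ler_pdivrMr // mul1r mulrC ler_pdivrMr // mulrC.
    by apply: le_trans ttN; rewrite ler_nat.
  have T2 : 0 <= (tau^-1 - 1) * (#|T|%:R / N).
    by rewrite mulr_ge0 ?divr_ge0 // subr_ge0 invf_ge1.
  rewrite lerXn2r ?nnegrE ?expR_ge0 ?addr_ge0 //.
  by apply: le_trans (expR_ge1Dx _); rewrite lerD2l.
rewrite -!expRM_natl ler_expR mulr1 -natrM ler_nat.
apply: (@leq_trans (K * #|T| * k)%N); last by lia.
rewrite leq_mul2r; apply/orP; right.
by apply: leq_trans (leq_imset_card _ _) _; rewrite cardsT card_ord.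
Qed.

Definition abnormal_unseen (kap : R) (w : draws) (A : {set U}) : {set color} :=
  [set x | ~~ normal kap x && unseen A [set x] w].

Lemma unseen_set (w : draws) (A : {set U}) (T : {set color}) :
  unseen A T w = [forall x in T, unseen A [set x] w].
Proof.
apply/forall_inP/forall_inP => [h x xT|h u uA].
  apply/forall_inP => u uA; apply/forallP => i; have /forallP/(_ i) := h u uA.
  by apply: contra; rewrite !inE => /andP[-> /eqP ->].
apply/forallP => i; apply/negP; rewrite in_setD => /andP[nF xT].
have /forall_inP/(_ u uA)/forallP/(_ i) := h _ xT.
by rewrite in_setD nF in_set1 eqxx.
Qed.

(* Unseen abnormal colors: the generating function of their number at
   [expR ((1 - kap) l)] is at most that of the average number [g] of colors
   forbidden at a vertex, since each factor is bounded by a chord. *)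
Lemma Ex_abnormal_unseen (kap kap' g : R) (A : {set U}) :
  A \subset C0 -> (0 < #|A|)%N -> 0 < kap' <= 1 / 2 ->
  4 / kap' <= k%:R * #|A|%:R / N ->
  kap' * #|A|%:R <= kap * #|C0|%:R - #|C0 :\: A|%:R ->
  (forall u, u \in A -> #|F u|%:R <= g) ->
  Ex (fun w => expR ((1 - kap') * (k%:R * #|A|%:R / N)) ^+ #|abnormal_unseen kap w A|)
  <= expR ((1 - kap') * (k%:R * #|A|%:R / N) * g).
Proof.
move=> sA A0 kap01 kl kA Fg; set l := k%:R * _ / N; set z := expR _.
have /andP[kap0 kap2] := kap01.
have l0 : 0 < l by apply: lt_le_trans kl; rewrite divr_gt0.
have Ar : (0 : R) < #|A|%:R by rewrite ltr0n.
pose Abn := [set x | ~~ normal kap x].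
pose y (x : color) : R := #|[set u in A | x \in F u]|%:R / #|A|%:R.
have z1 : 0 <= z - 1 by rewrite subr_ge0 -expR0 ler_expR mulr_ge0 ?ltW // subr_gt0; lra.
have yx x : x \in Abn -> kap' <= y x <= 1.
  rewrite inE /normal -ltNge => nx; rewrite /y ler_pdivlMr // ler_pdivrMr // mul1r ler_nat.
  apply/andP; split; last by apply: subset_leq_card; apply/subsetP => u; rewrite inE => /andP[].
  apply: le_trans kA _; rewrite lerBlDr; apply: le_trans (ltW nx) _.
  rewrite -natrD ler_nat -(cardsID A) leq_add // subset_leq_card //.
    by apply/subsetP => u; rewrite !inE => /andP[/andP[_ ->] ->].
  by apply/subsetP => u; rewrite !inE => /andP[-> /andP[-> _]].
have unseen_le T : Pr R (unseen A T) <= \prod_(x in T) expR (- (l * (1 - y x))).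
  apply: le_trans (Pr_unseen_exp _ _) _; apply: eq_leW.
  apply: eq_bigr => x _; congr (expR (- _)).
  have := card_compl_forbid A x => /(congr1 (fun n => n%:R : R)); rewrite natrD => e.
  have -> : #|[set u in A | x \notin F u]|%:R = #|A|%:R - #|[set u in A | x \in F u]|%:R :> R.
    by rewrite -e addrK.
  rewrite /l /y; move: (negbT (gt_eqF Ar)) (negbT (gt_eqF N_gt0)).
  by move: (#|A|%:R) N => a n a0 n0; field; rewrite a0.
apply: (@le_trans _ _ (\sum_(T : {set color} | T \subset Abn) (z - 1) ^+ #|T| * Pr R (unseen A T))).
  rewrite (eq_Ex (g := fun w => \sum_(T : {set color} | T \subset Abn) (z - 1) ^+ #|T| * (unseen A T w)%:R)).
    by rewrite Ex_sum; apply: ler_sum => T _; rewrite ExZ.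
  (* The power [z^n] is the sum of [(z - 1)^|T|] over the subsets [T] of an [n]-set, which turns the
     moment into probabilities of [unseen A T]. *)
  move=> w; rewrite -[z in LHS](subrK 1) [_ - 1 + 1]addrC -sum_subsets.
  rewrite big_mkcond [RHS]big_mkcond /=; apply: eq_bigr => T _.
  have -> : (T \subset abnormal_unseen kap w A) = (T \subset Abn) && unseen A T w.
    rewrite unseen_set; apply/subsetP/andP => [h|[/subsetP TA /forall_inP Tu] x xT].
      split; first by apply/subsetP => x /h; rewrite !inE => /andP[].
      by apply/forall_inP => x /h; rewrite inE => /andP[].
    by rewrite inE Tu // andbT; have := TA _ xT; rewrite inE.
  by case: (_ \subset _) => //=; case: (unseen _ _ _); rewrite ?mulr1 ?mulr0.
apply: (@le_trans _ _ (\sum_(T : {set color} | T \subset Abn)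
    \prod_(x in T) ((z - 1) * expR (- (l * (1 - y x)))))).
  apply: ler_sum => T _; rewrite big_split /= prodr_const.
  by rewrite ler_wpM2l ?exprn_ge0.
rewrite sum_subsets_prod.
apply: (@le_trans _ _ (\prod_(x in Abn) expR ((1 - kap') * l * y x))).
  apply: ler_prod => x xA; rewrite addr_ge0 // ?mulr_ge0 ?expR_ge0 //=.
  exact: convex_chord (yx _ xA).
rewrite -expR_sum ler_expR -mulr_sumr ler_wpM2l //.
  by rewrite mulr_ge0 ?ltW // subr_gt0; lra.
apply: (@le_trans _ _ (\sum_x y x)).
  rewrite big_mkcond; apply: ler_sum => x _; case: ifP => // _.
  by rewrite divr_ge0.
rewrite -mulr_suml ler_pdivrMr // -natr_sum.
rewrite -(double_count (mem A) xpredT (fun u x => x \in F u)).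
rewrite (eq_bigr (fun u => #|F u|)%N) => [|u _]; last by apply: eq_card => x; rewrite inE.
rewrite natr_sum mulrC mulr_natl -sumr_const; apply: ler_sum => u uA; exact: Fg.
Qed.

(** A vertex of [C0] has at most [g = N - |C|] forbidden colors, so the exponential moment is no
    larger than if exactly [g] abnormal colors were unseen. Exceeding [g] by [1 + |B| (1 - 1/K)]
    costs [exp (- lz)] raised to that power. The part depending on [B] is summable over all [B], and
    the 1 yields the coupon collector's bound [exp (- lz)]. *)
Lemma Pr_abnormal (K b : nat) (kap lz : R) : (0 < K)%N ->
  (#|C| <= D.+1)%N -> C0 \subset C -> (forall u, u \in C0 -> (#|F u| + #|C| <= D.+1)%N) ->
  0 < kap <= 1 -> b%:R <= kap / 2 * #|C0|%:R ->
  lz = (1 - kap / 2) * (k%:R * (#|C0|%:R - b%:R) / N) ->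
  8 / kap <= k%:R * (#|C0|%:R - b%:R) / N ->
  #|C|%:R * expR (- (lz * (1 - K%:R^-1))) <= 1 ->
  Pr R (fun w => [exists B : {set U}, [&& B \subset C, (#|B| <= b)%N &
     (K * (D.+1 - #|C|).+1 + K.-1 * #|B| <= K * #|abnormal_unseen kap w (C0 :\: B)|)%N]])
  <= 4 * expR (- lz).
Proof.
move=> K0 cN C0C Fg /andP[kap0 kap1] bk lzE lk x1.
have lz0 : 0 < lz.
  rewrite lzE mulr_gt0 //; first by lra.
  by apply: lt_le_trans lk; rewrite divr_gt0.
have Kr : (0 : R) < K%:R by rewrite ltr0n.
set x := expR (- (lz * (1 - K%:R^-1))) in x1.
apply: (@le_trans _ _ (\sum_(B : {set U} | B \subset C) expR (- lz) * x ^+ #|B|)); last first.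
  rewrite -mulr_sumr [leRHS]mulrC ler_wpM2l ?expR_ge0 //.
  apply: le_trans (sum_subsets_le (expR_ge0 _) x1) _.
  by move: x1; set t := _ * x => t1; lra.
apply: (@le_trans _ _ (\sum_(B : {set U} | B \subset C) Pr R (fun w => (#|B| <= b)%N &&
     (K * (D.+1 - #|C|).+1 + K.-1 * #|B| <= K * #|abnormal_unseen kap w (C0 :\: B)|)%N))).
  apply: Pr_exists => // w /existsP[B /and3P[BC Bb h]]; exists B => //.
  by rewrite Bb.
apply: ler_sum => B BC; set A := C0 :\: B.
have [Bb|_] /= := leqP #|B| b; last first.
  by rewrite /Pr (Ex_cst _ cg) mulr_ge0 ?expR_ge0 // exprn_ge0 // expR_ge0.
have cAB : #|C0 :\: A|%:R <= #|B|%:R :> R.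
  rewrite ler_nat subset_leq_card //; apply/subsetP => u; rewrite !inE.
  by case: (u \in B); case: (u \in C0).
have cA : #|C0|%:R - #|B|%:R <= #|A|%:R :> R.
  rewrite lerBlDr -natrD ler_nat /A cardsD addnC -leq_subLR leq_sub2l //.
  exact/subset_leq_card/subsetIr.
have Br : #|B|%:R <= b%:R :> R by rewrite ler_nat.
have AC : #|A|%:R <= #|C0|%:R :> R by rewrite ler_nat subset_leq_card // subsetDl.
have cb0 : 0 < #|C0|%:R - b%:R :> R.
  have : 0 < k%:R * (#|C0|%:R - b%:R) / N by apply: lt_le_trans lk; rewrite divr_gt0.
  rewrite pmulr_lgt0 ?invr_gt0 // => h; have [//|h'] := ltP 0 (#|C0|%:R - b%:R :> R).
  by move: h; rewrite ltNge mulr_ge0_le0.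
set l := k%:R * #|A|%:R / N.
have ll : k%:R * (#|C0|%:R - b%:R) / N <= l.
  by rewrite ler_pM2r ?invr_gt0 // ler_wpM2l //; lra.
pose g : R := D.+1%:R - #|C|%:R.
have Ex_le : Ex (fun w => expR ((1 - kap / 2) * l) ^+ #|abnormal_unseen kap w A|)
  <= expR ((1 - kap / 2) * l * g).
  apply: Ex_abnormal_unseen.
  - exact: subsetDl.
  - rewrite -(ltr_nat R); lra.
  - by apply/andP; split; lra.
  - have -> : 4 / (kap / 2) = 8 / kap :> R by field; rewrite gt_eqF.
    exact: le_trans lk ll.
  - have : kap / 2 * #|A|%:R <= kap / 2 * #|C0|%:R by rewrite ler_wpM2l //; lra.
    lra.
  - move=> u /setDP[uC _]; have := Fg u uC; rewrite -(ler_nat R) natrD /g; lra.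
set z := (1 - kap / 2) * l in Ex_le *.
have lzz : lz <= z by rewrite lzE /z ler_wpM2l //; lra.
pose b' : R := #|B|%:R * (1 - K%:R^-1).
have b'0 : 0 <= b'.
  by rewrite mulr_ge0 // subr_ge0 invf_le1 // ler1n.
apply: (@le_trans _ _ (Ex (fun w => expR z ^+ #|abnormal_unseen kap w A| * expR (- (z * (g + 1 + b')))))).
  apply: Pr_markov => // [w|w h]; first by rewrite mulr_ge0 ?expR_ge0 // exprn_ge0 // expR_ge0.
  rewrite -expRM_natl -expRD -[leLHS]expR0 ler_expR.
  have -> : #|abnormal_unseen kap w A|%:R * z - z * (g + 1 + b') =
     z * (#|abnormal_unseen kap w A|%:R - (g + 1 + b')) by ring.
  rewrite mulr_ge0 //; first by apply: le_trans lzz; apply: ltW.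
  rewrite subr_ge0 -(ler_pM2l Kr) /b'; move: h; rewrite -(ler_nat R) natrD !natrM.
  have -> : K.-1%:R = K%:R - 1 :> R by rewrite -[in RHS](prednK K0) -natr1 addrK.
  rewrite -natr1 natrB // -/g => h.
  have -> : K%:R * (g + 1 + #|B|%:R * (1 - K%:R^-1)) = K%:R * (g + 1) + (K%:R - 1) * #|B|%:R :> R.
    by field; rewrite gt_eqF.
  exact: h.
rewrite ExZr; apply: (@le_trans _ _ (expR (z * g) * expR (- (z * (g + 1 + b'))))).
  by rewrite ler_wpM2r ?expR_ge0.
rewrite /x -expRM_natl -!expRD ler_expR.
have -> : z * g - z * (g + 1 + b') = - (z * (1 + b')) by ring.
have -> : - lz + #|B|%:R * - (lz * (1 - K%:R^-1)) = - (lz * (1 + b')) by rewrite /b'; ring.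
by rewrite lerN2 ler_wpM2r // addr_ge0.
Qed.

(* A Hall violator [A] leaves [T] unseen with [#|T| > N - #|A|].  When [C :\: A] is
   small, the normal colors of [T] are hit only from [C :\: A], so by expansion they
   are few, and [T] contains too many unseen abnormal colors. *)
Lemma violator_cases (K h tt b : nat) (kap : R) (w : draws) (A : {set U}) :
  (#|C| <= D.+1)%N -> C0 \subset C -> (0 < K)%N -> (b <= K * tt)%N -> A \subset C ->
  (#|nbhd (usable w) A| < #|A|)%N -> (#|~: nbhd (usable w) A| < b)%N ->
  (forall x, normal kap x -> (h <= #|hits w x|)%N) ->
  (forall (B : {set U}) (T : {set color}), (0 < #|T| <= tt)%N -> (#|B| <= K * #|T|)%N ->
     (#|[set c in setX B setT | w c \in T]| < h * #|T|)%N) ->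
  exists B : {set U}, [&& B \subset C, (#|B| <= b)%N &
     (K * (D.+1 - #|C|).+1 + K.-1 * #|B| <= K * #|abnormal_unseen kap w (C0 :\: B)|)%N].
Proof.
move=> C_le C0_C K_gt0 b_tt sAC An Tb manyhits expand; pose T := ~: nbhd (usable w) A; pose B := C :\: A.
have cA : (#|A| + #|B| = #|C|)%N by rewrite /B -(cardsID A C) (setIidPr sAC).
have cT : (#|T| + #|nbhd (usable w) A| = D.+1)%N by rewrite addnC cardsC card_ord.
have Bb : (#|B| <= b)%N by move: Tb cA cT An C_le; rewrite -/T -/B; clear; lia.
pose Tn := [set x in T | normal kap x].
have hitsB (T' : {set color}) : T' \subset Tn ->
  (h * #|T'| <= #|[set c in setX B [set: 'I_k] | w c \in T']|)%N.
  move=> /subsetP T'T; apply: (@leq_trans (\sum_(x in T') #|hits w x|)%N).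
    rewrite mulnC -sum_nat_const; apply: leq_sum => x /T'T.
    by rewrite inE => /andP[_]; apply: manyhits.
  rewrite -[leqRHS]sum1_card (partition_big (fun c => w c) (mem T')) /=; last first.
    by move=> c; rewrite !inE => /andP[].
  apply: leq_sum => x xT; rewrite -sum1_card.
  rewrite [leqLHS]big_mkcond [leqRHS]big_mkcond; apply: leq_sum => -[u i] _.
  case: ifP => //; rewrite !inE /= andbT => /andP[/andP[uC0 xF] /eqP wx].
  rewrite wx xT eqxx !andbT (subsetP C0_C) // andbT.
  suff -> : u \notin A by [].
  apply/negP => uA; have := T'T _ xT; rewrite in_set in_setC => /andP[/negP xn _]; case: xn.
  by apply/bigcupP; exists u => //; rewrite in_setD xF -wx; apply: imset_f.
(* All hits on normal colors of [T] come from [B], so otherwise expansion is contradicted. If there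
   are more than [tt] such colors, any [tt] of them suffice, because [b <= K * tt]. *)
have KTn : (K * #|Tn| <= #|B|)%N.
  rewrite leqNgt; apply/negP => BT.
  have [Tt|Tt] := leqP #|Tn| tt.
    have Tn0 : (0 < #|Tn|)%N by move: BT; case: #|Tn|; rewrite ?muln0.
    have := expand B Tn; rewrite Tn0 Tt (ltnW BT) => /(_ isT isT).
    by rewrite ltnNge hitsB.
  have [tt_0|tt0] := posnP tt; first by move: Tb b_tt; rewrite tt_0 muln0 leqn0 => h1 /eqP h2; rewrite h2 in h1.
  have [T' T'Tn cT'] : exists2 T' : {set color}, T' \subset Tn & #|T'| = tt.
    exact: (subset_leq_card_ex (ltnW Tt)).
  have := expand B T'; rewrite cT' tt0 leqnn (leq_trans Bb b_tt) => /(_ isT isT).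
  by rewrite -cT' ltnNge hitsB.
exists B; rewrite subsetDl Bb /=.
have sub : T :\: Tn \subset abnormal_unseen kap w (C0 :\: B).
  apply/subsetP => x; rewrite in_setD [x \in Tn]in_set => /andP[nx xT].
  rewrite inE; move: nx; rewrite xT /= => -> /=.
  have : unseen A [set x] w.
    apply: unseen_nbhd; rewrite disjoint_sym disjoints1.
    by move: xT; rewrite inE.
  move=> /forall_inP uA; apply/forall_inP => u; rewrite !inE negb_and negbK => /andP[/orP[//|uC] uC0].
    by move=> _; apply: uA.
  by rewrite (subsetP C0_C) in uC.
have sTn : Tn \subset T by apply/subsetP => x; rewrite inE => /andP[].
have := subset_leq_card sub; have := subset_leq_card sTn.
rewrite cardsD (setIidPr sTn) => t1 t2.
have -> : K.-1 = (K - 1)%N by rewrite subn1.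
have t3 : ((D.+1 - #|C|).+1 + #|B| <= #|T|)%N by move: cA cT An C_le; clear; lia.
apply: (@leq_trans (K * (#|T| - #|Tn|))%N); last by rewrite leq_mul2l t2 orbT.
move: t1 t3 KTn K_gt0; clear.
move: (D.+1 - #|C|).+1 #|T| #|Tn| #|B| => g t tn bn t1 t3 KTn K_gt0.
have : (K * (g + bn) <= K * t)%N by rewrite leq_mul2l t3 orbT.
rewrite mulnBr mulnBl mulnDr mul1n; have : (bn <= K * bn)%N by rewrite leq_pmull.
lia.
Qed.

Variables (K h tt b ts fm : nat) (kap th tau p q lz : R).
Hypothesis C_le : (#|C| <= D.+1)%N.
Hypothesis C0_C : C0 \subset C.
Hypothesis F_C0 : forall u, u \in C0 -> (#|F u| + #|C| <= D.+1)%N.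
Hypothesis F_C : forall u, u \in C -> (#|F u| <= fm)%N.
Hypothesis K_gt0 : (0 < K)%N.
Hypothesis h_gt0 : (0 < h)%N.
Hypothesis kap_bounds : 0 < kap <= 1.
Hypothesis th_ge0 : 0 <= th.
Hypothesis tau_bounds : 0 < tau <= 1.
Hypothesis tt_le : tt%:R <= tau * N.
Hypothesis b_tt : (b <= K * tt)%N.
Hypothesis b_kap : b%:R <= kap / 2 * #|C0|%:R.
Hypothesis p_ge : (ts + fm)%:R <= p * N.
Hypothesis p_small : #|C|%:R * (N * p ^+ k) <= 1.
Hypothesis q_ge : N - b%:R + fm%:R <= q * N.
Hypothesis q_bounds : 0 <= q <= 1.
Hypothesis expand_small : N * (#|U|%:R ^+ K * (tau ^+ h * expR (K * k)%:R)) <= 1.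
Hypothesis lzE : lz = (1 - kap / 2) * (k%:R * (#|C0|%:R - b%:R) / N).
Hypothesis lz_large : 8 / kap <= k%:R * (#|C0|%:R - b%:R) / N.
Hypothesis lz_small : #|C|%:R * expR (- (lz * (1 - K%:R^-1))) <= 1.

(** In this order: a violator of at most [ts] vertices, a larger set missing [b] colors, a normal
    color with fewer than [h] hits, a failure of expansion, too many unseen abnormal colors. *)
Definition matching_bound : R :=
  3 * (#|C|%:R * (N * p ^+ k)) + 2 ^+ #|C| * (2 ^+ D.+1 * (q ^+ k) ^+ ts) +
  N * expR (th * h%:R - (1 - expR (- th)) * (k%:R * ((1 - kap) * #|C0|%:R) / N)) +
  3 * (N * (#|U|%:R ^+ K * (tau ^+ h * expR (K * k)%:R))) + 4 * expR (- lz).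

Theorem Pr_unmatchable : Pr R (fun w => ~~ matchable w) <= matching_bound.
Proof.
pose E1 (w : draws) := [exists A : {set U}, [&& A \subset C, A != set0, (#|A| <= ts)%N &
    (#|nbhd (usable w) A| < #|A|)%N]].
pose E2 (w : draws) := [exists A : {set U}, [&& A \subset C, (ts <= #|A|)%N &
    (b <= #|~: nbhd (usable w) A|)%N]].
pose E3 (w : draws) := [exists x, normal kap x && (#|hits w x| < h)%N].
pose E4 (w : draws) := [exists B : {set U}, exists T : {set color},
    [&& (0 < #|T| <= tt)%N, (#|B| <= K * #|T|)%N &
        (h * #|T| <= #|[set c in setX B setT | w c \in T]|)%N]].
pose E5 (w : draws) := [exists B : {set U}, [&& B \subset C, (#|B| <= b)%N &
     (K * (D.+1 - #|C|).+1 + K.-1 * #|B| <= K * #|abnormal_unseen kap w (C0 :\: B)|)%N]].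
apply: (@le_trans _ _ (Pr R (fun w => [|| (((E1 w || E2 w) || E3 w) || E4 w) | E5 w]))); last first.
  have /andP[q0 q1] := q_bounds.
  apply: le_trans (PrU R cg _ _) _; apply: lerD; last exact: Pr_abnormal.
  apply: le_trans (PrU R cg _ _) _; apply: lerD; last exact: Pr_expansion.
  apply: le_trans (PrU R cg _ _) _; apply: lerD; last exact: Pr_few_hits.
  apply: le_trans (PrU R cg _ _) _; apply: lerD; last exact: Pr_middle_violator F_C q_ge q1 q0.
  exact: Pr_small_violator F_C p_ge p_small.
apply: (le_Pr R cg) => w; apply: contraR; rewrite !negb_or.
case/andP=> /andP[/andP[/andP[n1 n2] n3] n4] n5.
have [f [fA fI]] : exists f : U -> color,
    (forall u, u \in C -> f u \in usable w u) /\ {in C &, injective f}.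
  apply: (hall ord0) => A sAC; rewrite leqNgt; apply/negP => An.
  have ats : (ts < #|A|)%N.
    rewrite ltnNge; apply/negP => At; move/negP: n1; apply; apply/existsP; exists A.
    by rewrite sAC At An -card_gt0 (leq_ltn_trans _ An).
  have Tb : (#|~: nbhd (usable w) A| < b)%N.
    rewrite ltnNge; apply/negP => At; move/negP: n2; apply; apply/existsP; exists A.
    by rewrite sAC (ltnW ats) At.
  have [||B BP] := violator_cases (kap := kap) (h := h) C_le C0_C K_gt0 b_tt sAC An Tb.
  - move=> x nx; rewrite leqNgt; apply/negP => hx; move/negP: n3; apply.
    by apply/existsP; exists x; rewrite nx.
  - move=> B T hT hB; rewrite ltnNge; apply/negP => hx; move/negP: n4; apply.
    by apply/existsP; exists B; apply/existsP; exists T; rewrite hT hB.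
  by move/negP: n5; apply; apply/existsP; exists B.
apply/existsP; exists [ffun u => f u]; apply/andP; split.
  by apply/forall_inP => u uC; rewrite ffunE fA.
apply/forall_inP => u uC; apply/forall_inP => v vC; rewrite !ffunE.
by apply/implyP => /eqP /fI ->.
Qed.

End Matching.

(** * Nonadjacent pairs sharing a color *)

Section Pairs.
Variables (R : realType) (U : finType) (D a : nat) (adj : rel U) (C : {set U}).
Variables (F : U -> {set 'I_D.+1}).
Notation color := 'I_D.+1.
Notation xdraws := {ffun U * 'I_a -> color}.
Notation draws := {ffun U * (bool * 'I_a) -> color}.
Notation N := (D.+1%:R : R).
Hypothesis adj_sym : symmetric adj.

Let cg := color_gt0 D.
Let N_gt0 : 0 < N. Proof. by rewrite ltr0n. Qed.

Definition nonnbr (u : U) : {set U} := [set v in C | (v != u) && ~~ adj u v].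

Lemma nonnbr_sym u v : u \in C -> v \in nonnbr u -> u \in nonnbr v.
Proof. by move=> uC; rewrite !inE uC eq_sym adj_sym => /and3P[_ -> ->]. Qed.

Variables (fm hm m r yt : nat) (lam : R).
Hypothesis F_le : forall u, u \in C -> (#|F u| <= fm)%N.
Hypothesis nonnbr_le : forall u, u \in C -> (#|nonnbr u| <= hm)%N.
Hypothesis C_le : (#|C| <= D.+1)%N.
Hypothesis m_gt0 : (0 < m)%N.
Hypothesis m_hm : (m <= hm)%N.
Hypothesis r_m : (2 * r <= m.+1)%N.
Hypothesis ra_le : (8 * (r * a) <= D.+1)%N.
Hypothesis fm_le : (4 * (m + 2 * fm) <= D.+1)%N.
Hypothesis a_ge : N <= (8 * hm * a)%:R.
Hypothesis many : (yt + 6 * hm <= #|[set u in C | (m <= #|nonnbr u|)%N]|)%N.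

Section Fixed.
Variables (U0 : {set U}) (G0 : {set color}).
Hypothesis U0_C : U0 \subset C.
Hypothesis U0_le : (#|U0| <= 2 * m)%N.
Hypothesis G0_le : (#|G0| <= m)%N.

Definition rich : {set U} := [set y in C :\: U0 | (r <= #|nonnbr y :\: U0|)%N].

(** A vertex with [m] non-neighbors that is not rich has at least [(m + 1) / 2] of them in [U0].
    Counting these from [U0] gives at most [4 hm] such vertices, and [U0] itself removes at most
    [2 hm]. *)
Lemma card_rich : (yt <= #|rich|)%N.
Proof.
pose Y := [set u in C | (m <= #|nonnbr u|)%N]; pose bad := (Y :\: U0) :\: rich.
have badU : (\sum_(y in bad) m.+1 <= \sum_(y in bad) 2 * #|nonnbr y :&: U0|)%N.
  apply: leq_sum => y; rewrite in_setD [y \in Y :\: U0]in_setD => /andP[nr /andP[yU yY]].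
  move: nr yY; rewrite [y \in rich]in_set [y \in _ :\: _]in_setD yU [y \in Y]in_set.
  move=> nr /andP[yC my]; move: nr; rewrite yC /= -ltnNge => nr.
  have := cardsID U0 (nonnbr y); move: nr my r_m; clear; lia.
have cnt : (\sum_(y in bad) #|nonnbr y :&: U0| <= #|U0| * hm)%N.
  have -> : (\sum_(y in bad) #|nonnbr y :&: U0| = \sum_(y in bad) #|[set x in U0 | x \in nonnbr y]|)%N.
    by apply: eq_bigr => y _; apply: eq_card => x; rewrite in_setI in_set andbC.
  rewrite (double_count (mem bad) (mem U0) (fun y x => x \in nonnbr y)) -sum_nat_const.
  apply: leq_sum => x xU; have xC := subsetP U0_C _ xU; apply: leq_trans (nonnbr_le xC).
  apply/subset_leq_card/subsetP => y; rewrite in_set => /andP[yb].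
  by apply: nonnbr_sym; case/setDP: yb => /setDP[]; rewrite in_set => /andP[].
move: badU; rewrite sum_nat_const -big_distrr /= => badU.
have b4 : (#|bad| <= 4 * hm)%N.
  have e : (#|bad| * m.+1 <= 2 * (2 * m * hm))%N.
    apply: leq_trans badU _; rewrite leq_mul2l /=; apply: leq_trans cnt _.
    by rewrite leq_mul2r U0_le orbT.
  rewrite -(leq_pmul2r (ltn0Sn m)); apply: leq_trans e _.
  by rewrite mulnA mulnA mulnAC leq_mul2l leqnSn orbT.
have := cardsID U0 Y; have := subset_leq_card (subsetIr Y U0).
have := cardsID rich (Y :\: U0); have := subset_leq_card (subsetIr (Y :\: U0) rich).
rewrite -/bad; move: many b4 U0_le m_hm; rewrite -/Y.
move: #|_ :&: rich| #|_ :&: U0| #|_ :\: U0| #|bad| #|rich| #|U0| #|Y|; clear; lia.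
Qed.

(** Truncation to [r] non-neighbors keeps their [r a] draws below [N / 8], so that these draws
    rarely coincide. *)
Definition sample (y : U) : {set U} :=
  [set x in take r (enum (nonnbr y :\: U0))].

Lemma sample_sub y : sample y \subset nonnbr y :\: U0.
Proof. by apply/subsetP => x; rewrite inE => /mem_take; rewrite mem_enum. Qed.

Lemma card_sample y : y \in rich -> #|sample y| = r.
Proof.
rewrite inE => /andP[_ ry].
by rewrite cardsE (card_uniqP _) ?take_uniq ?enum_uniq // size_takel // -cardE.
Qed.

Definition shareable (w : xdraws) (y : U) : {set color} :=
  [set x in ~: (G0 :|: F y) | ~~ unseen F (sample y) [set x] w].

Definition total (w : xdraws) : R := \sum_(y in rich) #|shareable w y|%:R.

Lemma Pr_unseen_sum (k : nat) (G : U -> {set color}) (A : {set U}) (T : {set color}) :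
  Pr R (fun w : {ffun U * 'I_k -> color} => unseen G A T w) <=
  expR (- (k%:R / N * (\sum_(u in A) #|T :\: G u|)%:R)).
Proof.
apply: le_trans (Pr_unseen_exp R k G A T) _.
by rewrite -expR_sum sumrN -mulr_sumr -natr_sum sum_setD.
Qed.

(** A color expected [t <= 1 / 8] times is seen with probability at least
    [1 - exp (- t) >= 3 t / 4], and at most a quarter of the colors are used or forbidden; [9 / 16]
    is rounded down to [1 / 2]. *)
Lemma Ex_shareable y : y \in rich -> (r * a)%:R / 2 <= Ex (fun w => #|shareable w y|%:R : R).
Proof.
move=> yr; have yC : y \in C by move: yr; rewrite inE => /andP[/setDP[]].
have RC x : x \in sample y -> x \in C.
  by move=> /(subsetP (sample_sub y)); rewrite !inE => /andP[_ /andP[]].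
pose T := ~: (G0 :|: F y); pose n x := (a * #|[set u in sample y | x \notin F u]|)%N.
have n_le x : (n x <= r * a)%N.
  rewrite /n mulnC leq_mul2r -(card_sample yr); apply/orP; right.
  by apply: subset_leq_card; apply/subsetP => u; rewrite inE => /andP[].
have raN : (r * a)%:R / N <= 1 / 8 :> R.
  rewrite ler_pdivrMr // -mulrA mul1r ler_pdivlMl // -natrM ler_nat; exact: ra_le.
rewrite (eq_Ex (g := fun w => \sum_(x in T) (~~ unseen F (sample y) [set x] w)%:R)); last first.
  move=> w; rewrite -natr_sum; congr _%:R; rewrite -sum1_card big_mkcond [RHS]big_mkcond /=.
  by apply: eq_bigr => x _; rewrite inE -/T; case: (x \in T) => //=; case: (unseen _ _ _ _).
rewrite Ex_sum; apply: (@le_trans _ _ (\sum_(x in T) 3 / 4 * ((n x)%:R / N))); last first.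
  apply: ler_sum => x _; rewrite -/(Pr R (fun w => ~~ unseen F (sample y) [set x] w)) (PrC R cg).
  have := Pr_unseen_exp R a F (sample y) [set x]; rewrite big_set1 => h.
  pose t : R := (n x)%:R / N.
  have te : a%:R / N * #|[set u in sample y | x \notin F u]|%:R = t.
    by rewrite /t /n natrM; ring.
  have t0 : 0 <= t by rewrite divr_ge0.
  have t1 : t <= 1 / 8 by apply: le_trans raN; rewrite ler_pM2r ?invr_gt0 // ler_nat.
  rewrite te in h; have /expR_le_quad : `|- t| <= 1 by rewrite normrN ger0_norm //; lra.
  have : t ^+ 2 <= t / 8 by rewrite expr2 ler_wpM2l //; lra.
  rewrite sqrrN -/t; move: h; set P := Pr _ _; set e := expR _ => h1 h2 h3; lra.
rewrite -mulr_sumr -mulr_suml -natr_sum -big_distrr /= -sum_setD.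
have big x : x \in sample y -> 3 / 4 * N <= #|T :\: F x|%:R.
  move=> xR; have : (D.+1 <= #|T :\: F x| + (#|G0| + #|F y| + #|F x|))%N.
    apply: (@leq_trans (#|T :\: F x| + #|~: (T :\: F x)|)); first by rewrite cardsC card_ord.
    rewrite leq_add2l setCD setCK.
    by apply: leq_trans (leq_card_setU _ _) _; rewrite leq_add2r leq_card_setU.
  move=> hD; have hT : (3 * D.+1 <= 4 * #|T :\: F x|)%N.
    move: hD (F_le yC) (F_le (RC _ xR)) G0_le fm_le.
    by move: #|F x| #|F y| #|G0| #|T :\: F x|; clear; lia.
  by move: hT; rewrite -(ler_nat R) !natrM; lra.
have : (r%:R * (3 / 4 * N)) <= (\sum_(u in sample y) #|T :\: F u|)%:R.
  rewrite -(card_sample yr) mulr_natl -sumr_const natr_sum; apply: ler_sum => x xR; exact: big.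
set S := (\sum_(_ in _) _)%N => hS.
apply: (@le_trans _ _ (3 / 4 * (a%:R * (r%:R * (3 / 4 * N)) / N))).
  have -> : 3 / 4 * (a%:R * (r%:R * (3 / 4 * N)) / N) = 9 / 16 * (a%:R * r%:R) :> R.
    by move: (negbT (gt_eqF N_gt0)); move: N => nn n0; field.
  rewrite natrM [r%:R * _]mulrC; have : 0 <= a%:R * r%:R :> R by rewrite mulr_ge0.
  lra.
have : a%:R * (r%:R * (3 / 4 * N)) / N <= (a * S)%:R / N.
  by rewrite ler_pM2r ?invr_gt0 // natrM ler_wpM2l.
by apply: ler_wpM2l; apply: divr_ge0.
Qed.

Lemma shareable_diff (c : U * 'I_a) (w w' : xdraws) y : (forall j, j != c -> w j = w' j) ->
  (#|shareable w y| <= #|shareable w' y| + (c.1 \in sample y))%N.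
Proof.
move=> ww'; have [cR|cR] := boolP (c.1 \in sample y); last first.
  rewrite addn0 subset_leq_card //; apply/subsetP => x; rewrite !in_set => /andP[-> /=].
  apply: contra => /forall_inP h; apply/forall_inP => u uR; apply/forallP => i.
  rewrite ww'; first by have /forallP := h u uR; apply.
  by apply/eqP => e; move: cR; rewrite -e uR.
apply: (@leq_trans #|w c |: shareable w' y|%N); last first.
  by rewrite addnC; apply: leq_trans (leq_card_setU _ _) _; rewrite cards1.
apply: subset_leq_card; apply/subsetP => x; rewrite in_setU1 !in_set => /andP[-> /=] nu.
have [//|xw] := eqVneq x (w c); apply: contra nu => /forall_inP h.
apply/forall_inP => u uR; apply/forallP => i.
have [e|ne] := eqVneq (u, i) c; first by rewrite e !inE eq_sym (negbTE xw) andbF.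
by rewrite ww' //; have /forallP := h u uR; apply.
Qed.

(** A draw of [u] affects only the rich vertices that sample [u], at most [hm] of them. The squared
    differences therefore sum to at most [hm] times the trivial bound [|rich| r a] on [total], and
    with [l = 1 / (8 hm)] the quadratic term is half the linear one. *)
Lemma mgf_total : Ex (fun w => expR (- (8 * hm%:R)^-1 * total w)) <=
  expR (- (yt%:R * r%:R * a%:R / (32 * hm%:R))).
Proof.
have hm0 : (0 : R) < hm%:R by rewrite ltr0n (leq_trans m_gt0).
have l0 : (0 : R) < (8 * hm%:R)^-1 by rewrite invr_gt0 mulr_gt0.
pose b (c : U * 'I_a) : R := #|[set y in rich | c.1 \in sample y]|%:R.
have b_le c : b c <= hm%:R.
  rewrite ler_nat; have [cC|cC] := boolP (c.1 \in C); last first.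
    rewrite (_ : [set y in rich | c.1 \in sample y] = set0) ?cards0 //.
    apply/setP => y; rewrite !in_set; apply/negbTE; apply: contra cC => /andP[_ h].
    have := subsetP (sample_sub y) c.1; rewrite inE => /(_ h).
    by rewrite in_setD in_set => /andP[_ /andP[]].
  apply: leq_trans (nonnbr_le cC); apply: subset_leq_card; apply/subsetP => y.
  rewrite in_set => /andP[yr /(subsetP (sample_sub y))]; rewrite in_setD => /andP[_ h].
  by apply: nonnbr_sym => //; move: yr; rewrite in_set => /andP[/setDP[]].
apply: le_trans (mgf_bounded_diffT cg (b := b) (ltW l0) _ _) _.
- move=> c; rewrite mulrC ler_pdivrMr ?mulr_gt0 // mul1r.
  by have := b_le c; lra.
- move=> c w w' ww'; rewrite /total -sumrB; apply: le_trans (ler_norm_sum _ _ _) _.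
  rewrite /b -sum1_card natr_sum big_mkcond [leRHS]big_mkcond /=; apply: ler_sum => y _.
  rewrite in_set; case: (y \in rich) => //=.
  have h1 := shareable_diff y ww'.
  have h2 := @shareable_diff c w' w y (fun j jc => esym (ww' j jc)).
  move: h1 h2; rewrite -!(ler_nat R) !natrD; case: (c.1 \in sample y) => /= h1 h2.
    by rewrite ler_norml; lra.
  by rewrite ler_norml; lra.
rewrite ler_expR.
have EZ : #|rich|%:R * ((r * a)%:R / 2) <= Ex total.
  rewrite /total Ex_sum mulr_natl -sumr_const; apply: ler_sum => y yr.
  exact: Ex_shareable.
have Sb : \sum_(i : U * 'I_a) b i ^+ 2 <= hm%:R * (#|rich|%:R * (r * a)%:R).
  apply: (@le_trans _ _ (\sum_(i : U * 'I_a) hm%:R * b i)).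
    by apply: ler_sum => c _; rewrite expr2 ler_wpM2r.
  rewrite -mulr_sumr ler_wpM2l // /b -natr_sum -natrM ler_nat.
  have -> : (\sum_(i : U * 'I_a) #|[set y in rich | i.1 \in sample y]| =
     \sum_(u : U) \sum_(i : 'I_a) #|[set y in rich | u \in sample y]|)%N.
    by rewrite pair_big /=.
  rewrite (eq_bigr (fun u => a * #|[set y in rich | u \in sample y]|)%N); last first.
    by move=> u _; rewrite sum_nat_const card_ord.
  rewrite -big_distrr /=.
  rewrite (double_count xpredT (mem rich) (fun u y => u \in sample y)).
  rewrite (eq_bigr (fun=> r)) => [|y yr]; last first.
    by rewrite -(card_sample yr); apply: eq_card => u; rewrite inE.
  by rewrite sum_nat_const mulnC -mulnA.
have ytr : yt%:R <= #|rich|%:R :> R by rewrite ler_nat card_rich.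
set l := (8 * hm%:R)^-1 in l0 *.
apply: (@le_trans _ _ (- l * (#|rich|%:R * ((r * a)%:R / 2)) + 2 * l ^+ 2 * (hm%:R * (#|rich|%:R * (r * a)%:R)))).
  apply: lerD; first by rewrite ler_wnM2l // oppr_le0 ltW.
  by rewrite ler_wpM2l // mulr_ge0 // exprn_ge0 // ltW.
have -> : - l * (#|rich|%:R * ((r * a)%:R / 2)) + 2 * l ^+ 2 * (hm%:R * (#|rich|%:R * (r * a)%:R))
  = - (#|rich|%:R * ((r * a)%:R / (32 * hm%:R))) by rewrite /l; field; rewrite gt_eqF.
have -> : yt%:R * r%:R * a%:R / (32 * hm%:R) = yt%:R * ((r * a)%:R / (32 * hm%:R)) :> R.
  by rewrite natrM; ring.
by rewrite lerN2 ler_wpM2r // divr_ge0 // mulr_ge0 // ltW.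
Qed.

Definition xpart (w : draws) : xdraws := [ffun c => w (c.1, (true, c.2))].
Definition ypart (w : draws) : xdraws := [ffun c => w (c.1, (false, c.2))].

Definition noshare (w : draws) : bool :=
  unseen (fun y => ~: shareable (xpart w) y) rich setT (ypart w).

(** Given the draws marked [true], the draws marked [false] of the rich vertices all miss with
    probability at most [exp (- (a / N) total)], and [a / N >= 1 / (8 hm)] by [a_ge]. *)
Lemma Pr_noshare : Pr R noshare <= expR (- (yt%:R * r%:R * a%:R / (32 * hm%:R))).
Proof.
have hm0 : (0 : R) < hm%:R by rewrite ltr0n (leq_trans m_gt0).
apply: le_trans mgf_total.
have xI : injective (fun c : U * 'I_a => (c.1, (true, c.2))) by move=> [u i] [v j] [-> ->].
have yI : injective (fun c : U * 'I_a => (c.1, (false, c.2))) by move=> [u i] [v j] [-> ->].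
pose J := [set c : U * (bool * 'I_a) | ~~ c.2.1].
rewrite /Pr -(Ex_mix cg J).
rewrite -(Ex_inj cg (fun w => expR (- (8 * hm%:R)^-1 * total w)) xI).
apply: (le_Ex cg) => b; rewrite -[[ffun u => b _]]/(xpart b).
rewrite (eq_Ex (g := fun w => (unseen (fun y => ~: shareable (xpart b) y) rich setT (ypart w))%:R)); last first.
  move=> w; rewrite /noshare; have -> : xpart (mix J w b) = xpart b.
    by apply/ffunP => c; rewrite !ffunE inE.
  by have -> : ypart (mix J w b) = ypart w by apply/ffunP => c; rewrite !ffunE inE.
rewrite -/(Pr R (fun w => unseen (fun y => ~: shareable (xpart b) y) rich setT (ypart w))).
rewrite (Pr_inj R cg (unseen (fun y => ~: shareable (xpart b) y) rich setT) yI).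
apply: le_trans (Pr_unseen_sum _ _ _ _) _; rewrite ler_expR.
have -> : (\sum_(u in rich) #|setT :\: ~: shareable (xpart b) u|)%:R = total (xpart b).
  by rewrite /total natr_sum; apply: eq_bigr => u _; rewrite setTD setCK.
rewrite mulNr lerN2 ler_wpM2r //; first by apply: sumr_ge0.
by rewrite ler_pdivlMr // mulrC ler_pdivrMr ?mulr_gt0 // mulrC -!natrM; exact: a_ge.
Qed.

Lemma shared_pair (w : draws) : ~~ noshare w ->
  exists x y c, [/\ x \in C :\: U0, y \in C :\: U0, x != y, ~~ adj x y &
    [/\ c \notin G0, c \notin F x, c \notin F y & (exists i, w (x, i) = c) /\ (exists i, w (y, i) = c)]].
Proof.
rewrite negb_forall => /existsP[y]; rewrite negb_imply => /andP[yr].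
rewrite negb_forall => /existsP[j]; rewrite negbK setTD setCK !ffunE /= in_set => /andP[].
set c := w _; rewrite in_setC in_setU negb_or => /andP[cG cF].
rewrite negb_forall => /existsP[x]; rewrite negb_imply => /andP[xR].
rewrite negb_forall => /existsP[i]; rewrite negbK in_setD in_set1 !ffunE /= => /andP[cx /eqP xc].
have := subsetP (sample_sub y) x xR; rewrite in_setD in_set => /and4P[xU xC xy axy].
exists x, y, c; rewrite in_setD xU xC xy adj_sym axy cG cF -xc cx.
move: yr; rewrite in_set => /andP[-> _]; split=> //; split=> //.
by split; [exists (true, i) | exists (false, j)].
Qed.

End Fixed.

(** The pairs themselves are forgotten: what counts is that [2 k] vertices are properly colored with
    at most [k] colors. *)
Definition paired (k : nat) (w : draws) : bool :=
  [exists f : {ffun U -> color}, exists P : {set U},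
    [&& P \subset C, #|P| == (2 * k)%N, (#|f @: P| <= k)%N &
     [forall u in P, [&& [exists i, w (u, i) == f u], f u \notin F u &
        [forall v in P, adj u v ==> (f u != f v)]]]]].

Hypothesis adj_irr : irreflexive adj.

Lemma paired_all (w : draws) : (forall (U0 : {set U}) (G0 : {set color}),
    U0 \subset C -> (#|U0| <= 2 * m)%N -> (#|G0| <= m)%N -> ~~ noshare U0 G0 w) ->
  forall k, (k <= m)%N -> paired k w.
Proof.
move=> share; elim=> [_|k IH km].
  apply/existsP; exists [ffun=> ord0]; apply/existsP; exists set0.
  rewrite sub0set cards0 imset0 cards0 /=; apply/forall_inP => u; by rewrite inE.
have /existsP[f /existsP[P /and4P[PC /eqP cP fP /forall_inP HP]]] := IH (ltnW km).
have [||x [y [c [xC yC xy axy [cG cx cy [[i wi] [j wj]]]]]]] := shared_pair (share P (f @: P) PC _ _).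
- by rewrite cP leq_mul2l ltnW ?orbT.
- exact: leq_trans fP (ltnW km).
move: xC yC; rewrite !in_setD => /andP[xP xC] /andP[yP yC].
pose g : {ffun U -> color} := [ffun u => if (u == x) || (u == y) then c else f u].
apply/existsP; exists g; apply/existsP; exists (x |: (y |: P)).
have gP u : u \in P -> g u = f u.
  move=> uP; rewrite ffunE; case: eqP => [e|_]; first by rewrite -e uP in xP.
  by case: eqP => // e; rewrite -e uP in yP.
have gx : g x = c by rewrite ffunE eqxx.
have gy : g y = c by rewrite ffunE eqxx orbT.
have fc u : u \in P -> f u != c.
  by move=> uP; apply: contra cG => /eqP <-; apply: imset_f.
apply/and4P; split.
- by rewrite !subUset !sub1set xC yC.
- by rewrite !cardsU1 in_setU1 (negbTE xP) (negbTE xy) yP cP !add1n mulnS.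
- rewrite !imsetU1 gx gy setUA setUid; apply: leq_trans (leq_card_setU _ _) _.
  rewrite cards1 add1n ltnS (eq_in_imset (g := f)) //.
apply/forall_inP => u uP.
have H1 : [exists l, w (u, l) == g u] && (g u \notin F u).
  move: uP; rewrite !in_setU1 => /or3P[/eqP->|/eqP->|uP].
  - by rewrite gx cx andbT; apply/existsP; exists i; rewrite wi.
  - by rewrite gy cy andbT; apply/existsP; exists j; rewrite wj.
  - by rewrite gP //; have /and3P[-> -> _] := HP u uP.
rewrite andbA H1 /=; apply/forall_inP => v vP; apply/implyP => uv.
move: uP vP uv; rewrite !in_setU1.
case/or3P=> [/eqP->|/eqP->|uP]; case/or3P=> [/eqP->|/eqP->|vP].
- by rewrite adj_irr.
- by rewrite (negbTE axy).
- by rewrite gx (gP v) // eq_sym fc.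
- by rewrite adj_sym (negbTE axy).
- by rewrite adj_irr.
- by rewrite gy (gP v) // eq_sym fc.
- by rewrite gx gP // fc.
- by rewrite gy gP // fc.
move=> uv; rewrite !gP //; have /and3P[_ _ /forall_inP/(_ v vP)] := HP u uP.
by rewrite uv.
Qed.

Lemma expr_le_expR (x : R) (n : nat) : 0 <= x -> (1 + x) ^+ n <= expR (n%:R * x).
Proof.
by move=> x0; rewrite expRM_natl lerXn2r ?nnegrE ?expR_ge0 ?addr_ge0 // expR_ge1Dx.
Qed.

(** Pairs are found greedily, so it suffices that [noshare] fails for all small [U0] and [G0]. In
    the union bound the size limits enter through the weights [exp (lam (2m - |U0|))] and
    [exp (lam (m - |G0|))]. A large [lam] is efficient for few pairs, [lam = 0] for linearly
    many. *)
Lemma Pr_unpaired : 0 <= lam -> Pr R (fun w => ~~ paired m w) <=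
  expR (3 * m%:R * lam + (#|C| + D.+1)%:R * expR (- lam) -
        yt%:R * r%:R * a%:R / (32 * hm%:R)).
Proof.
move=> lam0; set B := _ * a%:R / _.
apply: (@le_trans _ _ (\sum_(U0 : {set U} | U0 \subset C) \sum_(G0 : {set color} | G0 \subset setT)
   Pr R (fun w => [&& (#|U0| <= 2 * m)%N, (#|G0| <= m)%N & noshare U0 G0 w]))).
  apply: (@le_trans _ _ (\sum_(U0 : {set U} | U0 \subset C) 
   Pr R (fun w => [exists G0 : {set color}, [&& (#|U0| <= 2 * m)%N, (#|G0| <= m)%N & noshare U0 G0 w]]))).
    apply: Pr_exists => // w nw; apply/exists_inP; apply: contraR nw => h.
    apply: (paired_all _ (leqnn m)) => U0 G0 UC Um Gm; apply: contra h => ns.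
    apply/exists_inP; exists U0 => //; apply/existsP; exists G0.
    by rewrite Um Gm.
  apply: ler_sum => U0 _; apply: Pr_exists => // w /existsP[G0 h]; exists G0 => //.
pose x := expR (- lam); have x0 : 0 < x by apply: expR_gt0.
apply: (@le_trans _ _ (\sum_(U0 : {set U} | U0 \subset C) \sum_(G0 : {set color} | G0 \subset setT)
   expR (3 * m%:R * lam - B) * x ^+ #|U0| * x ^+ #|G0|)).
  apply: ler_sum => U0 UC; apply: ler_sum => G0 _.
  have R0 : 0 <= expR (3 * m%:R * lam - B) * x ^+ #|U0| * x ^+ #|G0|.
    by rewrite !mulr_ge0 ?expR_ge0 // exprn_ge0 // ltW.
  have [Um|_] /= := leqP #|U0| (2 * m); last by rewrite /Pr (Ex_cst _ cg).
  have [Gm|_] /= := leqP #|G0| m; last by rewrite /Pr (Ex_cst _ cg).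
  apply: le_trans (Pr_noshare UC Um Gm) _; rewrite /x -!expRM_natl -!expRD ler_expR -/B.
  have : #|U0|%:R * lam <= (2 * m)%:R * lam by rewrite ler_wpM2r // ler_nat.
  have : #|G0|%:R * lam <= m%:R * lam by rewrite ler_wpM2r // ler_nat.
  rewrite natrM; lra.
apply: (@le_trans _ _ (expR (3 * m%:R * lam - B) * ((1 + x) ^+ #|C| * (1 + x) ^+ D.+1))).
  rewrite -[in X in _ <= _ * (_ * X)](card_ord D.+1) -cardsT -!sum_subsets.
  rewrite mulrA [leRHS]mulr_sumr exchange_big /=; apply: eq_leW.
  by apply: eq_bigr => G0 _; rewrite -mulr_suml -mulr_sumr.
rewrite -exprD [_ + _ - B]addrAC [leRHS]expRD ler_wpM2l ?expR_ge0 //.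
exact/expr_le_expR/ltW.
Qed.

End Pairs.

(** * Asymptotics for one cluster *)

Section ClusterStep.
Variables (R : realType) (U : finType) (D a k m : nat) (adj : rel U) (C : {set U}).
Variables (F : U -> {set 'I_D.+1}).
Notation color := 'I_D.+1.
Notation adraws := {ffun U * (bool * 'I_a) -> color}.
Notation kdraws := {ffun U * 'I_k -> color}.
Notation draws := {ffun U * ((bool * 'I_a) + 'I_k) -> color}.
Hypothesis adj_sym : symmetric adj.
Hypothesis adj_irr : irreflexive adj.

Let cg := color_gt0 D.

Definition extendable (J : finType) (w : {ffun U * J -> color}) : bool :=
  [exists f : {ffun U -> color}, [forall u in C, [&& [exists j, w (u, j) == f u], f u \notin F u &
     [forall v in C, adj u v ==> (f u != f v)]]]].

(** Removing [P] frees [2 m] vertices from the matching while its coloring forbids at most [m]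
    further colors. The two stages use separate draws, so [P] and its colors may be fixed before the
    matching is drawn. *)
Lemma cluster_step (p q : R) : 0 <= q ->
  Pr R (fun w : adraws => ~~ paired adj C F m w) <= p ->
  (forall (P : {set U}) (G : {set color}), P \subset C -> #|P| = (2 * m)%N -> (#|G| <= m)%N ->
     Pr R (fun w : kdraws => ~~ matchable (C :\: P) (fun u => F u :|: G) w) <= q) ->
  Pr R (fun w : draws => ~~ extendable w) <= p + q.
Proof.
move=> q0 pp qq.
have aI : injective (fun c : U * (bool * 'I_a) => (c.1, inl c.2 : (bool * 'I_a) + 'I_k)).
  by move=> [u i] [v j] [-> ->].
have kI : injective (fun c : U * 'I_k => (c.1, inr c.2 : (bool * 'I_a) + 'I_k)).
  by move=> [u i] [v j] [-> ->].
pose apart (w : draws) : adraws := [ffun c => w (c.1, inl c.2)].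
pose kpart (w : draws) : kdraws := [ffun c => w (c.1, inr c.2)].
apply: (@le_trans _ _ (Pr R (fun w => ~~ paired adj C F m (apart w) || (paired adj C F m (apart w) && ~~ extendable w)))).
  by apply: (le_Pr R cg) => w ->; case: (paired _ _ _ _ _).
apply: le_trans (PrU R cg _ _) _; apply: lerD.
  by rewrite (Pr_inj R cg (fun w => ~~ paired adj C F m w) aI).
apply: (Pr_cond cg (J := [set c : U * ((bool * 'I_a) + 'I_k) | if c.2 is inr _ then true else false])) => b.
set J := [set c | _].
have ab w : apart (mix J w b) = apart b by apply/ffunP => c; rewrite !ffunE inE.
have kb w : kpart (mix J w b) = kpart w by apply/ffunP => c; rewrite !ffunE inE.
have [bad|good] := boolP (paired adj C F m (apart b)); last first.
  by rewrite (Pr_eq0 R cg) // => w; rewrite ab (negbTE good).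
have /existsP[f /existsP[P /and4P[PC /eqP cP fP /forall_inP HP]]] := bad.
apply: le_trans (qq P (f @: P) PC cP fP).
rewrite -(Pr_inj R cg (fun w => ~~ matchable _ _ w) kI).
apply: (le_Pr R cg) => w; rewrite -/(kpart w) ab bad /=; apply: contra.
case/existsP=> g /andP[/forall_inP gA /forall_inP gI]; apply/existsP.
exists [ffun u => if u \in P then f u else g u]; apply/forall_inP => u uC.
rewrite !ffunE.
have gu v : v \in C -> v \notin P -> [/\ exists i, w (v, inr i) = g v, g v \notin F v & g v \notin f @: P].
  move=> vC vP; have := gA v; rewrite in_setD vP vC => /(_ isT).
  rewrite in_setD in_setU negb_or => /andP[/andP[gF gG] /imsetP[i _ gi]]; split=> //.
  by exists i; rewrite gi ffunE.
apply/and3P; split.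
- case: ifPn => uP.
    have /and3P[/existsP[i /eqP fi] _ _] := HP u uP.
    by apply/existsP; exists (inl i); rewrite -fi !ffunE inE.
  have [[i gi] _ _] := gu u uC uP.
  by apply/existsP; exists (inr i); rewrite -gi ffunE inE.
- case: ifPn => uP; first by have /and3P[] := HP u uP.
  by have [] := gu u uC uP.
apply/forall_inP => v vC; apply/implyP => uv; rewrite ffunE.
have gf x y : x \in P -> y \in C -> y \notin P -> f x != g y.
  move=> xP yC yP; have [_ _] := gu y yC yP; apply: contra => /eqP <-; exact: imset_f.
case: ifPn => uP; case: ifPn => vP.
- by have /and3P[_ _ /forall_inP/(_ v vP)/implyP/(_ uv)] := HP u uP.
- exact: gf.
- by rewrite eq_sym; apply: gf.
apply/negP => guv; have uC' : u \in C :\: P by rewrite in_setD uP.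
have := gI u uC' => /forall_inP/(_ v); rewrite in_setD vP vC guv => /(_ isT) /= /eqP e.
by rewrite e adj_irr in uv.
Qed.

End ClusterStep.

Lemma expR_ge2 (R : realType) (x : R) : 1 <= x -> 2 <= expR x.
Proof. by move=> x1; apply: le_trans (expR_ge1Dx x); lra. Qed.

Lemma expRN_le_inv (R : realType) (x : R) : 0 < x -> expR (- x) <= x^-1.
Proof.
move=> x0; rewrite expRN lef_pV2 ?posrE ?expR_gt0 //.
by apply: le_trans (expR_ge1Dx x); rewrite lerDr.
Qed.

Lemma truncn_half (R : realType) (x : R) : 2 <= x ->
  x / 2 <= (Num.truncn x)%:R <= x.
Proof.
move=> x2; have x0 : 0 <= x by lra.
by have /andP[a b] := truncn_itv x0; rewrite a andbT; move: b; rewrite -natr1; lra.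
Qed.

Lemma matching_asymptotic (R : realType) (eps : R) : 0 < eps <= 1 ->
  exists delta L0 : R, 0 < delta /\ forall (U : finType) (D k fm : nat) (C C0 : {set U})
    (F : U -> {set 'I_D.+1}) (L : R), let N : R := D.+1%:R in
  L0 <= L -> L <= N -> N <= 2 * expR L -> #|U|%:R <= expR L ->
  (1 + eps / 2) * L <= k%:R ->
  (#|C| <= D.+1)%N -> C0 \subset C -> (1 - delta) * N <= #|C0|%:R ->
  (forall u, u \in C0 -> (#|F u| + #|C| <= D.+1)%N) ->
  (forall u, u \in C -> (#|F u| <= fm)%N) -> fm%:R <= delta * N ->
  Pr R (fun w : {ffun U * 'I_k -> 'I_D.+1} => ~~ matchable C F w) <=
  20 * N * expR (- ((1 + eps / 4) * L)).
Proof.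
(* Since [th * eta = eps / 64], demanding about [eta k] hits costs little in Chernoff's bound, while
   [exp (- th) <= eps / 64] keeps almost the full exponent. *)
case/andP=> e0 e1; pose th : R := 64 / eps; pose eta : R := (eps / 64) ^+ 2.
pose K := (Num.truncn (16 / eps)).+1.
(* The first summand makes [tau^h] beat [|U|^K exp (K k)] by a factor [exp (- 10 L)]; the second
   gives [tau <= eps / 256]. *)
pose x0 : R := (4 * K%:R + 10) / eta + 256 / eps.
pose tau : R := expR (- x0).
pose e7 : R := expR 7.
have tau0 : 0 < tau by apply: expR_gt0.
have e70 : 0 < e7 by apply: expR_gt0.
(* Forbidden sets of at most [delta N] colors must be small both against the deficiency
   [tt >= tau N / 2] of middle violators and against the size [N / e^7] up to which violators count
   as small. *)
exists (tau / (4 * e7)), (64 * e7 / tau + 4096 / eps ^+ 2 + 1024 / eps + 1); split.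
  by rewrite divr_gt0 // mulr_gt0.
set delta := tau / _.
move=> U D k fm C C0 F L N LL LN NL UL kL cN sC0 c0 FC0 FC fmN.
have th0 : 0 < th by rewrite divr_gt0.
have eta0 : 0 < eta by rewrite exprn_gt0 // divr_gt0.
have Ke : 16 / eps <= K%:R by apply/ltW/truncnS_gt.
have K0 : (0 : R) < K%:R by rewrite ltr0n.
have a0 : 0 < (4 * K%:R + 10) / eta :> R by rewrite divr_gt0 // addr_gt0 // mulr_gt0.
have b0 : 0 < 256 / eps by rewrite divr_gt0.
have x00 : 0 < x0 by rewrite addr_gt0.
have tau_eps : tau <= eps / 256.
  apply: le_trans (expRN_le_inv x00) _; rewrite -[eps / 256]invrK invf_div.
  by rewrite lef_pV2 ?posrE // /x0 lerDr ltW.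
have tauK : tau <= expR (- ((4 * K%:R + 10) / eta)).
  by rewrite ler_expR lerN2 /x0 lerDl ltW.
have tau1 : tau <= 1 by move: tau_eps e1; clear; lra.
have e7_ge : 8 <= e7 by apply: le_trans (expR_ge1Dx 7); clear; lra.
have delta0 : 0 < delta by rewrite divr_gt0 // mulr_gt0.
have delta_tau : delta <= tau / 4.
  rewrite /delta ler_pdivrMr ?mulr_gt0 //.
  have : tau * 1 <= tau * e7 by rewrite ler_pM2l //; move: e7_ge; clear; lra.
  by clear; lra.
have delta_e7 : delta * e7 <= 1 / 4.
  by rewrite /delta invfM mulrA mulfVK ?gt_eqF //; move: tau1; clear; lra.
clearbody delta.
have N0 : 0 < N by rewrite ltr0n.
have [L1 L2 L3 L4] : [/\ 64 * e7 / tau <= L, 4096 / eps ^+ 2 <= L, 1024 / eps <= L & 1 <= L].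
  have h1 : 0 <= 64 * e7 / tau by rewrite divr_ge0 ?ltW // mulr_gt0.
  have h2 : 0 <= 4096 / eps ^+ 2 by rewrite divr_ge0 // exprn_ge0 // ltW.
  have h3 : 0 <= 1024 / eps by rewrite divr_ge0 // ltW.
  move: LL h1 h2 h3; set u := _ / tau; set v := _ / _ ^+ 2; set x := 1024 / _.
  by clear => LL h1 h2 h3; split; lra.
have Lk : L <= k%:R.
  by apply: le_trans kL; rewrite mulrDl mul1r lerDl mulr_ge0 //; move: e0 L4; clear; lra.
have k0 : 0 <= k%:R - L by rewrite subr_ge0.
have L1' : 64 * e7 <= tau * L by move: L1; rewrite ler_pdivrMr // [L * tau]mulrC.
have tauN : 64 * e7 <= tau * N by apply: le_trans L1' _; rewrite ler_pM2l.
have Ne7 : 64 <= N / e7.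
  by rewrite ler_pdivlMr //; apply: le_trans (ler_piMl (ltW N0) tau1); move: tauN e70; clear; lra.
have [tt1 tt2] : tau * N / 2 <= (Num.truncn (tau * N))%:R /\ (Num.truncn (tau * N))%:R <= tau * N.
  by apply/andP/truncn_half; move: tauN e7_ge; clear; lra.
have [ts1 ts2] : N / e7 / 2 <= (Num.truncn (N / e7))%:R /\ (Num.truncn (N / e7))%:R <= N / e7.
  by apply/andP/truncn_half; move: Ne7; clear; lra.
set tt := Num.truncn (tau * N) in tt1 tt2; set ts := Num.truncn (N / e7) in ts1 ts2.
pose h := (Num.truncn (eta * k%:R)).+1.
have [h1 h2] : eta * k%:R <= h%:R /\ h%:R <= eta * k%:R + 1.
  have := @truncn_itv R (eta * k%:R); rewrite mulr_ge0 ?(ltW eta0) //= => /(_ isT)/andP[h1 h2].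
  by rewrite /h ltW // -natr1 lerD2r.
(* The five units of [eps / 64] are spent in [T3]: two on [th * h], and three on the factors
   [1 - eps / 64] coming from [th], [kap] and the size of [C0]. *)
have ek : (1 + eps / 4) * L <= (1 - 5 * eps / 64) * k%:R.
  apply: (@le_trans _ _ ((1 - 5 * eps / 64) * ((1 + eps / 2) * L))); last first.
    by rewrite ler_wpM2l //; move: e1; clear; lra.
  rewrite mulrA ler_wpM2r //; first by move: L4; clear; lra.
  by move: e0 e1; clear; nra.
have cb : (1 - eps / 64) * N <= #|C0|%:R - tt%:R.
  have : (delta + tau) * N <= eps / 64 * N.
    by rewrite ler_wpM2r ?(ltW N0) //; move: delta_tau tau_eps e0; clear; lra.
  by move: c0 tt2; rewrite !mulrBl mulrDl mul1r; clear; lra.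
pose kap : R := eps / 64.
pose q : R := expR (- (tau / 4)).
pose lz : R := (1 - kap / 2) * (k%:R * (#|C0|%:R - tt%:R) / N).
have kcb : (1 - eps / 64) * k%:R <= k%:R * (#|C0|%:R - tt%:R) / N.
  by rewrite ler_pdivlMr // mulrAC mulrC ler_wpM2l.
have lzk : (1 - 5 * eps / 64) * k%:R <= lz.
  apply: (@le_trans _ _ ((1 - kap / 2) * ((1 - eps / 64) * k%:R))).
    by rewrite mulrA ler_wpM2r // /kap; move: e0 e1; clear; nra.
  by rewrite ler_wpM2l // /kap; move: e1; clear; lra.
have C0C : #|C|%:R <= N by rewrite ler_nat.
have small : #|C|%:R * (N * expR (- 6) ^+ k) <= 2 * N * expR (- 5 * L).
  rewrite -expRM_natl mulrA.
  have -> : 2 * N * expR (- 5 * L) = 2 * expR L * N * expR (- 6 * L).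
    rewrite mulrAC -!mulrA [N * _]mulrC !mulrA; congr (_ * N); rewrite -mulrA -expRD.
    by congr (_ * expR _); ring.
  apply: ler_pM; rewrite ?expR_ge0 ?mulr_ge0 // ?ler_pM2r //; first exact: le_trans C0C NL.
  by rewrite ler_expR; move: Lk; clear; lra.
have small1 : 2 * N * expR (- 5 * L) <= 1.
  apply: (@le_trans _ _ (2 * (2 * expR L) * expR (- 5 * L))).
    by rewrite ler_wpM2r ?expR_ge0 // ler_wpM2l.
  rewrite mulrA -mulrA -expRD; apply: (@le_trans _ _ (2 * 2 * expR (- 2))).
    by rewrite ler_wpM2l ?mulr_ge0 // ler_expR; move: L4; clear; lra.
  rewrite -[2]opprK expRN !opprK ler_pdivrMr ?expR_gt0 // mul1r.
  apply: (@le_trans _ _ (expR 1 * expR 1)); first by apply: ler_pM => //; apply: expR_ge2.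
  by rewrite -expRD.
have pe7 : (ts + fm)%:R <= expR (- 6) * N.
  rewrite natrD; apply: (@le_trans _ _ (2 * (N / e7))).
    have : fm%:R <= N / e7.
      apply: le_trans fmN _; rewrite ler_pdivlMr // mulrAC.
      by rewrite ler_piMl ?(ltW N0) //; move: delta_e7; clear; lra.
    by move: ts2; clear; lra.
  rewrite mulrC -mulrA [leRHS]mulrC ler_pM2l // mulrC ler_pdivrMr //.
  by rewrite /e7 -expRD; apply: expR_ge2; clear; lra.
have N1 : 1 <= N by rewrite ler1n.
have NL1 : L <= N by [].
pose X := expR (- ((1 + eps / 4) * L)).
have X0 : 0 < X by apply: expR_gt0.
have XN : X <= N * X by rewrite ler_peMl // ltW.
have X2 : expR (- 2 * L) <= X.
  rewrite ler_expR mulNr lerN2 ler_wpM2r //; first by move: L4; clear; lra.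
  by move: e1; clear; lra.
(* The [4^N] choices are at most [exp (2 N)], while [k ts tau / 4 >= 8 N] because
   [tau L >= 64 e^7]. *)
have T2 : 2 ^+ #|C| * (2 ^+ D.+1 * (q ^+ k) ^+ ts) <= N * X.
  apply: le_trans XN; apply: le_trans X2.
  have two : 2 ^+ D.+1 <= expR N.
    by rewrite -[N]mulr1 /N expRM_natl lerXn2r ?nnegrE ?expR_ge0 // expR_ge2.
  apply: (@le_trans _ _ (expR N * (expR N * (q ^+ k) ^+ ts))).
    have q0 : 0 <= (q ^+ k) ^+ ts by rewrite !exprn_ge0 // expR_ge0.
    apply: ler_pM; rewrite ?mulr_ge0 ?ler_wpM2r ?exprn_ge0 ?expR_ge0 //.
    by apply: le_trans two; rewrite ler_eXn2l // ltr1n.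
  rewrite /q -!expRM_natl -!expRD ler_expR.
  have : 8 * N <= ts%:R * (k%:R * (tau / 4)).
    apply: (@le_trans _ _ (N / e7 / 2 * (L * (tau / 4)))).
      have -> : N / e7 / 2 * (L * (tau / 4)) = N * ((tau * L) / e7) / 8 by field; rewrite gt_eqF.
      have : N * 64 <= N * (tau * L / e7) by rewrite ler_pM2l // ler_pdivlMr.
      by clear; lra.
    apply: ler_pM => //.
    - by rewrite !divr_ge0 // ltW.
    - by rewrite mulr_ge0 ?divr_ge0 // ?(ltW tau0) //; move: L4; clear; lra.
    - by rewrite ler_pM2r // divr_gt0.
  by move: NL1 N1; clear; lra.
have T3 : expR (th * h%:R - (1 - expR (- th)) * (k%:R * ((1 - kap) * #|C0|%:R) / N)) <= X.
  rewrite ler_expR.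
  have p1 : th * h%:R <= eps / 32 * k%:R.
    apply: (@le_trans _ _ (th * (eta * k%:R + 1))); first by rewrite ler_pM2l.
    have -> : th * (eta * k%:R + 1) = eps / 64 * k%:R + eps / 64 * (4096 / eps ^+ 2).
      by rewrite /th /eta; field; rewrite gt_eqF.
    have : eps / 64 * (4096 / eps ^+ 2) <= eps / 64 * k%:R.
      by rewrite ler_pM2l ?divr_gt0 //; apply: le_trans L2 Lk.
    by clear; lra.
  have p2 : 1 - eps / 64 <= 1 - expR (- th).
    rewrite lerD2l lerN2; apply: le_trans (expRN_le_inv th0) _.
    by rewrite /th invf_div.
  have p3 : (1 - eps / 64) * ((1 - eps / 64) * k%:R) <= k%:R * ((1 - kap) * #|C0|%:R) / N.
    rewrite ler_pdivlMr //.
    have : (1 - eps / 64) * k%:R * ((1 - eps / 64) * N) <= (1 - eps / 64) * k%:R * #|C0|%:R.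
      rewrite ler_wpM2l //; first by rewrite mulr_ge0 //; move: e1; clear; lra.
      by move: cb; have : 0 <= tt%:R :> R by []; clear; lra.
    by rewrite /kap; clear; lra.
  have p4 : (1 - eps / 64) * ((1 - eps / 64) * ((1 - eps / 64) * k%:R)) <=
      (1 - expR (- th)) * (k%:R * ((1 - kap) * #|C0|%:R) / N).
    have x1 : 0 <= 1 - eps / 64 by move: e1; clear; lra.
    by apply: ler_pM => //; rewrite !mulr_ge0.
  have p5 : (1 - 3 * (eps / 64)) * k%:R <= (1 - eps / 64) * ((1 - eps / 64) * ((1 - eps / 64) * k%:R)).
    by rewrite !mulrA ler_wpM2r //; move: e0 e1; clear; nra.
  move: p1 (le_trans p5 p4) ek; set Q := (1 - expR _) * _; set Q' := th * _; clearbody Q Q'.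
  by clear; lra.
have T4 : N * (#|U|%:R ^+ K * (tau ^+ h * expR (K * k)%:R)) <= N * expR (- 10 * L).
  rewrite ler_pM2l //.
  have t1 : #|U|%:R ^+ K <= expR (K%:R * L).
    by rewrite expRM_natl lerXn2r // nnegrE ?expR_ge0.
  have t2 : tau ^+ h <= expR (- ((4 * K%:R + 10) * k%:R)).
    apply: (@le_trans _ _ (expR (- ((4 * K%:R + 10) / eta)) ^+ h)).
      by rewrite lerXn2r // nnegrE ?expR_ge0 // ltW.
    rewrite -expRM_natl ler_expR.
    have -> : h%:R * - ((4 * K%:R + 10) / eta) = - ((4 * K%:R + 10) * (h%:R / eta)) by ring.
    rewrite lerN2 ler_wpM2l //; first by rewrite addr_ge0 // mulr_ge0.
    by rewrite ler_pdivlMr // mulrC.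
  apply: (@le_trans _ _ (expR (K%:R * L) * (expR (- ((4 * K%:R + 10) * k%:R)) * expR (K * k)%:R))).
    apply: ler_pM => //; first by rewrite exprn_ge0.
      by rewrite mulr_ge0 ?expR_ge0 // exprn_ge0 // ltW.
    by rewrite ler_wpM2r ?expR_ge0.
  rewrite -!expRD ler_expR natrM.
  have : K%:R * L <= K%:R * k%:R by rewrite ler_wpM2l.
  have : 0 <= K%:R * k%:R :> R by rewrite mulr_ge0.
  by move: Lk; clear; lra.
have T5 : expR (- lz) <= X by rewrite ler_expR lerN2; apply: le_trans ek lzk.
have X5 : expR (- 5 * L) <= X by apply: le_trans X2; rewrite ler_expR; move: L4; clear; lra.
have X10 : expR (- 10 * L) <= X by apply: le_trans X2; rewrite ler_expR; move: L4; clear; lra.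
apply: le_trans (@Pr_unmatchable R U D k C C0 F K h tt tt ts fm kap th tau (expR (- 6)) q lz
  cN sC0 FC0 FC _ _ _ (ltW th0) _ tt2 _ _ pe7 (le_trans small small1) _ _ _ (erefl _) _ _) _.
- by [].
- by [].
- by rewrite /kap divr_gt0 //=; move: e1; clear; lra.
- by rewrite tau0 tau1.
- by rewrite leq_pmull.
- have : tau * N <= eps / 256 * N by rewrite ler_wpM2r // ltW.
  have : 0 <= eps / 128 * #|C0|%:R - eps / 128 * (N / 2).
    rewrite -mulrBr mulr_ge0 ?divr_ge0 ?(ltW e0) // subr_ge0.
    move: cb; have : 0 <= tt%:R :> R by [].
    have : (1 - eps / 64) * N >= 1 / 2 * N by rewrite ler_wpM2r ?(ltW N0) //; move: e1; clear; lra.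
    by clear; lra.
  by rewrite /kap; move: tt2; clear; lra.
- apply: (@le_trans _ _ ((1 - tau / 4) * N)).
    have : delta * N <= tau / 4 * N by rewrite ler_wpM2r // ltW.
    by move: fmN tt1; rewrite mulrBl mul1r; clear; lra.
  by rewrite ler_wpM2r ?(ltW N0) //; apply: expR_ge1Dx.
- by rewrite expR_ge0 -expR0 ler_expR oppr_le0 divr_ge0 // ltW.
- apply: le_trans T4 _; apply: le_trans small1.
  rewrite -mulrA mulrCA ler_wpM2l ?(ltW N0) //; apply: (@le_trans _ _ (1 * expR (- 5 * L))).
    by rewrite mul1r ler_expR; move: L4; clear; lra.
  by rewrite ler_wpM2r ?expR_ge0 // ler1n.
- apply: le_trans kcb; rewrite /kap invf_div mulrA.
  have : 1 / 2 * L <= (1 - eps / 64) * k%:R.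
    by apply: ler_pM => //; move: L4 e1; clear; lra.
  by move: L3; clear; lra.
- apply: (@le_trans _ _ (2 * expR L * expR (- (lz * (1 - K%:R^-1))))).
    by rewrite ler_wpM2r ?expR_ge0 //; apply: le_trans C0C NL.
  have K16 : 1 - eps / 16 <= 1 - K%:R^-1.
    rewrite lerD2l lerN2 -[eps / 16]invrK lef_pV2 ?posrE ?invr_gt0 ?divr_gt0 //.
    by rewrite invf_div.
  have lzL : (1 + eps / 8) * L <= lz * (1 - K%:R^-1).
    apply: (@le_trans _ _ ((1 + eps / 4) * L * (1 - eps / 16))).
      rewrite mulrAC ler_wpM2r //; first by move: L4; clear; lra.
      by move: e0 e1; clear; nra.
    apply: ler_pM => //; last exact: le_trans ek lzk.
      by rewrite mulr_ge0 //; move: L4 e0; clear; lra.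
    by move: e1; clear; lra.
  rewrite -mulrA -expRD; apply: (@le_trans _ _ (2 * expR (- 1))).
    rewrite ler_wpM2l // ler_expR.
    have : 1 <= eps / 8 * L.
      have : eps / 8 * (1024 / eps) <= eps / 8 * L by rewrite ler_pM2l // divr_gt0.
      have -> : eps / 8 * (1024 / eps) = 128 by field; rewrite gt_eqF.
      by clear; lra.
    by move: lzL; clear; lra.
  by rewrite expRN ler_pdivrMr ?expR_gt0 // mul1r expR_ge2.
rewrite /matching_bound -/X -/N.
have q1 : 3 * (#|C|%:R * (N * expR (- 6) ^+ k)) <= 6 * (N * X).
  have : 2 * N * expR (- 5 * L) <= 2 * N * X by rewrite ler_wpM2l // mulr_ge0 // ltW.
  by move: small; clear; lra.
have q3 : N * expR (th * h%:R - (1 - expR (- th)) * (k%:R * ((1 - kap) * #|C0|%:R) / N)) <= N * X.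
  by rewrite ler_pM2l.
have q4 : N * expR (- 10 * L) <= N * X by rewrite ler_pM2l.
have q5 := ler_wpM2l (ler0n R 3) (le_trans T4 q4).
have q6 := ler_wpM2l (ler0n R 4) (le_trans T5 XN).
apply: le_trans (lerD (lerD (lerD (lerD q1 T2) q3) q5) q6) _.
have : 0 <= N * X by rewrite mulr_ge0 ?ltW.
by rewrite -mulrA; move: (N * X) => Y; clear; lra.
Qed.

Lemma uphalf_bounds (m : nat) : (2 * uphalf m <= m.+1)%N /\ (m <= 2 * uphalf m)%N.
Proof. by rewrite uphalf_half; have := odd_double_half m; case: (odd m) => /=; lia. Qed.

Lemma pairing_asymptotic (R : realType) (theta alpha : R) : 0 < theta <= 1 -> 0 < alpha <= 1 ->
  exists delta L0 : R, 0 < delta /\ forall (U : finType) (D a m : nat) (adj : rel U) (C : {set U})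
    (F : U -> {set 'I_D.+1}) (L : R), let N : R := D.+1%:R in
  symmetric adj -> irreflexive adj ->
  L0 <= L -> L <= N -> N <= 2 * expR L -> alpha * L <= a%:R -> a%:R <= L / 16 ->
  (0 < m)%N -> (#|C| <= D.+1)%N ->
  (forall u, u \in C -> #|nonnbr adj C u|%:R <= delta * N) ->
  (forall u, u \in C -> #|F u|%:R <= 2 * delta * N) ->
  theta * N <= #|[set u in C | (m <= #|nonnbr adj C u|)%N]|%:R ->
  Pr R (fun w : {ffun U * (bool * 'I_a) -> 'I_D.+1} => ~~ paired adj C F m w) <= expR (- 3 * L).
Proof.
(* The constant 10240 is [4 * 32 * 80]: it makes the exponent of [Pr_unpaired] at least [80 / alpha]
   per sampled draw, and [80 = 5 * 16] is what the case of large [m] requires. *)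
case/andP=> t0 t1 /andP[al0 al1]; pose delta : R := theta * alpha / 10240.
have d0 : 0 < delta by rewrite divr_gt0 // mulr_gt0.
have dt : delta <= theta / 10240 by rewrite /delta ler_pM2r ?invr_gt0 // ler_piMr // ltW.
have dE : delta = theta * alpha / 10240 by [].
clearbody delta; exists delta, (4 / theta + 2 / delta + (4 * alpha * delta)^-1 + 1); split=> //.
move=> U D a m adj C F L N sym irr LL LN NL aL aU m0 cN hC FC many.
have [L1 L2 L3 L4] : [/\ 4 / theta <= L, 2 / delta <= L, (4 * alpha * delta)^-1 <= L & 1 <= L].
  have h1 : 0 <= 4 / theta by rewrite divr_ge0 // ltW.
  have h2 : 0 <= 2 / delta by rewrite divr_ge0 // ltW.
  have h3 : 0 <= (4 * alpha * delta)^-1 by rewrite invr_ge0 !mulr_ge0 // ltW.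
  move: LL h1 h2 h3; set u := 4 / _; set v := 2 / _; set x := _^-1; clearbody u v x.
  by clear => LL h1 h2 h3; split; lra.
have N0 : 0 < N by rewrite ltr0n.
have tN : 4 <= theta * N.
  by move: L1; rewrite ler_pdivrMr // [L * _]mulrC => /le_trans -> //; rewrite ler_pM2l.
have dN : 2 <= delta * N.
  by move: L2; rewrite ler_pdivrMr // [L * _]mulrC => /le_trans -> //; rewrite ler_pM2l.
have [hm1 hm2] : delta * N / 2 <= (Num.truncn (delta * N))%:R /\ (Num.truncn (delta * N))%:R <= delta * N.
  exact/andP/truncn_half.
have [fm1 fm2] : 2 * delta * N / 2 <= (Num.truncn (2 * delta * N))%:R /\ (Num.truncn (2 * delta * N))%:R <= 2 * delta * N.
  by apply/andP/truncn_half; move: dN; clear; lra.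
have [yt1 yt2] : theta * N / 2 / 2 <= (Num.truncn (theta * N / 2))%:R /\ (Num.truncn (theta * N / 2))%:R <= theta * N / 2.
  by apply/andP/truncn_half; move: tN; clear; lra.
set hm := Num.truncn (delta * N) in hm1 hm2; set fm := Num.truncn (2 * delta * N) in fm1 fm2.
set yt := Num.truncn (theta * N / 2) in yt1 yt2.
have hCn u : u \in C -> (#|nonnbr adj C u| <= hm)%N.
  by move=> uC; rewrite truncn_ge_nat ?hC //; move: dN; clear; lra.
have FCn u : u \in C -> (#|F u| <= fm)%N.
  by move=> uC; rewrite truncn_ge_nat ?FC //; move: dN; clear; lra.
have m_hm : (m <= hm)%N.
  have : (0 < #|[set u in C | (m <= #|nonnbr adj C u|)%N]|)%N.
    by rewrite -(ltr_nat R); move: many tN; clear; lra.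
  by move=> /card_gt0P[u]; rewrite inE => /andP[uC mu]; apply: leq_trans mu (hCn u uC).
have hm0 : (0 : R) < hm%:R by rewrite ltr0n (leq_trans m0).
have dtN : delta * N <= theta / 10240 * N by rewrite ler_pM2r.
have tN1 : theta * N <= N by rewrite ler_piMl // ltW.
have fm_le : (4 * (m + 2 * fm) <= D.+1)%N.
  have mh : m%:R <= hm%:R :> R by rewrite ler_nat.
  by rewrite -(ler_nat R) natrM natrD natrM -/N; move: hm2 fm2 dtN tN1 mh N0; clear; lra.
have a0 : (0 : R) < a%:R by apply: lt_le_trans aL; rewrite mulr_gt0 //; move: L4; clear; lra.
have a_ge : N <= (8 * hm * a)%:R.
  rewrite !natrM.
  have : 1 <= 4 * delta * a%:R.
    apply: (@le_trans _ _ (4 * delta * (alpha * L))); last by rewrite ler_pM2l // mulr_gt0.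
    have -> : 4 * delta * (alpha * L) = (4 * alpha * delta) * L by ring.
    by rewrite -ler_pdivrMl ?mulr_gt0 // mulr1.
  move=> h; have : N * 1 <= N * (4 * delta * a%:R) by rewrite ler_pM2l.
  have : delta * N / 2 * a%:R <= hm%:R * a%:R by rewrite ler_pM2r.
  by clear; lra.
have manyn : (yt + 6 * hm <= #|[set u in C | (m <= #|nonnbr adj C u|)%N]|)%N.
  rewrite -(ler_nat R) natrD natrM; apply: le_trans many.
  by move: yt2 hm2 dtN tN; clear; lra.
have bound r : (r * a)%:R * (80 / alpha) <= yt%:R * r%:R * a%:R / (32 * hm%:R).
  rewrite ler_pdivlMr ?mulr_gt0 // natrM.
  have : r%:R * a%:R * (80 / alpha) * (32 * hm%:R) <= r%:R * a%:R * (80 / alpha) * (32 * (delta * N)).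
    by apply: ler_wpM2l; [rewrite !mulr_ge0 ?invr_ge0 ?(ltW al0) | rewrite ler_pM2l].
  have -> : r%:R * a%:R * (80 / alpha) * (32 * (delta * N)) = r%:R * a%:R * (theta * N / 2 / 2).
    by rewrite dE; field; rewrite gt_eqF.
  have : r%:R * a%:R * (theta * N / 2 / 2) <= r%:R * a%:R * yt%:R by rewrite ler_wpM2l // mulr_ge0.
  by clear; lra.
have key r lam : (2 * r <= m.+1)%N -> (8 * (r * a) <= D.+1)%N -> 0 <= lam ->
    3 * m%:R * lam + 2 * N * expR (- lam) - (r * a)%:R * (80 / alpha) <= - 3 * L ->
    Pr R (fun w : {ffun U * (bool * 'I_a) -> 'I_D.+1} => ~~ paired adj C F m w) <= expR (- 3 * L).
  move=> rm ra lam0 h.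
  apply: le_trans (Pr_unpaired sym FCn hCn m0 m_hm rm ra fm_le a_ge manyn irr lam0) _.
  rewrite ler_expR; apply: le_trans h; apply: lerB; last exact: bound.
  rewrite lerD2l ler_wpM2r ?expR_ge0 // natrD -/N.
  have : #|C|%:R <= N by rewrite ler_nat.
  by clear; lra.
have [um1 um2] := uphalf_bounds m.
(* For small [m], half of the [m] non-neighbors are sampled and [lam = L] makes the union cheap. For
   large [m] their draws would exceed [N / 8], so [r] is cut to about [N / (8 a)]; the exponent is
   then linear in [N] and the full union with [lam = 0] is affordable. *)
have [reg|reg] := leqP (8 * (uphalf m * a)) D.+1.
  apply: (key (uphalf m) L) => //; first by move: L4; clear; lra.
  have m2 : m%:R / 2 <= (uphalf m)%:R :> R.
    by rewrite ler_pdivrMr // -natrM ler_nat mulnC.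
  have e1 : 2 * N * expR (- L) <= 4.
    by rewrite expRN ler_pdivrMr ?expR_gt0 //; move: NL; clear; lra.
  have m1 : L <= m%:R * L by rewrite ler_peMl ?ler1n //; move: L4; clear; lra.
  have e2 : 40 * (m%:R * L) <= (uphalf m * a)%:R * (80 / alpha).
    have -> : 40 * (m%:R * L) = (m%:R / 2) * (alpha * L) * (80 / alpha) by field; rewrite gt_eqF.
    have aL0 : 0 <= alpha * L by rewrite mulr_ge0 ?(ltW al0) //; move: L4; clear; lra.
    by rewrite ler_pM2r ?divr_gt0 // natrM; apply: ler_pM => //; apply: divr_ge0.
  by move: e1 e2 m1 L4; clear; lra.
have a0n : (0 < a)%N by rewrite -(ltr_nat R).
pose r := (D.+1 %/ (8 * a))%N.
have r1 : (8 * (r * a) <= D.+1)%N by rewrite mulnA [(8 * r)%N]mulnC -mulnA leq_divM.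
have r2 : (r < uphalf m)%N.
  by rewrite ltn_divLR ?muln_gt0 //; move: reg; rewrite mulnA [(8 * _)%N]mulnC -mulnA.
have r3 : (D.+1 <= 16 * (r * a))%N.
  have : (0 < r)%N.
    rewrite divn_gt0 ?muln_gt0 // -(ler_nat R) natrM.
    by move: aU LN; rewrite /N; clear; set n := D.+1%:R; clearbody n; have := ler0n R a; lra.
  have := ltn_ceil D.+1 (_ : 0 < 8 * a)%N; rewrite muln_gt0 a0n => /(_ isT); rewrite -/r.
  by clear; nia.
apply: (key r 0) => //.
  by move: r2 um1; clear; lia.
rewrite mulr0 oppr0 expR0 mulr1 add0r.
have e2 : 5 * N <= (r * a)%:R * (80 / alpha).
  have h : N / 16 <= (r * a)%:R.
    by rewrite ler_pdivrMr // mulrC -natrM ler_nat.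
  apply: (@le_trans _ _ (N / 16 * (80 / alpha))); last by rewrite ler_pM2r // divr_gt0.
  have -> : N / 16 * (80 / alpha) = 5 * N / alpha by field; rewrite gt_eqF.
  by rewrite ler_pdivlMr // ler_piMr // mulr_ge0 // ltW.
by move: e2 LN; clear; lra.
Qed.

(** The non-neighbors of [u] inside [C] are the only reason why its outside neighbors can outnumber
    [N - |C|]; this excess is what the pairs have to repair. *)
Lemma card_forbidden (U : finType) (D : nat) (adj : rel U) (C : {set U}) (u : U) :
  irreflexive adj -> (#|[set w | adj u w]| <= D)%N -> u \in C ->
  (#|[set w | adj u w] :\: C| + #|C| <= D.+1 + #|nonnbr adj C u|)%N.
Proof.
move=> irr deg uC.
have -> : #|C| = (#|[set w | adj u w] :&: C| + #|nonnbr adj C u|).+1%N.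
  rewrite (cardsD1 u) uC add1n -(cardsID [set w | adj u w]); congr (_ + _).+1%N.
    apply: eq_card => v; rewrite !inE.
    by case: eqVneq => [->|_]; rewrite ?irr ?andbF //= andbC.
  by apply: eq_card => v; rewrite !inE; case: (adj u v); case: (v == u); case: (v \in C).
have := cardsID C [set w | adj u w]; move: deg; clear.
move: #|[set w | adj u w] :&: C| #|[set w | adj u w] :\: C| #|[set w | adj u w]|.
by clear; lia.
Qed.

Lemma cluster_asymptotic (R : realType) (eps alpha : R) : 0 < eps <= 1 -> 0 < alpha <= 1 ->
  exists delta L0 : R, 0 < delta /\ forall (U : finType) (D a k : nat) (adj : rel U) (C : {set U})
    (F : U -> {set 'I_D.+1}) (L : R), let N : R := D.+1%:R in
  symmetric adj -> irreflexive adj -> (forall u, (#|[set w | adj u w]| <= D)%N) ->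
  L0 <= L -> L <= N -> N <= 2 * expR L -> #|U|%:R <= expR L ->
  alpha * L <= a%:R -> a%:R <= L / 16 -> (1 + eps / 2) * L <= k%:R ->
  (#|C| <= D.+1)%N -> (1 - delta) * N <= #|C|%:R ->
  (forall u, u \in C -> #|nonnbr adj C u|%:R <= delta * N) ->
  (forall u, u \in C -> (#|F u| <= #|[set w | adj u w] :\: C|)%N) ->
  Pr R (fun w : {ffun U * ((bool * 'I_a) + 'I_k) -> 'I_D.+1} => ~~ extendable adj C F w) <=
  21 * N * expR (- ((1 + eps / 4) * L)).
Proof.
move=> eps01 al01; have /andP[e0 e1] := eps01.
have [d1 [L1 [d10 matching]]] := matching_asymptotic eps01.
pose theta : R := Num.min (d1 / 4) 1.
have theta01 : 0 < theta <= 1.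
  by rewrite lt_min divr_gt0 // ltr01 ge_min lexx orbT.
have [t0 t1] := andP theta01.
have td1 : theta <= d1 / 4 by rewrite ge_min lexx.
have [d2 [L2 [d20 pairing]]] := pairing_asymptotic theta01 al01.
pose delta : R := Num.min d2 (d1 / 16).
have delta0 : 0 < delta by rewrite lt_min d20 divr_gt0.
have dd2 : delta <= d2 by rewrite ge_min lexx.
have dd1 : delta <= d1 / 16 by rewrite ge_min lexx orbT.
exists delta, (Num.max 1 (Num.max L1 L2)); split=> //.
move=> U D a k adj C F L N sym irr deg; rewrite !ge_max => /and3P[LL0 LL1 LL2] LN NL UL aL aU kL cN cd hC FC.
have N0 : 0 < N by rewrite ltr0n.
(* The least [m] with few vertices of more than [m] non-neighbors balances two needs. By minimality,
   if [m > 0], many vertices have at least [m] non-neighbors, so [m] pairs can be found. For all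
   others the excess is at most [m]; with [m] more colors forbidden and [2 m] vertices removed, the
   condition [|F u| + |C| <= N] is restored. *)
pose big m := [set u in C | (m < #|nonnbr adj C u|)%N].
have ex_m : exists m, #|big m|%:R <= theta * N.
  exists #|U|; rewrite (_ : big _ = set0) ?cards0 ?mulr_ge0 ?(ltW t0) //.
  by apply/setP => u; rewrite !inE ltnNge max_card andbF.
case: (ex_minnP ex_m) => m mbig mmin.
have mdN : m%:R <= delta * N.
  case: m mbig mmin => [|m] mbig mmin; first by rewrite mulr_ge0 // ltW.
  have /card_gt0P[u] : (0 < #|big m|)%N.
    rewrite lt0n; apply/negP => /eqP b0; have := mmin m; rewrite b0 ltnn mulr_ge0 ?(ltW t0) //.
    by move=> /(_ isT).
  by rewrite inE => /andP[uC mu]; apply: le_trans (hC u uC); rewrite ler_nat.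
have FCd u : u \in C -> #|F u|%:R <= 2 * delta * N.
  move=> uC; have := card_forbidden irr (deg u) uC; rewrite -(ler_nat R) !natrD -/N.
  have : #|F u|%:R <= #|[set w | adj u w] :\: C|%:R :> R by rewrite ler_nat FC.
  by have := hC u uC; move: cd; rewrite mulrBl mul1r; clear; lra.
have dN2 : delta * N <= d2 * N by rewrite ler_pM2r.
have dN1 : delta * N <= d1 / 16 * N by rewrite ler_pM2r.
pose X := expR (- ((1 + eps / 4) * L)).
have X0 : 0 < X by apply: expR_gt0.
have N1 : 1 <= N by rewrite ler1n.
have -> : 21 * N * X = N * X + 20 * N * X by ring.
apply: (@cluster_step R U D a k m adj C F irr).
- by rewrite !mulr_ge0 // ltW.
- case: m mbig mmin mdN => [|m] mbig mmin mdN.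
    rewrite (Pr_eq0 R (color_gt0 D)); first by rewrite mulr_ge0 // ltW.
    move=> w; rewrite negbK; apply/existsP; exists [ffun=> ord0].
    apply/existsP; exists set0; rewrite sub0set cards0 imset0 cards0 /=.
    by apply/forall_inP => u; rewrite inE.
  apply: (@le_trans _ _ X); last by rewrite ler_peMl // ltW.
  apply: (@le_trans _ _ (expR (- 3 * L))); last first.
    rewrite ler_expR mulNr lerN2 ler_wpM2r //; first by move: LL0; clear; lra.
    by move: e1; clear; lra.
  apply: pairing => //.
  - by move=> u uC; apply: le_trans (hC u uC) dN2.
  - by move=> u uC; apply: le_trans (FCd u uC) _; move: dN2; clear; lra.
  rewrite leNgt; apply/negP => h; have := mmin m; rewrite ltnn ltW // => /(_ isT) //.
move=> P G PC cP cG.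
have P2 : (2 * m <= #|C|)%N by rewrite -cP subset_leq_card.
have cCP : (#|C :\: P| + 2 * m = #|C|)%N.
  by rewrite cardsD (setIidPr PC) cP subnK.
have FG u : (#|F u :|: G| <= #|F u| + m)%N.
  by apply: leq_trans (leq_card_setU _ _) _; rewrite leq_add2l.
have tr := @truncn_itv R (d1 * N); rewrite mulr_ge0 ?(ltW d10) ?(ltW N0) //= in tr.
have /andP[fm1 fm2] := tr isT.
apply: (matching U D k (Num.truncn (d1 * N)) (C :\: P) [set u in C :\: P | (#|nonnbr adj C u| <= m)%N]) => //.
- by apply: leq_trans cN; apply/subset_leq_card/subsetDl.
- by apply/subsetP => u; rewrite inE => /andP[].
- set C0 := [set u in _ | _].
  have : (#|C| <= #|C0| + 2 * m + #|big m|)%N.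
    rewrite -cCP -addnA [(2 * m + _)%N]addnC addnA leq_add2r.
    rewrite -(cardsID C0 (C :\: P)); apply: leq_add; apply: subset_leq_card.
      exact: subsetIr.
    apply/subsetP => u; rewrite in_setD !inE => /andP[h /andP[uP uC]].
    by move: h; rewrite uP uC /= -ltnNge => ->.
  rewrite -(ler_nat R) natrD natrD natrM.
  have : theta * N <= d1 / 4 * N by rewrite ler_pM2r.
  have : 0 <= d1 * N by rewrite mulr_ge0 // ltW.
  by move: mdN mbig cd dN1; rewrite -/N !mulrBl !mul1r; clear; lra.
- move=> u; rewrite inE => /andP[/setDP[uC _] um].
  have := card_forbidden irr (deg u) uC; have := FC u uC; have := FG u.
  move: um cCP P2; move: #|F u :|: G| #|F u| #|nonnbr adj C u| #|_ :\: C| #|_ :\: P| #|C|.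
  by clear; lia.
- move=> u /setDP[uC _]; rewrite truncn_ge_nat; last by rewrite mulr_ge0 // ltW.
  have : #|F u :|: G|%:R <= #|F u|%:R + m%:R :> R by rewrite -natrD ler_nat.
  have := FCd u uC; move: mdN dN1; have : 0 <= d1 * N by rewrite mulr_ge0 // ltW.
  by clear; lra.
Qed.

(** * The sparse remainder and the peeling *)

(** The [k] draws of a vertex are interchangeable, so any structured index type of size at most [k]
    can label some of them for the different stages. *)
Lemma Pr_more_draws (R : realType) (V J : finType) (D k : nat)
    (E : pred {ffun V * 'I_k -> 'I_D.+1}) (F : pred {ffun V * J -> 'I_D.+1}) : (#|J| <= k)%N ->
  (forall (h : J -> 'I_k) w, E w -> F [ffun c => w (c.1, h c.2)]) -> Pr R E <= Pr R F.
Proof.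
move=> Jk EF; pose h (j : J) : 'I_k := widen_ord Jk (enum_rank j).
have hI : injective (fun c : V * J => (c.1, h c.2)).
  move=> [u i] [v j] [-> e]; congr (_, _).
  by apply: enum_rank_inj; apply: val_inj.
rewrite -(Pr_inj R (color_gt0 D) F hI); apply: (le_Pr R (color_gt0 D)) => w.
exact: EF.
Qed.

Lemma colorable_on_more (R : realType) (V : finType) (D : nat) (adj : rel V) (W : {set V})
    (J : finType) (k : nat) : (#|J| <= k)%N ->
  Pr R (fun w : {ffun V * 'I_k -> 'I_D.+1} => ~~ colorable_on adj W w) <=
  Pr R (fun w : {ffun V * J -> 'I_D.+1} => ~~ colorable_on adj W w).
Proof.
move=> Jk; apply: Pr_more_draws => // h w; apply: contra => /existsP[f /forall_inP fP].
apply/existsP; exists f; apply/forall_inP => u uW.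
have /andP[/existsP[j fj] ->] := fP u uW; rewrite andbT.
by apply/existsP; exists (h j); move: fj; rewrite ffunE.
Qed.

Lemma extendable_more (R : realType) (V : finType) (D : nat) (adj : rel V) (C : {set V})
    (F : V -> {set 'I_D.+1}) (J : finType) (k : nat) : (#|J| <= k)%N ->
  Pr R (fun w : {ffun V * 'I_k -> 'I_D.+1} => ~~ extendable adj C F w) <=
  Pr R (fun w : {ffun V * J -> 'I_D.+1} => ~~ extendable adj C F w).
Proof.
move=> Jk; apply: Pr_more_draws => // h w; apply: contra => /existsP[f /forall_inP fP].
apply/existsP; exists f; apply/forall_inP => u uW.
have /andP[/existsP[j fj] ->] := fP u uW; rewrite andbT.
by apply/existsP; exists (h j); move: fj; rewrite ffunE.
Qed.

Lemma slack_d_le (R : realType) (D : nat) : (slack_d D)%:R <= (D.+1%:R : R) ^+ 4.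
Proof.
rewrite -natrX ler_nat /slack_d.
have -> : (D + D * D = D * D.+1)%N by rewrite mulnS.
have -> : (D.+1 ^ 4 = D.+1 * D.+1 * (D.+1 * D.+1))%N by rewrite !expnS expn0; lia.
have -> : (D * D.+1 * (D * D.+1) = D * D * (D.+1 * D.+1))%N by rewrite mulnACA.
apply: (@leq_trans ((D * D).+1 * (D.+1 * D.+1))%N).
  by rewrite [leqRHS]mulSn leq_add2r muln_gt0.
by rewrite leq_mul2r; apply/orP; right; lia.
Qed.

Lemma sparse_asymptotic (R : realType) (z : R) : 0 < z <= 1 ->
  exists L0 : R, forall (V : finType) (D k : nat) (adj : rel V) (W : {set V}) (L : R),
    let N : R := D.+1%:R in
  symmetric adj -> irreflexive adj -> (forall u, (#|[set w | adj u w]| <= D)%N) ->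
  L0 <= L -> L <= N -> #|V|%:R <= expR L -> L <= k%:R ->
  (forall v, v \in W -> #|hnbr adj W v|%:R <= (1 - z) * N \/
     z * N ^+ 2 <= #|nonedges adj W v|%:R) ->
  Pr R (fun w : {ffun V * 'I_k -> 'I_D.+1} => ~~ colorable_on adj W w) <= 4 * expR (- L).
Proof.
(* With [k3 >= L / 16] forced draws, [tau^k3 <= exp (- 2 L)], which survives a union over all
   vertices. *)
case/andP=> z0 z1; pose tau : R := expR (- 32).
have tau0 : 0 < tau by apply: expR_gt0.
have tau1 : tau <= 1 by rewrite -expR0 ler_expR oppr_le0.
pose m : R := tau * z * expR (- 3) / 16.
have m0 : 0 < m by rewrite divr_gt0 // !mulr_gt0 // expR_gt0.
have e3 : expR (- 3) <= 1 :> R by rewrite -[leRHS]expR0 ler_expR oppr_le0.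
have mz : m <= z.
  have : tau * z * expR (- 3) <= 1 * z * 1.
    by apply: ler_pM => //; rewrite ?expR_ge0 ?mulr_ge0 ?(ltW tau0) ?(ltW z0) // ler_pM2r.
  by rewrite /m; move: z0; clear; set x := tau * z * _; clearbody x; lra.
have mE : 16 * m = tau * z * expR (- 3) by rewrite /m; field.
clearbody m.
(* For a threshold [E] of at least [tau N / 8] this gives [lam E >= 4 N]; the drift [4 rho N] takes
   back at most [N]. *)
pose lam : R := 32 / tau; have lam0 : 0 < lam by rewrite divr_gt0.
pose M := Num.truncn (4 / tau).
have M1 : 4 / tau <= M.+1%:R by apply/ltW/truncnS_gt.
pose c : R := m ^+ 2 / 256; have c0 : 0 < c by rewrite divr_gt0 // exprn_gt0.
have cE : m ^+ 2 / 256 = c by [].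
(* Each round gains [exp (- c N / 2)], so [r >= 4 / c] rounds gain [exp (- 2 N) <= exp (- 2 L)]. *)
clearbody c; pose r := (Num.truncn (4 / c)).+1.
have r1 : 4 / c <= r%:R by apply/ltW/truncnS_gt.
pose ec : R := expR (lam * M.+1%:R); have ec0 : 0 < ec by apply: expR_gt0.
pose y1 : R := 64 / m * (256 * ec / m).
pose y2 : R := expR (2 * r%:R) * (10 / c) ^+ 5.
exists (16 + 8 / tau + 2 * r.+1%:R + y1 + y2).
move=> V D k adj W L N sym irr deg LL LN VL kL sparse.
have [L1 L2 L3 L4 L5] : [/\ 16 <= L, 8 / tau <= L, 2 * r.+1%:R <= L, y1 <= L & y2 <= L].
  have h1 : 0 <= 8 / tau by rewrite divr_ge0 // ltW.
  have h2 : 0 <= y1 by rewrite mulr_ge0 // divr_ge0 // ?mulr_ge0 // ltW.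
  have h3 : 0 <= y2 by rewrite mulr_ge0 ?expR_ge0 // exprn_ge0 // divr_ge0 // ltW.
  have h4 : 0 <= r.+1%:R :> R by [].
  move: LL h1 h2 h3 h4; move: (8 / tau) y1 y2 (r.+1%:R : R) => u v x y.
  by clear => LL h1 h2 h3 h4; split; lra.
have N0 : 0 < N by rewrite ltr0n.
have tN : 8 <= tau * N.
  by move: L2; rewrite ler_pdivrMr // [L * _]mulrC => /le_trans -> //; rewrite ler_pM2l.
have [g1 g2] : tau * N / 4 / 2 <= (Num.truncn (tau * N / 4))%:R /\ (Num.truncn (tau * N / 4))%:R <= tau * N / 4.
  by apply/andP/truncn_half; move: tN; clear; lra.
set g := Num.truncn (tau * N / 4) in g1 g2.
have [k1 k2] : L / 8 / 2 <= (Num.truncn (L / 8))%:R /\ (Num.truncn (L / 8))%:R <= L / 8.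
  by apply/andP/truncn_half; move: L1; clear; lra.
set k3 := Num.truncn (L / 8) in k1 k2.
have k30 : (0 < k3)%N by rewrite -(ltr_nat R); move: k1 L1; clear; lra.
have [G1 _ cG1] : exists2 G1 : {set 'I_D.+1}, G1 \subset setT & #|G1| = g.
  apply: subset_leq_card_ex; rewrite cardsT card_ord -(ler_nat R) -/N.
  have : tau * N <= 1 * N by rewrite ler_pM2r.
  by move: g2 N0; clear; lra.
pose J : finType := ('I_r.+1 + bool * ('I_k3 + 'I_k3))%type.
have Jk : (#|J| <= k)%N.
  rewrite card_sum card_prod card_sum card_bool !card_ord -(ler_nat R) natrD natrM natrD.
  by move: k2 L3 kL; move: (r.+1%:R : R) => x; clear; lra.
apply: le_trans (colorable_on_more _ _ _ _ Jk) _.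
pose p4 : R := expR (- (m / 2 * k3%:R)); pose pf : R := expR (- 2 * L).
have Ac : (slack_d D)%:R * slack_p D m * expR (2 * r%:R) <= expR (- (c / 2 * N)).
  have -> : slack_p D m = expR (- (c * N)) :> R by rewrite /slack_p cE mulNr.
  rewrite mulrAC mulrC; have -> : expR (- (c / 2 * N)) = expR (- (c * N)) * expR (c / 2 * N).
    by rewrite -expRD; congr expR; field.
  rewrite ler_pM2l ?expR_gt0 //.
  apply: (@le_trans _ _ (N ^+ 4 * expR (2 * r%:R))).
    by rewrite ler_pM2r ?expR_gt0 // slack_d_le.
  have -> : c / 2 * N = 5%:R * (c * N / 10) by field.
  rewrite [expR (5%:R * _)]expRM_natl; apply: (@le_trans _ _ ((c * N / 10) ^+ 5)); last first.
    have : 0 < c * N / 10 by rewrite divr_gt0 // mulr_gt0.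
    move: (c * N / 10) => x x0; rewrite lerXn2r ?nnegrE ?expR_ge0 ?(ltW x0) //.
    by apply: le_trans (expR_ge1Dx _); rewrite lerDr.
  have -> : (c * N / 10) ^+ 5 = N ^+ 4 * (N / (10 / c) ^+ 5) by field; rewrite gt_eqF.
  rewrite ler_pM2l ?exprn_gt0 // ler_pdivlMr ?exprn_gt0 ?divr_gt0 //.
  exact: le_trans L5 LN.
have A1 : expR (- (c / 2 * N)) <= 1.
  by rewrite -[leRHS]expR0 ler_expR oppr_le0 ltW // mulr_gt0 // divr_gt0.
have p4L : p4 <= expR (- (m * L / 32)).
  rewrite ler_expR lerN2; have : m * (L / 16) <= m * k3%:R by rewrite ler_pM2l //; move: k1; clear; lra.
  by clear; lra.
(* The chance [p4] of missing all free draws decays exponentially in [L], while [k3] is linear in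
   [L] and the factor [ec] does not depend on [L]. *)
have rho_le : 4 * rho k3 M lam p4 <= 1.
  rewrite /rho -/ec.
  pose y := m * L / 64.
  have yL : 256 * ec / m <= y.
    rewrite /y ler_pdivlMr // mulrC -ler_pdivrMl //; apply: le_trans L4; rewrite /y1.
    by apply: eq_leW; field; rewrite gt_eqF.
  have ey : y <= expR y by apply: le_trans (expR_ge1Dx _); rewrite lerDr.
  have p4y : p4 * (expR y * expR y) <= 1.
    rewrite -expRD; apply: (@le_trans _ _ (expR (- (m * L / 32)) * expR (y + y))).
      by rewrite ler_pM2r ?expR_gt0.
    by rewrite -expRD -[leRHS]expR0 ler_expR /y; clear; lra.
  have p40 : 0 < p4 by apply: expR_gt0.
  have k3y : k3%:R <= 8 / m * y.
    by rewrite /y; have -> : 8 / m * (m * L / 64) = L / 8 by field; rewrite gt_eqF.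
  have ecy : ec <= m / 256 * y.
    rewrite mulrC; have -> : y * (m / 256) = y * m / 256 by ring.
    by rewrite ler_pdivlMr // mulrC -ler_pdivrMr.
  have y0 : 0 < y by apply: lt_le_trans yL; rewrite divr_gt0 // mulr_gt0.
  have : p4 * ec * k3%:R <= p4 * (m / 256 * y) * (8 / m * y).
    apply: ler_pM => //; first by rewrite mulr_ge0 // ltW.
    by rewrite ler_pM2l.
  have -> : p4 * (m / 256 * y) * (8 / m * y) = p4 * (y * y) / 32 by field; rewrite gt_eqF.
  have : p4 * (y * y) <= p4 * (expR y * expR y).
    by rewrite ler_pM2l //; apply: ler_pM => //; apply: ltW.
  by move: p4y; clear; lra.
have eD2 : expR L * expR (- 2 * L) = expR (- L) by rewrite -expRD; congr expR; ring.
have L0 : 0 < L by move: L1; clear; lra.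
have rE : - (lam * g%:R) + 4 * rho k3 M lam p4 * N <= - 3 * N.
  have : 4 * rho k3 M lam p4 * N <= 1 * N by rewrite ler_pM2r.
  have : lam * (tau * N / 4 / 2) <= lam * g%:R by rewrite ler_pM2l.
  have -> : lam * (tau * N / 4 / 2) = 4 * N by rewrite /lam; field; rewrite gt_eqF.
  by clear; lra.
apply: le_trans (@sparse_coloring R V D r k3 k3 M g adj sym irr deg W G1 z m tau lam p4 pf
  sparse _ (le_trans mz z1) _ (ltW lam0) k30 (expR_ge0 _) _ _ _ (le_trans Ac A1)) _.
- by rewrite (ltW m0) /=; move: mz z0; clear; lra.
- rewrite cG1; have : tau * N / 8 * (z * N ^+ 2) * expR (- 3) <= g%:R * (z * N ^+ 2) * expR (- 3).
    rewrite ler_pM2r ?expR_gt0 // ler_pM2r ?mulr_gt0 ?exprn_gt0 //.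
    by move: g1; clear; lra.
  have -> : tau * N / 8 * (z * N ^+ 2) * expR (- 3) = (tau * z * expR (- 3)) / 8 * N ^+ 3.
    by rewrite !exprS expr0; ring.
  rewrite -mE; have -> : 16 * m / 8 * N ^+ 3 = 2 * m * N ^+ 3 by field.
  by [].
- rewrite cG1; have : D%:R / M.+1%:R <= tau * N / 4.
    rewrite ler_pdivrMr //; apply: (@le_trans _ _ (tau * N / 4 * (4 / tau))).
      have -> : tau * N / 4 * (4 / tau) = N by field; rewrite gt_eqF.
      by rewrite /N ler_nat.
    by rewrite ler_wpM2l // divr_ge0 // mulr_ge0 // ltW.
  by rewrite -/N; move: g2 tN; move: (D%:R / M.+1%:R) => q; clear; lra.
- have -> : p4 = expR (k3%:R * - (m / 2)) by rewrite /p4; congr expR; ring.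
  rewrite expRM_natl lerXn2r ?nnegrE ?expR_ge0 //.
    by move: mz z1; clear; lra.
  exact: expR_ge1Dx.
- rewrite /tau -expRM_natl /pf ler_expR; move: k1; clear; lra.
have VA : #|V|%:R * ((slack_d D)%:R * slack_p D m * expR (2 * r%:R)) ^+ r *
   (slack_p D m * expR (2 * r%:R)) <= expR (- L) :> R.
  have A0 : 0 <= (slack_d D)%:R * slack_p D m * expR (2 * r%:R) :> R.
    by rewrite !mulr_ge0 ?expR_ge0.
  have B1 : slack_p D m * expR (2 * r%:R) <= 1 :> R.
    apply: le_trans (le_trans Ac A1); rewrite -mulrA ler_peMl ?mulr_ge0 ?expR_ge0 //.
    by rewrite ler1n.
  have AL : ((slack_d D)%:R * slack_p D m * expR (2 * r%:R)) ^+ r <= expR (- 2 * L) :> R.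
    apply: (@le_trans _ _ (expR (- (c / 2 * N)) ^+ r)); first by rewrite lerXn2r // nnegrE expR_ge0.
    rewrite -expRM_natl ler_expR mulrN mulNr lerN2.
    apply: (@le_trans _ _ (4 / c * (c / 2 * N))).
      have -> : 4 / c * (c / 2 * N) = 2 * N by field; rewrite gt_eqF.
      by rewrite ler_pM2l.
    by rewrite ler_pM2r // mulr_gt0 // divr_gt0.
  apply: (@le_trans _ _ (expR L * expR (- 2 * L) * 1)); last by rewrite mulr1 eD2.
  by apply: ler_pM => //; rewrite ?mulr_ge0 ?exprn_ge0 ?expR_ge0 //; apply: ler_pM => //; rewrite ?exprn_ge0.
have VB : #|V|%:R * expR (- (lam * g%:R) + 4 * rho k3 M lam p4 * N) <= expR (- L).
  rewrite -eD2; apply: ler_pM => //; rewrite ?expR_ge0 // ler_expR; apply: le_trans rE _.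
  by move: LN L0; clear; lra.
have VC : 2 * pf * #|V|%:R <= 2 * expR (- L).
  by rewrite -mulrA ler_pM2l // -eD2 mulrC ler_pM2r // expR_gt0.
apply: le_trans (lerD VA (lerD VB VC)) _.
by move: (expR (- L)) => x; clear; lra.
Qed.

(** * Peeling off dense clusters *)

Section Peeling.
Variables (R : realType) (V : finType) (D k : nat) (adj : rel V).
Notation color := 'I_D.+1.
Notation draws := {ffun V * 'I_k -> color}.
Notation N := (D.+1%:R : R).
Hypothesis adj_sym : symmetric adj.
Hypothesis adj_irr : irreflexive adj.

Let cg := color_gt0 D.

(** The draws inside and outside [C] are independent. Once [U :\: C] is colored, [F u] collects the
    colors of the outside neighbors of [u], at most one for each. *)
Lemma peel_cluster (U C : {set V}) (q : R) : C \subset U ->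
  (forall F : V -> {set color}, (forall u, u \in C -> (#|F u| <= #|[set w | adj u w] :\: C|)%N) ->
     Pr R (fun w : draws => ~~ extendable adj C F w) <= q) ->
  Pr R (fun w : draws => ~~ colorable_on adj U w) <=
  Pr R (fun w : draws => ~~ colorable_on adj (U :\: C) w) + q.
Proof.
move=> CU ext; pose rest (w : draws) := colorable_on adj (U :\: C) w.
have q0 : 0 <= q.
  apply: le_trans (Pr_ge0 _ cg _) (ext (fun=> set0) _) => u _; by rewrite cards0.
apply: (@le_trans _ _ (Pr R (fun w : draws => ~~ rest w || (rest w && ~~ colorable_on adj U w)))).
  by apply: (le_Pr R cg) => w ->; case: (rest w).
apply: le_trans (PrU R cg _ _) _; rewrite lerD2l.
pose J := [set c : V * 'I_k | c.1 \in C].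
apply: (Pr_cond cg (J := J)) => b.
have restE a : rest (mix J a b) = rest b.
  have e u j : u \in U :\: C -> mix J a b (u, j) = b (u, j).
    by move=> /setDP[_ uC]; rewrite ffunE inE (negbTE uC).
  apply: eq_existsb => f; apply: eq_forallb => u.
  case uU: (u \in U :\: C) => //=; congr (_ && _).
  by apply: eq_existsb => j; rewrite e.
have [good|bad] := boolP (rest b); last first.
  by rewrite (Pr_eq0 R cg) // => a; rewrite restE (negbTE bad).
have /existsP[f /forall_inP fP] := good.
pose F u := f @: (([set w | adj u w] :\: C) :&: U).
apply: le_trans (ext F _); last first.
  move=> u _; apply: leq_trans (leq_imset_card _ _) _.
  exact/subset_leq_card/subsetIl.
apply: (le_Pr R cg) => a /andP[_]; apply: contra => /existsP[g /forall_inP gP].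
apply/existsP; exists [ffun u => if u \in C then g u else f u].
have gf u v : u \in C -> v \in U -> v \notin C -> adj u v -> g u != f v.
  move=> uC vU vC uv; have /and3P[_ + _] := gP u uC.
  by apply: contra => /eqP ->; apply: imset_f; rewrite !inE vU vC uv.
apply/forall_inP => u uU; rewrite !ffunE; apply/andP; split.
  case: ifPn => uC.
    have /and3P[/existsP[j /eqP gj] _ _] := gP u uC.
    by apply/existsP; exists j; rewrite ffunE inE uC gj.
  have /andP[/existsP[j /eqP fj] _] : [exists j, b (u, j) == f u] && [forall v in U :\: C, adj u v ==> (f u != f v)].
    by apply: fP; rewrite in_setD uC.
  by apply/existsP; exists j; rewrite ffunE inE (negbTE uC) fj.
apply/forall_inP => v vU; apply/implyP => uv; rewrite ffunE.
case: ifPn => uC; case: ifPn => vC.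
- by have /and3P[_ _ /forall_inP/(_ v vC)/implyP/(_ uv)] := gP u uC.
- exact: gf.
- by rewrite eq_sym; apply: gf => //; rewrite adj_sym.
have uUC : u \in U :\: C by rewrite in_setD uC.
have vUC : v \in U :\: C by rewrite in_setD vC.
by have /andP[_ /forall_inP/(_ v vUC)/implyP/(_ uv)] := fP u uUC.
Qed.

(* [C] drops the vertices with more than [s * N] non-neighbors inside the neighborhood;
   counting non-edges, there are fewer than [s * N] of them. *)
Lemma dense_cluster (U : {set V}) (s : R) (v : V) :
  (forall u, (#|[set w | adj u w]| <= D)%N) -> 0 < s <= 1 ->
  (1 - s ^+ 2) * N < #|hnbr adj U v|%:R -> #|nonedges adj U v|%:R < s ^+ 2 * N ^+ 2 ->
  exists C : {set V}, [/\ C \subset U, (#|C| <= D.+1)%N, (1 - 2 * s) * N <= #|C|%:R &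
    forall u, u \in C -> #|nonnbr adj C u|%:R <= s * N].
Proof.
move=> deg /andP[s0 s1] big few; set A := hnbr adj U v in big.
have N0 : 0 < N by rewrite ltr0n.
pose bad := [set u in A | s * N < #|nonnbr adj A u|%:R].
exists (A :\: bad); split.
- by apply/subsetP => u; rewrite in_setD in_set => /andP[_]; rewrite in_set => /andP[].
- apply: leqW; apply: leq_trans (deg v); apply: subset_leq_card; apply/subsetP => u.
  by rewrite in_setD => /andP[_]; rewrite in_set in_set => /andP[].
- have sum_le : (\sum_(u in bad) #|nonnbr adj A u| <= #|nonedges adj U v|)%N.
    rewrite -[leqRHS]sum1_card (partition_big fst (mem A)) /=; last first.
      by move=> p; rewrite in_set => /andP[].
    rewrite [leqLHS]big_mkcond [leqRHS]big_mkcond; apply: leq_sum => u _.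
    case: ifP => //; rewrite in_set => /andP[uA _]; rewrite uA.
    rewrite sum1_card -(card_imset (f := fun x => (u, x))); last by move=> x y [].
    apply: subset_leq_card; apply/subsetP => p /imsetP[x xn ->].
    move: xn; rewrite in_set => /and3P[xA xu ux].
    by rewrite unfold_in /= in_set /= -/A uA xA eq_sym xu ux eqxx.
  have : #|bad|%:R * (s * N) <= s * N * (s * N).
    apply: le_trans (_ : _ <= #|nonedges adj U v|%:R) _; last first.
      by apply: le_trans (ltW few) _; apply: eq_leW; ring.
    apply: le_trans (_ : _ <= (\sum_(u in bad) #|nonnbr adj A u|)%:R) _; last by rewrite ler_nat.
    rewrite mulr_natl -sumr_const natr_sum; apply: ler_sum => u; rewrite in_set => /andP[_].
    exact: ltW.
  rewrite ler_pM2r ?mulr_gt0 // => badN.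
  have : #|A|%:R <= #|A :\: bad|%:R + #|bad|%:R :> R.
    rewrite -natrD ler_nat -(cardsID bad A) addnC leq_add2l.
    exact/subset_leq_card/subsetIr.
  have : s ^+ 2 * N <= s * N by rewrite ler_pM2r // expr2 ler_piMr // ltW.
  by move: big badN; rewrite !mulrBl !mul1r; lra.
move=> u; rewrite in_setD in_set => /andP[nb uA].
apply: le_trans (_ : _ <= #|nonnbr adj A u|%:R) _; last by move: nb; rewrite uA /= -leNgt.
rewrite ler_nat; apply: subset_leq_card; apply/subsetP => x.
by rewrite in_set [x \in nonnbr _ _ _]in_set in_setD => /andP[/andP[_ ->] ->].
Qed.

End Peeling.

Theorem iid_asymptotic (R : realType) (eps : R) : 0 < eps <= 1 ->
  exists L0 : R, forall (V : finType) (D k : nat) (adj : rel V) (L : R), let N : R := D.+1%:R in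
  symmetric adj -> irreflexive adj -> (forall u, (#|[set w | adj u w]| <= D)%N) ->
  L0 <= L -> L <= N -> N <= 2 * expR L -> #|V|%:R <= expR L -> (1 + eps) * L <= k%:R ->
  Pr R (fun w : {ffun V * 'I_k -> 'I_D.+1} => ~~ colorable_on adj setT w) <=
  4 * expR (- L) + 42 * expR (- (eps / 4 * L)).
Proof.
move=> eps01; have /andP[e0 e1] := eps01.
have al01 : 0 < eps / 64 <= 1 by rewrite divr_gt0 //=; move: e1; clear; lra.
have [delta [L1 [d0 cluster]]] := cluster_asymptotic eps01 al01.
pose s : R := Num.min (delta / 4) (1 / 4).
have s0 : 0 < s by rewrite lt_min !divr_gt0.
have sd : s <= delta / 4 by rewrite ge_min lexx.
have s4 : s <= 1 / 4 by rewrite ge_min lexx orbT.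
have z01 : 0 < s ^+ 2 <= 1.
  by rewrite exprn_gt0 // exprn_ile1 ?ltW //; move: s4; clear; lra.
have [L2 sparse] := sparse_asymptotic z01.
exists (Num.max (64 / eps) (Num.max L1 L2)).
move=> V D k adj L N sym irr deg; rewrite !ge_max => /and3P[LL0 LL1 LL2] LN NL VL kL.
have N0 : 0 < N by rewrite ltr0n.
have eL : 64 <= eps * L by move: LL0; rewrite ler_pdivrMr // mulrC.
have L0 : 0 < L by rewrite -(pmulr_rgt0 _ e0); move: eL; clear; lra.
have [a1 a2] : eps * L / 32 / 2 <= (Num.truncn (eps * L / 32))%:R /\ (Num.truncn (eps * L / 32))%:R <= eps * L / 32.
  by apply/andP/truncn_half; move: eL; clear; lra.
(* The two blocks of [a] draws for the pairs use at most [eps L / 16], leaving at least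
   [(1 + eps / 2) L] for the matching. Rounding down at most halves [eps L / 32], whence
   [alpha = eps / 64]. *)
set a := Num.truncn (eps * L / 32) in a1 a2.
have eLL : eps * L <= L by rewrite ler_piMl // ltW.
have a2k : (2 * a <= k)%N.
  by rewrite -(ler_nat R) natrM; move: kL a2 eLL L0 eL; rewrite mulrDl mul1r; clear; lra.
pose X := expR (- ((1 + eps / 4) * L)).
have X0 : 0 < X by apply: expR_gt0.
pose J : finType := ((bool * 'I_a) + 'I_(k - 2 * a))%type.
have Jk : (#|J| <= k)%N by rewrite card_sum card_prod card_bool !card_ord subnKC.
have Lk : L <= k%:R by apply: le_trans kL; rewrite mulrDl mul1r lerDl ltW // mulr_gt0.
(* The cost [21 N X] of a cluster is charged to its at least [N / 2] vertices, [42 X] each. *)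
suff H (n : nat) (U : {set V}) : (#|U| < n)%N ->
    Pr R (fun w : {ffun V * 'I_k -> 'I_D.+1} => ~~ colorable_on adj U w) <=
    4 * expR (- L) + 42 * #|U|%:R * X.
  apply: le_trans (H #|V|.+1 setT _) _; first by rewrite ltnS max_card.
  rewrite lerD2l -mulrA ler_pM2l // cardsT.
  apply: (@le_trans _ _ (expR L * X)); first by rewrite ler_pM2r.
  by rewrite -expRD ler_expR; clear; lra.
elim: n U => // n IH U Un.
have [/existsP[v /and3P[vU big few]]|no] := boolP [exists v, [&& v \in U,
    (1 - s ^+ 2) * N < #|hnbr adj U v|%:R & #|nonedges adj U v|%:R < s ^+ 2 * N ^+ 2]]; last first.
  apply: (@le_trans _ _ (4 * expR (- L))); last first.
    by rewrite lerDl mulr_ge0 ?mulr_ge0 // ltW.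
  apply: (sparse V D k adj U L) => // v vU.
  have [h|h] := leP #|hnbr adj U v|%:R ((1 - s ^+ 2) * N); first by left.
  right; rewrite leNgt; apply: contra no => few; apply/existsP; exists v.
  by rewrite vU h few.
have s01 : 0 < s <= 1 by rewrite s0 /=; move: s4; clear; lra.
have [C [CU cC cbig hC]] := dense_cluster deg s01 big few.
have sN : s * N <= delta / 4 * N by rewrite ler_pM2r.
have sN4 : s * N <= 1 / 4 * N by rewrite ler_pM2r.
have C2 : N / 2 <= #|C|%:R.
  by move: cbig; rewrite mulrBl mul1r -mulrA -/N; move: sN4; clear; lra.
apply: le_trans (@peel_cluster R V D k adj sym U C (21 * N * X) CU _) _.
  move=> F FC; apply: le_trans (extendable_more _ _ _ _ Jk) _.
  apply: (cluster V D a (k - 2 * a)%N adj C F L) => //.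
  - by move: a1; clear; lra.
  - by move: a2 eLL L0; clear; lra.
  - rewrite natrB // natrM; move: kL a2 eL; rewrite !mulrDl !mul1r; clear; lra.
  - apply: le_trans cbig; rewrite -/N !mulrBl lerB // -mulrA.
    by have : 0 < delta * N by [rewrite mulr_gt0]; move: sN; clear; lra.
  - move=> u uC; apply: le_trans (hC u uC) _; rewrite -/N.
    by have : 0 < delta * N by [rewrite mulr_gt0]; move: sN; clear; lra.
have cUC : (#|U :\: C| + #|C| = #|U|)%N.
  by rewrite cardsD (setIidPr CU) subnK // subset_leq_card.
have C0 : (0 < #|C|)%N by rewrite -(ltr_nat R); move: C2 N0; clear; lra.
have UC : (#|U :\: C| < n)%N by move: Un cUC C0; clear; lia.
apply: le_trans (lerD (IH _ UC) (lexx _)) _.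
rewrite -cUC natrD -addrA lerD2l [42 * (_ + _)]mulrDr mulrDl lerD2l.
by rewrite ler_pM2r //; move: C2; clear; lra.
Qed.

(** * From draws to random lists *)

Section Coupling.
Variables (R : realType) (V X : finType) (k : nat).
Hypothesis X_gt0 : (0 < #|X|)%N.
Hypothesis k_le : (k <= #|X|)%N.

Definition ksets : {set {set X}} := [set S : {set X} | #|S| == k].

Definition image_of (x : {ffun 'I_k -> X}) : {set X} := [set x i | i : 'I_k].

Definition fillings (A : {set X}) : {set {set X}} := [set S in ksets | A \subset S].

Lemma superset_card (A : {set X}) : (#|A| <= k)%N -> exists S : {set X}, (A \subset S) && (#|S| == k).
Proof.
move=> Ak; have : (k - #|A| <= #|~: A|)%N by move: k_le; rewrite -(cardsC A); lia.
move=> /subset_leq_card_ex[B BA cB]; exists (A :|: B); rewrite subsetUl cardsU cB.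
rewrite (_ : A :&: B = set0) ?cards0 ?subn0 ?subnKC ?eqxx //.
by apply/eqP; rewrite setI_eq0 disjoint_sym disjoints_subset.
Qed.

Lemma card_fillings_gt0 (x : {ffun 'I_k -> X}) : (0 < #|fillings (image_of x)|)%N.
Proof.
have [|S /andP[xS cS]] := @superset_card (image_of x).
  by apply: leq_trans (leq_imset_card _ _) _; rewrite cardT size_enum_ord.
by apply/card_gt0P; exists S; rewrite !inE cS xS.
Qed.

(* Probability that a uniform filling of the image of a random word is [S]. *)
Definition fill_weight (S : {set X}) (x : {ffun 'I_k -> X}) : R :=
  (S \in fillings (image_of x))%:R / #|fillings (image_of x)|%:R.

Lemma sum_fill_weight x : \sum_S fill_weight S x = 1.
Proof.
rewrite -mulr_suml -natr_sum -[X in X / _]/((\sum_S nat_of_bool (S \in fillings (image_of x)))%:R).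
have -> : (\sum_S (S \in fillings (image_of x)) = #|fillings (image_of x)|)%N.
  by rewrite -sum1_card [RHS]big_mkcond; apply: eq_bigr => S _; case: (S \in _).
by rewrite divff // pnatr_eq0 -lt0n card_fillings_gt0.
Qed.

(** A transposition of colors preserves the law of the random word and commutes with filling up. *)
Lemma Ex_fill_swap (a b : X) (S : {set X}) :
  Ex (fill_weight (tperm a b @: S)) = Ex (fill_weight S).
Proof.
pose p := tperm a b; have pK : involutive p by apply: tpermK.
have pI : injective p by apply: perm_inj.
have pS (A : {set X}) : p @: (p @: A) = A.
  by rewrite -imset_comp -[RHS]imset_id; apply: eq_imset => x /=; rewrite pK.
have pSI : injective (fun A : {set X} => p @: A) by move=> A B /= e; rewrite -(pS A) e pS.
have psub (A B : {set X}) : (p @: A \subset p @: B) = (A \subset B).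
  by apply/idP/idP => [/(imsetS p)|/(imsetS p)//]; rewrite !pS.
pose sw (x : {ffun 'I_k -> X}) : {ffun 'I_k -> X} := [ffun i => p (x i)].
have swK : involutive sw by move=> x; apply/ffunP => i; rewrite !ffunE pK.
have im x : image_of (sw x) = p @: image_of x.
  by rewrite /image_of -imset_comp; apply: eq_imset => i /=; rewrite ffunE.
have fil (A B : {set X}) : (p @: B \in fillings (p @: A)) = (B \in fillings A).
  by rewrite !inE psub card_imset.
have cfil (A : {set X}) : #|fillings (p @: A)| = #|fillings A|.
  have -> : fillings (p @: A) = (fun B : {set X} => p @: B) @: fillings A.
    apply/setP => B; apply/idP/imsetP => [BA|[C CA ->]]; last by rewrite fil.
    by exists (p @: B); rewrite ?pS // -fil pS.
  by rewrite card_imset.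
rewrite /Ex; congr (_ / _); rewrite (reindex_inj (inv_inj swK)) /=.
by apply: eq_bigr => x _; rewrite /fill_weight im fil cfil.
Qed.

(** Sets of equal size are joined by transpositions, each bringing [S] closer to [T]. So the law of
    the filling is constant on [k]-sets, and its total mass identifies it as uniform. *)
Lemma Ex_fill_eq (S T : {set X}) : #|S| = #|T| -> Ex (fill_weight S) = Ex (fill_weight T).
Proof.
have [n] := ubnP #|S :\: T|; elim: n S => // n IH S Sn ST.
have [ST0|[a]] := set_0Vmem (S :\: T).
  have : S \subset T by rewrite -setD_eq0 ST0.
  by move=> sST; congr (Ex (fill_weight _)); apply/eqP; rewrite eqEcard sST ST leqnn.
rewrite in_setD => /andP[aT aS].
have [b] : exists b, b \in T :\: S.
  apply/card_gt0P; have := cardsID T S; have := cardsID S T; rewrite setIC ST => <- /eqP.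
  rewrite eqn_add2l => /eqP <-; apply/card_gt0P; exists a; by rewrite in_setD aT aS.
rewrite in_setD => /andP[bS bT].
rewrite -(Ex_fill_swap a b); apply: IH; last by rewrite card_imset //; apply: perm_inj.
have ab : a != b by apply: contra bS => /eqP <-.
apply: leq_trans (_ : #|(S :\: T) :\ a| < n)%N; last first.
  by move: Sn; rewrite (cardsD1 a (S :\: T)) in_setD aT aS.
rewrite ltnS; apply: subset_leq_card; apply/subsetP => x.
rewrite in_setD => /andP[xT /imsetP[y yS xE]].
move: xE; have [->|ya] := eqVneq y a; first by rewrite tpermL => xb; rewrite xb bT in xT.
have [yb|yb] := eqVneq y b; first by rewrite -yb yS in bS.
by rewrite tpermD 1?eq_sym // in_setD1 in_setD xT => ->; rewrite ya yS.
Qed.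

Lemma Ex_fill S : Ex (fill_weight S) = uniform_mass R ksets S.
Proof.
rewrite /uniform_mass; case: ifPn => Sk; last first.
  rewrite (eq_Ex (g := fun=> 0)) ?(Ex_cst _ X_gt0) // => x.
  by rewrite /fill_weight inE (negbTE Sk) mul0r.
have tot : \sum_(T in ksets) Ex (fill_weight T) = 1.
  rewrite -Ex_sum -[RHS](Ex_cst 'I_k X_gt0 1); apply: eq_Ex => x.
  rewrite -(sum_fill_weight x) [LHS]big_mkcond; apply: eq_bigr => T _.
  by case: ifPn => // Tk; rewrite /fill_weight inE (negbTE Tk) mul0r.
have K0 : #|ksets|%:R != 0 :> R.
  by rewrite pnatr_eq0 -lt0n; apply/card_gt0P; exists S.
apply: (mulfI K0); rewrite divff // -[RHS]tot mulr_natl -sumr_const.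
apply: eq_bigr => T Tk; apply: Ex_fill_eq.
by move: Sk Tk; rewrite !inE => /eqP -> /eqP ->.
Qed.

Definition images (x : {ffun V * 'I_k -> X}) : {ffun V -> {set X}} :=
  [ffun v => image_of [ffun i => x (v, i)]].

Lemma Ex_blocks (phi : V -> {ffun 'I_k -> X} -> R) :
  Ex (fun x : {ffun V * 'I_k -> X} => \prod_v phi v [ffun i => x (v, i)]) =
  \prod_v Ex (phi v).
Proof.
have Y0 : (0 < #|{: {ffun 'I_k -> X}}|)%N by rewrite card_ffun expn_gt0 X_gt0.
rewrite -[RHS](Ex_prod phi).
pose cur (x : {ffun V * 'I_k -> X}) : {ffun V -> {ffun 'I_k -> X}} :=
  [ffun v => [ffun i => x (v, i)]].
pose unc (y : {ffun V -> {ffun 'I_k -> X}}) : {ffun V * 'I_k -> X} :=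
  [ffun c => y c.1 c.2].
have curK : cancel cur unc by move=> x; apply/ffunP => -[v i]; rewrite !ffunE.
have uncK : cancel unc cur by move=> y; apply/ffunP => v; apply/ffunP => i; rewrite !ffunE.
have cE : #|{: {ffun V * 'I_k -> X}}| = #|{: {ffun V -> {ffun 'I_k -> X}}}|.
  exact: bij_eq_card (Bijective curK uncK).
rewrite /Ex cE; congr (_ / _); rewrite [RHS](reindex cur); last by exists unc.
by apply: eq_bigr => x _; apply: eq_bigr => v _; rewrite ffunE.
Qed.

Lemma sum_prod_fill (x : {ffun V * 'I_k -> X}) :
  \sum_(f : {ffun V -> {set X}}) \prod_v fill_weight (f v) [ffun i => x (v, i)] = 1.
Proof.
rewrite -(bigA_distr_bigA (fun v S => fill_weight S [ffun i => x (v, i)])) /=.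
by apply: big1 => v _; apply: sum_fill_weight.
Qed.

(* Filling the image of [k] uniform draws up to a uniform [k]-set gives a uniform [k]-set. *)
Lemma coupling (E : pred {ffun V -> {set X}}) :
  (forall f g : {ffun V -> {set X}}, (forall v, f v \subset g v) -> E f -> E g) ->
  Pr R (fun x : {ffun V * 'I_k -> X} => E (images x)) <=
  prob_indep (fun _ : V => uniform_mass R ksets) E.
Proof.
move=> Emono; rewrite /prob_indep.
apply: (@le_trans _ _ (\sum_(f : {ffun V -> {set X}} | E f)
   Ex (fun x : {ffun V * 'I_k -> X} => \prod_v fill_weight (f v) [ffun i => x (v, i)]))); last first.
  apply: ler_sum => f _; rewrite (Ex_blocks (fun v => fill_weight (f v))).
  by apply: eq_leW; apply: eq_bigr => v _; apply: Ex_fill.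
rewrite -Ex_sum; apply: (le_Ex X_gt0) => x.
have w0 (f : {ffun V -> {set X}}) : 0 <= \prod_v fill_weight (f v) [ffun i => x (v, i)].
  by apply: prodr_ge0 => v _; rewrite divr_ge0.
case Ex1 : (E (images x)); last by apply: sumr_ge0.
rewrite -[leLHS](sum_prod_fill x) [leRHS]big_mkcond; apply: ler_sum => f _.
case: ifPn => // nE; apply: eq_leW.
have [/forallP sub|] := boolP [forall v, images x v \subset f v].
  by case/negP: nE; apply: Emono Ex1.
rewrite negb_forall => /existsP[v nv]; rewrite (bigD1 v) //= /fill_weight inE.
by move: nv; rewrite ffunE => /negbTE ->; rewrite andbF !mul0r.
Qed.

Lemma prob_indep_le1 (E : pred {ffun V -> {set X}}) :
  prob_indep (fun _ : V => uniform_mass R ksets) E <= 1.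
Proof.
have K0 : #|ksets|%:R != 0 :> R.
  rewrite pnatr_eq0 -lt0n; apply/card_gt0P.
  by have [|S /andP[_ cS]] := @superset_card set0; [rewrite cards0 | exists S; rewrite inE].
have m0 S : 0 <= uniform_mass R ksets S.
  by rewrite /uniform_mass; case: ifP => // _; rewrite invr_ge0.
apply: (@le_trans _ _ (\sum_(f : {ffun V -> {set X}}) \prod_v uniform_mass R ksets (f v))).
  rewrite /prob_indep big_mkcond; apply: ler_sum => f _; case: ifP => // _.
  exact: prodr_ge0.
rewrite -(bigA_distr_bigA (fun (_ : V) S => uniform_mass R ksets S)) /= big1 // => v _.
transitivity (\sum_(S in ksets) (#|ksets|%:R : R)^-1); first by rewrite [RHS]big_mkcond.
by rewrite sumr_const -[LHS]mulr_natl divff.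
Qed.

End Coupling.

(** * Full lists, and the passage to random lists *)

Lemma greedy_coloring (V : finType) (D : nat) (adj : rel V) : symmetric adj -> irreflexive adj ->
  (forall u, (#|[set w | adj u w]| <= D)%N) ->
  exists f : {ffun V -> 'I_D.+1}, proper_coloring adj f.
Proof.
move=> sym irr deg.
suff [f fP] : exists f : {ffun V -> 'I_D.+1},
    {in [set: V] &, forall u v, adj u v -> f u != f v}.
  exists f; apply/forallP => u; apply/forallP => v; apply/implyP; apply: fP; exact: in_setT.
have [n] := ubnP #|[set: V]|; elim: n [set: V] => // n IH U Un.
have [->|[u uU]] := set_0Vmem U; first by exists [ffun=> ord0] => u v; rewrite inE.
have [|f fP] := IH (U :\ u); first by move: Un; rewrite (cardsD1 u) uU.
have [c cN] : exists c, c \notin f @: [set w | adj u w].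
  have : (0 < #|~: (f @: [set w | adj u w])|)%N.
    have := cardsC (f @: [set w | adj u w]); rewrite card_ord => e.
    have : (#|f @: [set w | adj u w]| <= D)%N by apply: leq_trans (leq_imset_card _ _) (deg u).
    by move: e; move: #|f @: _| #|~: _| => x y; clear; lia.
  by move=> /card_gt0P[c]; rewrite inE; exists c.
have cf v : adj u v -> c != f v.
  by move=> uv; apply: contra cN => /eqP ->; apply: imset_f; rewrite inE.
exists [ffun v => if v == u then c else f v] => v w vU wU vw; rewrite !ffunE.
have [vu|vu] := eqVneq v u; have [wu|wu] := eqVneq w u.
- by move: vw; rewrite vu wu irr.
- by apply: cf; rewrite -vu.
- by rewrite eq_sym; apply: cf; rewrite -wu sym.
- by apply: fP => //; rewrite in_setD1 ?vu ?wu.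
Qed.

Lemma list_colorable_mono (V C : finType) (adj : rel V) (L L' : {ffun V -> {set C}}) :
  (forall v, L v \subset L' v) -> list_colorable adj L -> list_colorable adj L'.
Proof.
move=> LL' /existsP[f /andP[pf /forallP fL]]; apply/existsP; exists f.
rewrite /list_coloring pf; apply/forallP => v; exact: subsetP (LL' v) _ (fL v).
Qed.

(** When the list size is capped at [D + 1], every list is the whole palette and greedy coloring
    succeeds with certainty. *)
Lemma full_lists (R : realType) (V : finType) (D : nat) (adj : rel V) :
  symmetric adj -> irreflexive adj -> (forall u, (#|[set w | adj u w]| <= D)%N) ->
  1 <= prob_indep (fun _ : V => uniform_mass R (k_subsets D D.+1)) (fun L => list_colorable adj L).
Proof.
move=> sym irr deg; have KE : k_subsets D D.+1 = [set setT].
  apply/setP => S; rewrite !inE eqEcard subsetT /= cardsT card_ord.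
  by rewrite eqn_leq; have := max_card (mem S); rewrite card_ord => ->.
have good : list_colorable adj [ffun _ : V => [set: 'I_D.+1]].
  have [f pf] := greedy_coloring sym irr deg; apply/existsP; exists f.
  by rewrite /list_coloring pf; apply/forallP => v; rewrite ffunE in_setT.
rewrite /prob_indep (bigD1 [ffun _ : V => [set: 'I_D.+1]]) //=.
have -> : \prod_(i : V) uniform_mass R (k_subsets D D.+1) ([ffun _ : V => [set: 'I_D.+1]] i) = 1.
  by apply: big1 => v _; rewrite ffunE KE /uniform_mass set11 cards1 invr1.
rewrite lerDl; apply: sumr_ge0 => f _; apply: prodr_ge0 => v _.
by rewrite /uniform_mass; case: ifP => // _; rewrite invr_ge0.
Qed.

Lemma images_colorable (V : finType) (D k : nat) (adj : rel V) (x : {ffun V * 'I_k -> 'I_D.+1}) :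
  colorable_on adj setT x -> list_colorable adj (images x).
Proof.
move=> /existsP[f /forall_inP fP]; apply/existsP; exists f; apply/andP; split.
  apply/forallP => u; apply/forallP => v.
  by have /andP[_ /forall_inP h] := fP u (in_setT u); apply: h; apply: in_setT.
apply/forallP => v; rewrite ffunE.
have /andP[/existsP[j /eqP <-] _] := fP v (in_setT v).
by apply/imsetP; exists j; rewrite ?ffunE.
Qed.

Theorem theorem1p2 (R : realType) (eps : R) (eps_gt0 : 0 < eps) :
  forall delta : R, 0 < delta ->
  exists N : nat, forall n : nat, (N <= n)%N ->
  forall (D : nat) (V : finType) (adj : rel V),
    #|V| = n -> simple_graph adj ->
    (max_degree adj <= D)%N -> (D <= n)%N ->
    `|prob_list_colorable eps D adj - 1| < delta.
Proof.
move=> delta delta0; pose e1 : R := Num.min eps 1.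
have e10 : 0 < e1 by rewrite lt_min eps_gt0 ltr01.
have e1eps : e1 <= eps by rewrite ge_min lexx.
have e11 : e1 <= 1 by rewrite ge_min lexx orbT.
have e101 : 0 < e1 <= 1 by rewrite e10.
have [L0 iid] := iid_asymptotic e101.
(* With [exp (- x) <= 1 / x], the final error is at most [(4 + 42 * 4 / e1) / L]. *)
pose Ls := Num.max 1 (Num.max L0 ((4 + 168 / e1) / delta + 1)).
exists (Num.truncn (expR Ls)).+1 => n nN D V adj Vn [sym irr] maxD Dn.
pose L := ln (n%:R : R).
have n0 : 0 < n%:R :> R by rewrite ltr0n; apply: leq_trans nN.
have EL : expR L = n%:R by rewrite lnK // posrE.
have LsL : Ls <= L.
  rewrite -ler_expR EL; apply: le_trans (ltW (truncnS_gt _)) _.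
  by rewrite ler_nat.
have /and3P[L1 L2 L3] : [&& 1 <= L, L0 <= L & (4 + 168 / e1) / delta + 1 <= L].
  by rewrite -!ge_max.
have deg u : (#|[set w | adj u w]| <= D)%N.
  by apply: leq_trans maxD; apply: (leq_bigmax u).
rewrite /prob_list_colorable Vn /list_size.
set K := `|Num.ceil _|%N; have LK : (1 + eps) * L <= K%:R.
  have c0 : 0 <= (1 + eps) * L by rewrite mulr_ge0 //; move: eps_gt0 L1; clear; lra.
  rewrite /K natr_absz ger0_norm ?ceil_ge0 //; last by apply: lt_le_trans c0; rewrite ltrN10.
  exact: ceil_ge.
(* Uncapped lists force [L <= K <= D + 1], which supplies the hypothesis [L <= N] of the asymptotic
   bound. *)
have [DK|KD] := leqP D.+1 K.
  have p1 := full_lists R sym irr deg.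
  have DX : (D.+1 <= #|{: 'I_D.+1}|)%N by rewrite card_ord.
  have p2 := @prob_indep_le1 R V 'I_D.+1 D.+1 (color_gt0 D) DX (fun M => list_colorable adj M).
  have -> : prob_indep (fun _ : V => uniform_mass R (k_subsets D D.+1)) (fun M => list_colorable adj M) = 1.
    by apply/eqP; rewrite eq_le p1 p2.
  by rewrite subrr normr0.
have KX : (K <= #|{: 'I_D.+1}|)%N by rewrite card_ord ltnW.
have p2 := @prob_indep_le1 R V 'I_D.+1 K (color_gt0 D) KX (fun M => list_colorable adj M).
have p1 := @coupling R V 'I_D.+1 K (color_gt0 D) KX (fun M => list_colorable adj M)
  (fun f g fg => list_colorable_mono fg).
set P := prob_indep _ _ in p1 p2 *.
have LN : L <= D.+1%:R.
  apply: (@le_trans _ _ K%:R); last by rewrite ler_nat ltnW.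
  apply: le_trans LK; rewrite mulrDl mul1r lerDl mulr_ge0 //; move: eps_gt0 L1; clear; lra.
have NL : D.+1%:R <= 2 * expR L.
  rewrite EL -natr1; have : D%:R <= n%:R :> R by rewrite ler_nat.
  have : 1 <= n%:R :> R by rewrite ler1n; apply: leq_trans nN.
  by clear; lra.
have VL : #|V|%:R <= expR L by rewrite EL Vn.
have kL : (1 + e1) * L <= K%:R.
  by apply: le_trans LK; rewrite ler_wpM2r //; move: L1 e1eps; clear; lra.
have fail := iid V D K adj L sym irr deg L2 LN NL VL kL.
have cov : 1 - P <= 4 * expR (- L) + 42 * expR (- (e1 / 4 * L)).
  apply: le_trans fail; rewrite (PrC R (color_gt0 D)) lerD2l lerN2; apply: le_trans p1.
  apply: (le_Pr R (color_gt0 D)) => x; exact: images_colorable.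
have Lp : 0 < L by move: L1; clear; lra.
have b1 : expR (- L) <= L^-1 by apply: expRN_le_inv.
have b2 : expR (- (e1 / 4 * L)) <= 4 / e1 * L^-1.
  apply: le_trans (expRN_le_inv _) _; first by rewrite mulr_gt0 // divr_gt0.
  by rewrite invfM invf_div.
have small : (4 + 168 / e1) * L^-1 < delta.
  rewrite ltr_pdivrMr // [delta * L]mulrC -ltr_pdivrMr //.
  by apply: lt_le_trans L3; rewrite ltrDl.
rewrite distrC ger0_norm ?subr_ge0 //; apply: le_lt_trans cov _; apply: le_lt_trans small.
have -> : (4 + 168 / e1) * L^-1 = 4 * L^-1 + 42 * (4 / e1 * L^-1) by ring.
by apply: lerD; rewrite ler_pM2l.
Qed.
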